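(* Let $\underline A=(A_1,\dots,A_m)\in{\rm Mat}(d,\mathbb{R})^m$ and let $1\le i\le k\le d$. Assume: (1) $\underline A$ has constant rank $k$, i.e. $\mathrm{rank}(A_j)=k$ for all $1\le j\le m$; (2) $\mathrm{rank}(A_a A_b)=k$ for every $a,b\in\{1,\dots,m\}$; (3) $L_i(\underline A)>L_{i+1}(\underline A)$; (4) the random cocycle $\wedge_i\underline A=(\wedge_iA_1,\dots,\wedge_iA_m)$ is irreducible. Then: (a) there exist a neighborhood $\mathcal V$ of $\underline A$ in $\mathcal C_k(d)$ and constants $\varepsilon_0>0$, $C<\infty$, $c>0$ such that for every $\underline B\in\mathcal V$, every $n\in\mathbb N$ and every $0<\varepsilon<\varepsilon_0$, $$\mathbf p\Big\{\omega\in X:\ \Big|\tfrac1n\log\|\wedge_i\mathbf B^n(\omega)\|-L_1(\wedge_i\underline B)\Big|>\varepsilon\Big\}\le C\,e^{-n\,c\,\varepsilon^2},$$ i.e. the cocycles $\wedge_i\underline B$, $\underline B\in\mathcal V$, satisfy a uniform large deviations estimate of exponential type; (b) the function $\mathcal C_k(d)\ni\underline B\mapsto L_1(\underline B)+\cdots+L_i(\underline B)$ is Hölder continuous on some neighborhood of $\underline A$ in $\mathcal C_k(d)$.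
   Context: Fix integers $m,d\ge1$ and a probability vector $\underline p=(p_1,\dots,p_m)$ with all $p_j>0$. Let $X=\{1,\dots,m\}^{\mathbb N}$ with the Bernoulli product measure $\mathbf p=\underline p^{\mathbb N}$ and the left shift $\sigma$. A random cocycle is a tuple $\underline B=(B_1,\dots,B_m)\in\mathscr C(d):={\rm Mat}(d,\mathbb R)^m$ (with its Euclidean topology/metric as $\mathbb R^{md^2}$); it defines $\mathbf B(\omega)=B_{\omega_0}$ and $\mathbf B^n(\omega)=B_{\omega_{n-1}}\cdots B_{\omega_1}B_{\omega_0}$. For $1\le j\le d$, the $j$-th Lyapunov exponent $L_j(\underline B)\in[-\infty,\infty)$ is the $\mathbf p$-almost surely constant limit $\lim_{n\to\infty}\frac1n\log s_j(\mathbf B^n(\omega))$, where $s_1\ge\dots\ge s_d\ge0$ are singular values (with $\log0=-\infty$). $\mathcal C_k(d)$ denotes the set of $\underline B\in\mathscr C(d)$ with $\mathrm{rank}(B_j)=k$ for all $j$, with the subspace topology. For a matrix $A$, $\wedge_iA$ is its $i$-th exterior power (the matrix of $i\times i$ minors), so $\wedge_i(AB)=\wedge_iA\,\wedge_iB$ and $\|\wedge_iA\|=s_1(A)\cdots s_i(A)$; $\wedge_i\underline B=(\wedge_iB_1,\dots,\wedge_iB_m)$ and $\wedge_i\mathbf B^n(\omega)=\wedge_i(\mathbf B^n(\omega))$; $L_1(\wedge_i\underline B)=L_1(\underline B)+\dots+L_i(\underline B)$. A tuple $(D_1,\dots,D_m)$ of $N\times N$ real matrices is called reducible if there exist subspaces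 $V_1,\dots,V_m$ with $\{0\}\ne V_j\subsetneq\mathrm{Range}(D_j)$ and $D_aV_b=V_a$ for all $a,b\in\{1,\dots,m\}$; otherwise it is irreducible. *)

(* Defs.v *)
From HB Require Import structures.
From mathcomp Require Import all_boot all_order all_algebra.
From mathcomp Require Import all_classical all_reals all_analysis.
Set Implicit Arguments. Unset Strict Implicit. Unset Printing Implicit Defensive.
Import Order.TTheory GRing.Theory Num.Theory.
Local Open Scope classical_set_scope.
Local Open Scope ring_scope.

(* Conventions: the alphabet {1,...,m} of the paper is 'I_m.+1 here
   (so the paper's m is our m.+1 >= 1); indices are 0-based. *)

(** The alphabet, with a point so that the sequence space is a pointedType. *)
Definition letter (m : nat) := 'I_m.+1.
HB.instance Definition _ m := Choice.on (letter m).
HB.instance Definition _ m := isPointed.Build (letter m) ord0.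

Section Defs.
Variable R : realType.

Definition vnorm (n : nat) (v : 'cV[R]_n) : R := Num.sqrt (\sum_(r < n) v r 0 ^+ 2).

Definition opnorm (n : nat) (M : 'M[R]_n) : R :=
  sup [set vnorm (M *m v) | v in [set v : 'cV[R]_n | vnorm v <= 1]].

(** j-th singular value (1-based), by the Courant-Fischer min-max formula:
    s_j(A) = max over j-dimensional subspaces V of min over unit v in V of |Av|.
    A j-dimensional subspace V of R^d is the row space of a rank-j matrix
    U : 'M_(j,d), its vectors being (x *m U)^T.  By convention s_j = 0 for
    j = 0 or j > d (so that L_{d+1} = -oo). *)
Definition singval (d : nat) (j : nat) (A : 'M[R]_d) : R :=
  if (0 < j <= d)%N then
    sup [set inf [set vnorm (A *m (x *m U)^T) |
                  x in [set x : 'rV[R]_j | vnorm (x *m U)^T = 1]]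
        | U in [set U : 'M[R]_(j, d) | \rank U = j]]
  else 0.

Definition logE (x : R) : \bar R := if x <= 0 then -oo%E else (ln x)%:E.

(** Exterior power: the matrix of i x i minors, indexed by the i-element
    subsets of 'I_d (each listed in increasing order), the subsets being
    enumerated by enum_val. *)
Definition isub (d i : nat) := {S : {set 'I_d} | #|S| == i}.

Definition sub_elt (d i : nat) (S : isub d i) (r : 'I_i) : 'I_d :=
  @enum_val _ (mem (val S)) (cast_ord (esym (eqP (valP S))) r).

Definition minor (d i : nat) (A : 'M[R]_d) (S T : isub d i) : R :=
  \det (\matrix_(r < i, c < i) A (sub_elt S r) (sub_elt T c)).

Definition extpow (d i : nat) (A : 'M[R]_d) : 'M[R]_(#|{: isub d i}|) :=
  \matrix_(r, c) minor A (enum_val r) (enum_val c).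

Definition cocycle (m N : nat) := 'I_m.+1 -> 'M[R]_N.

Definition ext_cocycle m d i (B : cocycle m d) : cocycle m #|{: isub d i}| :=
  fun a => extpow i (B a).

Fixpoint iterB m N (B : cocycle m N) (n : nat) (w : nat -> letter m) : 'M[R]_N :=
  match n with
  | 0 => 1%:M
  | n'.+1 => B (w n') *m iterB B n' w
  end.

Definition cylinders (m : nat) : set (set (nat -> letter m)) :=
  [set C | exists n (w : nat -> letter m),
      C = [set om | forall t, (t < n)%N -> om t = w t]].

Definition Xspace (m : nat) := g_sigma_algebraType (@cylinders m).

Definition is_bernoulli m (p : 'I_m.+1 -> R) (P : probability (Xspace m) R) :=
  forall n (w : nat -> letter m),
    P [set om | forall t, (t < n)%N -> om t = w t] = (\prod_(t < n) p (w t))%:E.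

Definition lyap m N (P : probability (Xspace m) R) (B : cocycle m N) (j : nat) : \bar R :=
  xget 0%E [set l : \bar R | {ae P, forall om : Xspace m,
     ((fun n : nat => ((n%:R)^-1)%:E * logE (singval j (iterB B n om)))%E
        @ \oo --> l)}].

Definition cdist m d (B B' : cocycle m d) : R :=
  Num.sqrt (\sum_(a < m.+1) \sum_(r < d) \sum_(c < d) (B a r c - B' a r c) ^+ 2).

(** Irreducibility of a tuple (D_a): reducible iff there are subspaces V_a
    (row spaces of matrices) with 0 <> V_a strictly contained in Range(D_a)
    and D_a V_b = V_a for all a, b. Range(D) = row space of D^T; the image
    of the row space of V under v |-> D v is the row space of V *m D^T. *)
Definition reducible m N (D : cocycle m N) : Prop :=
  exists V : 'I_m.+1 -> 'M[R]_N,
    (forall a, V a != 0) /\ (forall a, (V a < (D a)^T)%MS) /\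
    (forall a b, (V b *m (D a)^T == V a)%MS).

Definition irreducible_cocycle m N (D : cocycle m N) : Prop := ~ reducible D.

End Defs.

(* Main.v *)
(** Fix Y_a, S_a with Y_a A_a S_a = 1. Every B of constant rank k near A factors
    as B_a = Q_a W_a through R^k, with Q and W Lipschitz in B, so that the i-th
    exterior power of B^n is, up to bounded outer factors, a product of the
    transition matrices T_ab = wedge_i (W_a Q_b) along the letters; these are
    invertible by (2), and irreducibility passes from wedge_i A to T.

    Kingman's theorem identifies L_1 + ... + L_j with the growth rate of the j-th
    exterior power, for all j <= k, so (3) says that long products of the T_ab are
    exponentially close to rank one. Then |M_n v| / (|M_n| |v|) stabilises in n,
    and irreducibility together with a zero-one argument keeps it away from 0
    with probability close to 1, uniformly in v. Hence for some n and alpha the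
    projective action of T contracts alpha-Hoelder distances on average over n
    letters, which is an open condition on T.

    Under this contraction the mean of log |M_n v| depends on v and on the first
    letter only up to a bounded error. So it is n L + O(1), its martingale
    differences are bounded, and Azuma's inequality gives (a), with constants
    depending only on the contraction. Comparing the means for two cocycles one
    letter at a time gives (b). *)

Require Import Defs.
From HB Require Import structures.
From mathcomp Require Import all_boot all_order all_algebra all_fingroup.
From mathcomp Require Import all_classical all_reals all_analysis.
From mathcomp Require Import ring lra.
Set Implicit Arguments. Unset Strict Implicit. Unset Printing Implicit Defensive.
Import Order.TTheory GRing.Theory Num.Theory.
Import numFieldNormedType.Exports.
Local Open Scope classical_set_scope.
Local Open Scope ring_scope.

(** * Entrywise norm and two-by-two minors *)

Section EntrywiseNorm.
Variable R : realType.

(** Only growth up to bounded factors matters, so entrywise norms and a pivot decomposition with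
    bounded outer factors take the place of Euclidean norms and of the singular value decomposition.
    A small quotient [kap M / nrm M ^+ 2], comparable with s_2 / s_1, means that M is nearly of rank
    one; [kap] also bounds the stretching of projective distances.

    The exponent alpha has to make rare bad words harmless. Over n letters the expansion at v never
    exceeds B^n, and it is at most s^n with s < 1 off a small event. With alpha = ln 2 / (n ln B)
    these bounds become 2 and a number theta < 1 that does not depend on n, so the probability
    granted to the bad event can be fixed before n.

    After the contraction everything is an expectation over finitely many letters, with constants
    depending only on the dimension, a bound for T and its inverses, and n, alpha, kp. Almost sure
    limits are used to find the gap at A and, for each B, to identify the rate of the means with the
    exponents: Kingman's theorem gives a limit and Borel-Cantelli its value. *)

Definition nrm (m n : nat) (M : 'M[R]_(m, n)) : R := \sum_i \sum_j `|M i j|.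

Lemma nrm_ge0 m n (M : 'M[R]_(m, n)) : 0 <= nrm M.
Proof. by apply: sumr_ge0 => i _; apply: sumr_ge0. Qed.
Hint Resolve nrm_ge0 : core.

Lemma nrm0 m n : nrm (0 : 'M[R]_(m, n)) = 0.
Proof. by rewrite /nrm big1 // => i _; rewrite big1 // => j _; rewrite mxE normr0. Qed.

Lemma entry_le_nrm m n (M : 'M[R]_(m, n)) i j : `|M i j| <= nrm M.
Proof.
rewrite /nrm (bigD1 i) //= (bigD1 j) //= -addrA lerDl addr_ge0 //.
  by apply: sumr_ge0.
by apply: sumr_ge0 => k _; apply: sumr_ge0.
Qed.

Lemma nrm_eq0 m n (M : 'M[R]_(m, n)) : (nrm M == 0) = (M == 0).
Proof.
apply/eqP/eqP => [h|->]; last exact: nrm0.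
apply/matrixP => i j; rewrite mxE; apply/eqP.
by rewrite -normr_eq0 eq_le normr_ge0 -h entry_le_nrm.
Qed.

Lemma nrm_gt0 m n (M : 'M[R]_(m, n)) : (0 < nrm M) = (M != 0).
Proof. by rewrite lt_neqAle eq_sym nrm_eq0 nrm_ge0 andbT. Qed.

Lemma nrmZ m n a (M : 'M[R]_(m, n)) : nrm (a *: M) = `|a| * nrm M.
Proof.
rewrite /nrm mulr_sumr; apply: eq_bigr => i _; rewrite mulr_sumr.
by apply: eq_bigr => j _; rewrite mxE normrM.
Qed.

Lemma nrmN m n (M : 'M[R]_(m, n)) : nrm (- M) = nrm M.
Proof. by rewrite -scaleN1r nrmZ normrN1 mul1r. Qed.

Lemma nrmD m n (M M' : 'M[R]_(m, n)) : nrm (M + M') <= nrm M + nrm M'.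
Proof.
rewrite /nrm -big_split; apply: ler_sum => i _; rewrite -big_split.
by apply: ler_sum => j _; rewrite mxE ler_normD.
Qed.

Lemma nrmB m n (M M' : 'M[R]_(m, n)) : nrm (M - M') <= nrm M + nrm M'.
Proof. by rewrite -(nrmN M') nrmD. Qed.

Lemma nrm_sub_sym m n (M M' : 'M[R]_(m, n)) : nrm (M - M') = nrm (M' - M).
Proof. by rewrite -nrmN opprB. Qed.

Lemma nrm_dist m n (M M' : 'M[R]_(m, n)) : `|nrm M - nrm M'| <= nrm (M - M').
Proof.
rewrite ler_distl; apply/andP; split.
  by rewrite lerBlDr nrm_sub_sym -[X in nrm X <= _](subrK M) addrC nrmD // addrC.
by rewrite -{1}[M](subrK M') addrC nrmD.
Qed.

Lemma nrm_tr m n (M : 'M[R]_(m, n)) : nrm M^T = nrm M.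
Proof.
rewrite /nrm exchange_big; apply: eq_bigr => i _; apply: eq_bigr => j _.
by rewrite mxE.
Qed.

Lemma nrm_mul m n p (M : 'M[R]_(m, n)) (M' : 'M[R]_(n, p)) :
  nrm (M *m M') <= nrm M * nrm M'.
Proof.
have h : nrm (M *m M') <= \sum_j (\sum_i `|M i j|) * (\sum_k `|M' j k|).
  rewrite [leRHS](eq_bigr (fun j => \sum_i \sum_k `|M i j| * `|M' j k|)); last first.
    by move=> j _; rewrite mulr_suml; apply: eq_bigr => i _; rewrite mulr_sumr.
  rewrite exchange_big; apply: ler_sum => i _; rewrite exchange_big.
  apply: ler_sum => k _; rewrite mxE; apply: le_trans (ler_norm_sum _ _ _) _.
  by apply: ler_sum => j _; rewrite normrM.
apply: le_trans h _; rewrite {1}/nrm exchange_big mulr_suml.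
apply: ler_sum => j _; apply: ler_wpM2l; first exact: sumr_ge0.
rewrite /nrm (bigD1 j) //= lerDl; apply: sumr_ge0 => k _; exact: sumr_ge0.
Qed.

Lemma nrm1 n : nrm (1%:M : 'M[R]_n) = n%:R.
Proof.
rewrite /nrm (eq_bigr (fun=> 1)) ?sumr_const ?card_ord // => i _.
rewrite (bigD1 i) //= mxE eqxx normr1 big1 ?addr0 // => j ji.
by rewrite mxE eq_sym (negbTE ji) normr0.
Qed.

Lemma nrm_cols m n (M : 'M[R]_(m, n)) : nrm M = \sum_j nrm (M *m delta_mx j (0 : 'I_1)).
Proof.
rewrite /nrm exchange_big; apply: eq_bigr => j _; apply: eq_bigr => i _.
by rewrite big_ord1 -colE mxE.
Qed.

Lemma nrm_delta m n (i : 'I_m) (j : 'I_n) : nrm (delta_mx i j : 'M[R]_(m, n)) = 1.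
Proof.
rewrite /nrm (bigD1 i) //= (bigD1 j) //= mxE !eqxx normr1.
rewrite !big1 ?addr0 //.
  move=> k ki; rewrite big1 // => l _; by rewrite mxE (negbTE ki) normr0.
by move=> k kj; rewrite mxE eqxx (negbTE kj) normr0.
Qed.

Lemma nrm_max_col m n (M : 'M[R]_(m, n.+1)) :
  exists j, nrm M <= n.+1%:R * nrm (M *m delta_mx j (0 : 'I_1)).
Proof.
pose f j := nrm (M *m delta_mx j (0 : 'I_1)).
have [j _ jmax] := @Order.TotalTheory.arg_maxP _ R 'I_n.+1 ord0 xpredT f isT.
exists j; rewrite nrm_cols mulr_natl -[X in _ *+ X]card_ord -sumr_const.
by apply: ler_sum => l _; apply: jmax.
Qed.

Lemma nrm_inv_lb m n p (M : 'M[R]_(m, n)) (M' : 'M[R]_(n, m)) (v : 'M[R]_(n, p)) :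
  M' *m M = 1%:M -> nrm v <= nrm M' * nrm (M *m v).
Proof. by move=> h; rewrite -{1}[v]mul1mx -h -mulmxA nrm_mul. Qed.

(** The exterior product of v and w as an antisymmetric matrix: it vanishes exactly when v and w are
    proportional, so its size compares the two lines. *)
Definition wedge (q : nat) (v w : 'cV[R]_q) : 'M[R]_q := v *m w^T - w *m v^T.

Lemma wedgeE q (v w : 'cV[R]_q) i j : wedge v w i j = v i 0 * w j 0 - w i 0 * v j 0.
Proof. by rewrite /wedge !mxE !big_ord1 !mxE. Qed.

Lemma nrm_wedge q (v w : 'cV[R]_q) : nrm (wedge v w) <= 2 * (nrm v * nrm w).
Proof.
apply: le_trans (nrmB _ _) _.
have := nrm_mul v w^T; have := nrm_mul w v^T; rewrite !nrm_tr.
by have := mulrC (nrm v) (nrm w); lra.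
Qed.

Lemma wedge_mul m q (M : 'M[R]_(m, q)) (v w : 'cV[R]_q) :
  wedge (M *m v) (M *m w) = M *m wedge v w *m M^T.
Proof. by rewrite /wedge !trmx_mul mulmxBr mulmxBl !mulmxA. Qed.

Definition minor2 m n (M : 'M[R]_(m, n)) i j k l : R := M i k * M j l - M i l * M j k.

(** An entrywise norm of the second exterior power, comparable with s_1 s_2. Summing over all index
    quadruples costs bounded factors but avoids order conditions on the indices. *)
Definition kap m n (M : 'M[R]_(m, n)) : R :=
  \sum_i \sum_j \sum_k \sum_l `|minor2 M i j k l|.

Lemma kap_ge0 m n (M : 'M[R]_(m, n)) : 0 <= kap M.
Proof. by do 4!(apply: sumr_ge0 => ? _). Qed.

(** An antisymmetric weight sees only the antisymmetric part of the coefficients; this turns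
    products of entries into two-by-two minors. *)
Lemma sum2_antisym q (f g : 'I_q -> 'I_q -> R) :
  (forall k l, g k l = - g l k) ->
  2 * (\sum_k \sum_l f k l * g k l) = \sum_k \sum_l (f k l - f l k) * g k l.
Proof.
move=> ga; rewrite mulr2n mulrDl mul1r [X in _ + X]exchange_big -big_split.
apply: eq_bigr => k _; rewrite -big_split; apply: eq_bigr => l _.
by rewrite /= (ga l k); ring.
Qed.

Lemma nrm_wedge_mul m q (M : 'M[R]_(m, q)) (v w : 'cV[R]_q) :
  nrm (wedge (M *m v) (M *m w)) <= kap M * nrm (wedge v w).
Proof.
rewrite wedge_mul /nrm /kap mulr_suml; apply: ler_sum => i _.
rewrite mulr_suml; apply: ler_sum => j _.
set W := wedge v w.
have Wa k l : W k l = - W l k by rewrite /W !wedgeE; ring.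
have e : (M *m W *m M^T) i j = \sum_k \sum_l (M i k * M j l) * W k l.
  rewrite mxE exchange_big; apply: eq_bigr => l _; rewrite mxE mulr_suml.
  by apply: eq_bigr => k _; rewrite !mxE; ring.
have h : 2 * `|(M *m W *m M^T) i j| <= (\sum_k \sum_l `|minor2 M i j k l|) * nrm W.
  rewrite -[X in X * _](ger0_norm (ler0n R 2)) -normrM e (@sum2_antisym _ (fun k l => M i k * M j l)) //.
  apply: le_trans (ler_norm_sum _ _ _) _; rewrite mulr_suml.
  apply: ler_sum => k _; apply: le_trans (ler_norm_sum _ _ _) _.
  rewrite mulr_suml; apply: ler_sum => l _.
  by rewrite normrM ler_wpM2l // entry_le_nrm.
have : 0 <= `|(M *m W *m M^T) i j| by [].
by rewrite /nrm in h *; lra.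
Qed.

(** Cauchy-Binet for two-by-two minors. Ordered pairs (s, t) count every inner pair twice, hence the
    factor 2 on the left, which is given up at the end. *)
Lemma kap_mul m n p (X : 'M[R]_(m, n)) (N : 'M[R]_(n, p)) :
  kap (X *m N) <= kap X * kap N.
Proof.
have h i j k l : 2 * `|minor2 (X *m N) i j k l| <=
    \sum_s \sum_t `|minor2 X i j s t| * `|minor2 N s t k l|.
  have e : minor2 (X *m N) i j k l =
     \sum_s \sum_t (X i s * X j t) * minor2 N s t k l.
    rewrite /minor2 !mxE !mulr_suml -sumrB; apply: eq_bigr => s _.
    rewrite !mulr_sumr -sumrB; apply: eq_bigr => t _; ring.
  rewrite -[X in X * _](ger0_norm (ler0n R 2)) -normrM e
    (@sum2_antisym _ (fun s t => X i s * X j t)); last by move=> s t; rewrite /minor2; ring.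
  apply: le_trans (ler_norm_sum _ _ _) _; apply: ler_sum => s _.
  apply: le_trans (ler_norm_sum _ _ _) _; apply: ler_sum => t _.
  by rewrite normrM.
have h2 : 2 * kap (X *m N) <= \sum_s \sum_t
    (\sum_i \sum_j `|minor2 X i j s t|) * (\sum_k \sum_l `|minor2 N s t k l|).
  (* The exchanges carry the sums over s and t innermost, where [h] applies. *)
  rewrite [leRHS](eq_bigr (fun s => \sum_t \sum_i \sum_j \sum_k \sum_l
     `|minor2 X i j s t| * `|minor2 N s t k l|)); last first.
    move=> s _; apply: eq_bigr => t _; rewrite mulr_suml; apply: eq_bigr => i _.
    rewrite mulr_suml; apply: eq_bigr => j _; rewrite mulr_sumr.
    by apply: eq_bigr => k _; rewrite mulr_sumr.
  rewrite exchange_big /= (eq_bigr (fun t => \sum_i \sum_s \sum_j \sum_k \sum_l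
     `|minor2 X i j s t| * `|minor2 N s t k l|)); last by move=> t _; rewrite exchange_big.
  rewrite [leRHS]exchange_big mulr_sumr; apply: ler_sum => i _ /=.
  rewrite (eq_bigr (fun t => \sum_j \sum_s \sum_k \sum_l
     `|minor2 X i j s t| * `|minor2 N s t k l|)); last by move=> t _; rewrite exchange_big.
  rewrite [leRHS]exchange_big mulr_sumr; apply: ler_sum => j _ /=.
  rewrite (eq_bigr (fun t => \sum_k \sum_s \sum_l
     `|minor2 X i j s t| * `|minor2 N s t k l|)); last by move=> t _; rewrite exchange_big.
  rewrite [leRHS]exchange_big mulr_sumr; apply: ler_sum => k _ /=.
  rewrite (eq_bigr (fun t => \sum_l \sum_s
     `|minor2 X i j s t| * `|minor2 N s t k l|)); last by move=> t _; rewrite exchange_big.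
  rewrite [leRHS]exchange_big mulr_sumr; apply: ler_sum => l _ /=.
  by rewrite [leRHS]exchange_big; exact: h.
have h3 : 2 * kap (X *m N) <= kap X * kap N.
  apply: le_trans h2 _.
  rewrite [X in _ <= X * _](_ : kap X = \sum_s \sum_t \sum_i \sum_j `|minor2 X i j s t|); last first.
    rewrite /kap; under eq_bigr do rewrite exchange_big.
    rewrite exchange_big; apply: eq_bigr => s _ /=.
    under eq_bigr do rewrite exchange_big.
    by rewrite exchange_big.
  rewrite mulr_suml; apply: ler_sum => s _; rewrite mulr_suml; apply: ler_sum => t _.
  apply: ler_wpM2l; first by do 2!(apply: sumr_ge0 => ? _).
  rewrite /kap (bigD1 s) //= (bigD1 t) //= -addrA lerDl addr_ge0 //.
    by do 3!(apply: sumr_ge0 => ? _).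
  by do 4!(apply: sumr_ge0 => ? _).
by have := kap_ge0 (X *m N); lra.
Qed.

Lemma kap_le m n (M : 'M[R]_(m, n)) : kap M <= 2 * nrm M ^+ 2.
Proof.
have h i j k l : `|minor2 M i j k l| <= `|M i k| * `|M j l| + `|M i l| * `|M j k|.
  by rewrite /minor2 -!normrM ler_normB.
have e1 : nrm M ^+ 2 = \sum_i \sum_j \sum_k \sum_l `|M i k| * `|M j l|.
  rewrite expr2 {1}/nrm mulr_suml; apply: eq_bigr => i _.
  rewrite mulr_sumr; apply: eq_bigr => j _; rewrite mulr_suml.
  by apply: eq_bigr => k _; rewrite mulr_sumr.
have e2 : nrm M ^+ 2 = \sum_i \sum_j \sum_k \sum_l `|M i l| * `|M j k|.
  rewrite e1; apply: eq_bigr => i _; apply: eq_bigr => j _; exact: exchange_big.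
rewrite mulr2n mulrDl mul1r {1}e1 e2 -big_split; apply: ler_sum => i _.
rewrite -big_split; apply: ler_sum => j _; rewrite -big_split; apply: ler_sum => k _.
by rewrite -big_split; apply: ler_sum => l _; exact: h.
Qed.

Lemma kap_diag q (c : 'rV[R]_q) (b : R) : 0 <= b ->
  (forall i j, i != j -> `|c 0 i * c 0 j| <= b) ->
  kap (diag_mx c) <= 2 * q%:R ^+ 4 * b.
Proof.
move=> b0 cb.
have h i j k l : `|minor2 (diag_mx c) i j k l| <= 2 * b.
  rewrite /minor2 !mxE; have [->|ij] := eqVneq i j.
    by rewrite mulrC subrr normr0 mulr_ge0.
  apply: le_trans (ler_normB _ _) _; rewrite mulr2n mulrDl mul1r; apply: lerD.
    case: (i == k) (j == l) => [] [] /=; rewrite ?mulr1n ?mulr0n ?mul0r ?mulr0 ?normr0 //; exact: cb.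
  case: (i == l) (j == k) => [] [] /=; rewrite ?mulr1n ?mulr0n ?mul0r ?mulr0 ?normr0 //; exact: cb.
apply: (@le_trans _ _ (\sum_(i < q) \sum_(j < q) \sum_(k < q) \sum_(l < q) (2 * b))).
  by do 4!(apply: ler_sum => ? _); exact: h.
by rewrite !sumr_const !card_ord le_eqVlt; apply/orP; left; apply/eqP; ring.
Qed.

Lemma kap_lip q (M M' : 'M[R]_q) (L : R) : nrm M <= L -> nrm M' <= L ->
  `|kap M - kap M'| <= 4 * q%:R ^+ 4 * L * nrm (M - M').
Proof.
move=> ML M'L; set e := nrm (M - M').
have e0 : 0 <= e := nrm_ge0 _.
have ent i j : `|M i j - M' i j| <= e by have := entry_le_nrm (M - M') i j; rewrite !mxE.
have pl i j k l : `|M i j * M k l - M' i j * M' k l| <= 2 * L * e.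
  have -> : M i j * M k l - M' i j * M' k l = M i j * (M k l - M' k l) + (M i j - M' i j) * M' k l by ring.
  apply: le_trans (ler_normD _ _) _; rewrite !normrM.
  have := ler_pM (normr_ge0 _) (normr_ge0 _) (le_trans (entry_le_nrm M i j) ML) (ent k l).
  have := ler_pM (normr_ge0 _) (normr_ge0 _) (ent i j) (le_trans (entry_le_nrm M' k l) M'L).
  by lra.
have h i j k l : `| `|minor2 M i j k l| - `|minor2 M' i j k l| | <= 4 * L * e.
  apply: le_trans (ler_dist_dist _ _) _.
  have -> : minor2 M i j k l - minor2 M' i j k l =
    (M i k * M j l - M' i k * M' j l) - (M i l * M j k - M' i l * M' j k).
    by rewrite /minor2; ring.
  apply: le_trans (ler_normB _ _) _.
  by have := pl i k j l; have := pl i l j k; lra.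
apply: (@le_trans _ _ (\sum_(i < q) \sum_(j < q) \sum_(k < q) \sum_(l < q) (4 * L * e))).
  rewrite /kap -sumrB; apply: le_trans (ler_norm_sum _ _ _) _; apply: ler_sum => i _.
  rewrite -sumrB; apply: le_trans (ler_norm_sum _ _ _) _; apply: ler_sum => j _.
  rewrite -sumrB; apply: le_trans (ler_norm_sum _ _ _) _; apply: ler_sum => k _.
  rewrite -sumrB; apply: le_trans (ler_norm_sum _ _ _) _; apply: ler_sum => l _.
  exact: h.
by rewrite !sumr_const !card_ord le_eqVlt; apply/orP; left; apply/eqP; ring.
Qed.

(* The multiple c is read off at the largest coordinate of w. *)
Lemma wedge_close q (v w : 'cV[R]_q) : w != 0 ->
  exists c, nrm (v - c *: w) * nrm w <= q%:R * nrm (wedge v w).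
Proof.
case: q v w => [v w|q v w w0].
  by rewrite (flatmx0 w) eqxx.
have [j _ jmax] := @Order.TotalTheory.arg_maxP _ R 'I_q.+1 ord0 xpredT (fun j => `|w j 0|) isT.
have wj : 0 < `|w j 0|.
  rewrite lt_neqAle normr_ge0 andbT eq_sym; apply: contra w0 => /eqP wj0.
  apply/eqP/matrixP => i k; rewrite ord1 mxE; apply/eqP; rewrite -normr_le0 -wj0.
  exact: jmax.
have wj' : w j 0 != 0 by rewrite -normr_gt0.
have nw : nrm w <= q.+1%:R * `|w j 0|.
  rewrite /nrm mulr_natl -[X in _ *+ X]card_ord -sumr_const; apply: ler_sum => l _.
  rewrite big_ord1; exact: jmax.
exists (v j 0 / w j 0).
have h : nrm (v - (v j 0 / w j 0) *: w) * `|w j 0| <= nrm (wedge v w).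
  rewrite mulr_suml; apply: ler_sum => i _; rewrite big_ord1 -normrM !mxE.
  rewrite [X in `|X| <= _](_ : _ = wedge v w i j); last first.
    by rewrite wedgeE !ord1; field.
  rewrite (bigD1 j) //= lerDl; exact: sumr_ge0.
apply: le_trans (ler_wpM2l (nrm_ge0 _) nw) _.
by rewrite mulrCA ler_wpM2l.
Qed.

End EntrywiseNorm.
#[global] Hint Resolve nrm_ge0 : core.
#[global] Hint Resolve kap_ge0 : core.

(** * Compound matrices *)

Section SubElt.
Variables d i : nat.
Implicit Type S : isub d i.

Lemma sub_elt_inj S : injective (sub_elt S).
Proof. by move=> r r' /enum_val_inj /cast_ord_inj. Qed.

Lemma sub_elt_in S r : sub_elt S r \in val S.
Proof. exact: enum_valP. Qed.

Lemma sub_elt_surj S s : s \in val S -> exists r, sub_elt S r = s.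
Proof.
move=> sS; exists (cast_ord (eqP (valP S)) (enum_rank_in sS s)).
by rewrite /sub_elt cast_ordK enum_rankK_in.
Qed.

Lemma card_isub S : #|val S| = i. Proof. exact/eqP/(valP S). Qed.

(** A set is listed as a subsequence of all ordinals, hence in increasing order. This is why the
    entry of rank r is at least r, on which the comparison of diagonal products rests. *)
Lemma sub_elt_mono S (r r' : 'I_i) : (r < r')%N -> (sub_elt S r < sub_elt S r')%N.
Proof.
have srt : sorted ltn (map val (enum (val S))).
  rewrite [enum (val S)]/enum_mem; apply: (subseq_sorted ltn_trans) (iota_ltn_sorted 0 d).
  by rewrite -val_enum_ord; apply: map_subseq; rewrite enumT; apply: filter_subseq.
have nthE (r0 : 'I_i) : val (sub_elt S r0) = nth 0%N (map val (enum (val S))) r0.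
  have r0s : (r0 < size (enum (val S)))%N by rewrite -cardE card_isub.
  rewrite (nth_map (sub_elt S r0)) //; congr val.
  rewrite /sub_elt (enum_val_nth (sub_elt S r0)) /=; exact: set_nth_default.
move=> rr'; rewrite !nthE.
by apply: (sorted_ltn_nth ltn_trans) => //; rewrite inE size_map -cardE card_isub.
Qed.

Lemma sub_elt_ge S (r : 'I_i) : (r <= sub_elt S r)%N.
Proof.
case: r => r; elim: r => [|r IH] ri //=.
by apply: leq_trans (sub_elt_mono S (_ : Ordinal (ltnW ri) < Ordinal ri)%N) => //; rewrite ltnS; exact: IH.
Qed.
End SubElt.

Section Compound.
Variable R : realType.

Definition cminor m n i (A : 'M[R]_(m, n)) (S : isub m i) (T : isub n i) : R :=
  \det (\matrix_(r < i, c < i) A (sub_elt S r) (sub_elt T c)).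

(** Rectangular form of [extpow]: the factors through R^k are d x k and k x d, and multiplicativity
    has to cover them. *)
Definition compound i m n (A : 'M[R]_(m, n)) : 'M[R]_(#|{: isub m i}|, #|{: isub n i}|) :=
  \matrix_(r, c) cminor A (enum_val r) (enum_val c).

Lemma compound_extpow i n (A : 'M[R]_n) : compound i A = extpow i A.
Proof. by []. Qed.

(** Expanding every entry of the product gives one term for each choice f of inner indices; if f is
    not injective, the remaining determinant has two equal rows. *)
Lemma det_mul_rect_aux i n (A : 'M[R]_(i, n)) (B : 'M[R]_(n, i)) :
  \det (A *m B) = \sum_(f : {ffun 'I_i -> 'I_n} | injectiveb f)
     (\prod_r A r (f r)) * \det (\matrix_(r, c) B (f r) c).
Proof.
pose AB (s : 'S_i) r j := A r j * B j (s r).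
transitivity (\sum_(f : {ffun 'I_i -> 'I_n}) \sum_(s : 'S_i) (-1) ^+ s * \prod_r AB s r (f r)).
  rewrite exchange_big; apply: eq_bigr => /= s _; rewrite -big_distrr /=.
  congr (_ * _); rewrite -(bigA_distr_bigA (AB s)) /=.
  by apply: eq_bigr => x _; rewrite mxE.
rewrite (bigID (fun f : {ffun 'I_i -> 'I_n} => injectiveb f)) /= [X in _ + X]big1 ?addr0 => [|f Uf].
  apply: eq_bigr => f _; rewrite big_distrr /=; apply: eq_bigr => s _.
  rewrite mulrCA big_split //=; congr (_ * (_ * _)).
  by apply: eq_bigr => x _; rewrite mxE.
transitivity (\det (\matrix_(r, c) B (f r) c) * \prod_r A r (f r)).
  rewrite mulrC big_distrr /=; apply: eq_bigr => s _.
  rewrite mulrCA big_split //=; congr (_ * (_ * _)).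
  by apply: eq_bigr => x _; rewrite mxE.
case/injectivePn: Uf => i1 [i2 Di12 Ef12].
by rewrite (determinant_alternate Di12) ?mul0r //= => j; rewrite !mxE Ef12.
Qed.

(* An injective f factors uniquely as an increasing enumeration
   of its image composed with a permutation, and the square case of the
   expansion above collects the permutations. *)
Lemma cauchy_binet i n (A : 'M[R]_(i, n)) (B : 'M[R]_(n, i)) :
  \det (A *m B) = \sum_(S : isub n i)
     \det (\matrix_(r < i, c < i) A r (sub_elt S c)) *
     \det (\matrix_(r < i, c < i) B (sub_elt S r) c).
Proof.
rewrite det_mul_rect_aux.
pose F (f : {ffun 'I_i -> 'I_n}) := (\prod_r A r (f r)) * \det (\matrix_(r, c) B (f r) c).
transitivity (\sum_(S : isub n i) \sum_(f : {ffun 'I_i -> 'I_n} | injectiveb f && (f @: [set: 'I_i]%SET == val S)) F f).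
  rewrite [RHS](exchange_big_dep (fun f : {ffun _ -> _} => injectiveb f)) /= => [|S f _ /andP[]//].
  apply: eq_bigr => f fi; rewrite -/(F f).
  have cS : #|f @: [set: 'I_i]%SET| == i by rewrite (card_imset _ (injectiveP _ fi)) cardsT card_ord.
  rewrite (big_pred1 (Sub (f @: [set: 'I_i]%SET) cS : isub n i)) // => S /=.
  by rewrite fi /= eq_sym -val_eqE.
apply: eq_bigr => S _; rewrite -det_mulmx det_mul_rect_aux.
pose h (g : {ffun 'I_i -> 'I_i}) := [ffun r => sub_elt S (g r)] : {ffun 'I_i -> 'I_n}.
have hinj : injective h.
  move=> g g' /ffunP e; apply/ffunP => r; have := e r; rewrite !ffunE; exact: sub_elt_inj.
transitivity (\sum_(f in h @: [set g : {ffun 'I_i -> 'I_i} | injectiveb g]%SET) F f).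
  apply: eq_bigl => f; apply/andP/imsetP => [[/injectiveP fi /eqP fS]|[g]].
    have ex r : exists r', sub_elt S r' == f r.
      have /sub_elt_surj[r' <-] : f r \in val S by rewrite -fS imset_f.
      by exists r'.
    exists [ffun r => xchoose (ex r)].
      rewrite inE; apply/injectiveP => r r'; rewrite !ffunE => e; apply: fi.
      by rewrite -(eqP (xchooseP (ex r))) e (eqP (xchooseP (ex r'))).
    by apply/ffunP => r; rewrite !ffunE (eqP (xchooseP (ex r))).
  rewrite inE => /injectiveP gi ->; split.
    by apply/injectiveP => r r'; rewrite !ffunE => /sub_elt_inj /gi.
  rewrite eqEcard card_isub; apply/andP; split.
    by apply/fintype.subsetP => _ /imsetP[r _ ->]; rewrite ffunE sub_elt_in.
  rewrite card_imset ?cardsT ?card_ord // => r r'.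
  by rewrite !ffunE => /sub_elt_inj /gi.
rewrite big_imset /=; last by move=> g g' _ _; exact: hinj.
apply: eq_big => [g|g _]; first by rewrite inE.
congr (_ * _); first by apply: eq_bigr => r _; rewrite mxE ffunE.
by congr (\det _); apply/matrixP => r c; rewrite !mxE ffunE.
Qed.

Lemma compound_mul i m n p (A : 'M[R]_(m, n)) (B : 'M[R]_(n, p)) :
  compound i (A *m B) = compound i A *m compound i B.
Proof.
apply/matrixP => r c; rewrite !mxE /cminor.
set S := enum_val r; set T := enum_val c.
rewrite (_ : (\matrix_(_, _) _) = (\matrix_(x < i, y < n) A (sub_elt S x) y) *m
    (\matrix_(x < n, y < i) B x (sub_elt T y))); last first.
  by apply/matrixP => x y; rewrite !mxE; apply: eq_bigr => z _; rewrite !mxE.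
rewrite cauchy_binet (reindex (@enum_val _ {: isub n i})) /=; last first.
  by exists enum_rank => x _; rewrite ?enum_valK ?enum_rankK.
apply: eq_bigr => U _; rewrite !mxE /cminor; congr (_ * _); congr (\det _).
  by apply/matrixP => x y; rewrite !mxE.
by apply/matrixP => x y; rewrite !mxE.
Qed.

Lemma cminor_diag i n (c : 'rV[R]_n) (S T : isub n i) :
  cminor (diag_mx c) S T = if S == T then \prod_(s in val S) c 0 s else 0.
Proof.
have [->|ST] := eqVneq S T; last first.
  (* By equality of cardinals S has an element s outside T, and row s of the minor is zero. *)
  have /fintype.subsetPn[s sS sT] : ~~ (val S \subset val T).
    apply: contra ST => h; rewrite -val_eqE eqEcard h !card_isub leqnn //.
  have [r rs] := sub_elt_surj sS.
  rewrite /cminor (expand_det_row _ r) big1 // => c' _; rewrite !mxE rs.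
  rewrite (_ : (s == sub_elt T c') = false) ?mulr0n ?mul0r //.
  by apply/negP => /eqP e; move: sT; rewrite e sub_elt_in.
rewrite /cminor (_ : (\matrix_(_, _) _) = diag_mx (\row_r c 0 (sub_elt T r))); last first.
  by apply/matrixP => x y; rewrite !mxE (inj_eq (@sub_elt_inj _ _ T)).
rewrite det_diag (reindex_onto (cast_ord (card_isub T)) (cast_ord (esym (card_isub T)))) /=; last first.
  by move=> r _; rewrite cast_ordKV.
rewrite [RHS]big_enum_val /=; apply: eq_big => [r|r _].
  by rewrite cast_ordK eqxx.
rewrite mxE /sub_elt; congr (c 0 (enum_val _)); exact/val_inj.
Qed.

Lemma compound_diag i n (c : 'rV[R]_n) :
  compound i (diag_mx c) = diag_mx (\row_r \prod_(s in val (enum_val r : isub n i)) c 0 s).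
Proof.
apply/matrixP => r r'; rewrite !mxE cminor_diag (inj_eq enum_val_inj).
by case: eqP => // ->.
Qed.

Lemma compound1 i n : compound i (1%:M : 'M[R]_n) = 1%:M.
Proof.
rewrite -diag_const_mx compound_diag -diag_const_mx; congr diag_mx.
by apply/matrixP => x y; rewrite !mxE big1 // => s _; rewrite mxE.
Qed.

Lemma prod_lip n (x y : 'I_n -> R) (L e : R) : 1 <= L -> 0 <= e ->
  (forall r, `|x r| <= L) -> (forall r, `|y r| <= L) -> (forall r, `|x r - y r| <= e) ->
  `|\prod_r x r - \prod_r y r| <= n%:R * L ^+ n * e.
Proof.
move=> L1 e0; elim: n x y => [|n IH] x y xL yL xy.
  by rewrite !big_ord0 subrr normr0 !mul0r.
rewrite !big_ord_recl.
set X := \prod_(j < n) _; set Y := \prod_(j < n) _.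
have XY : `|X - Y| <= n%:R * L ^+ n * e by apply: IH.
have YL : `|Y| <= L ^+ n.
  rewrite normr_prod -[X in L ^+ X]card_ord -prodr_const; apply: ler_prod => j _.
  by rewrite normr_ge0 yL.
have -> : x ord0 * X - y ord0 * Y = x ord0 * (X - Y) + (x ord0 - y ord0) * Y by ring.
apply: le_trans (ler_normD _ _) _; rewrite !normrM.
have h1 := ler_pM (normr_ge0 _) (normr_ge0 _) (xL ord0) XY.
have h2 := ler_pM (normr_ge0 _) (normr_ge0 _) (xy ord0) YL.
have Ln : L ^+ n <= L ^+ n.+1 by apply: ler_weXn2l.
have h3 := ler_wpM2r e0 Ln.
move: h1 h2 h3; rewrite exprS -natr1; lra.
Qed.

Lemma det_lip n (M M' : 'M[R]_n) (L e : R) : 1 <= L -> 0 <= e ->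
  (forall r c, `|M r c| <= L) -> (forall r c, `|M' r c| <= L) ->
  (forall r c, `|M r c - M' r c| <= e) ->
  `|\det M - \det M'| <= n`!%:R * (n%:R * L ^+ n * e).
Proof.
move=> L1 e0 ML M'L MM'; rewrite /determinant -sumrB.
apply: le_trans (ler_norm_sum _ _ _) _.
rewrite mulr_natl -card_Sn -sumr_const; apply: ler_sum => s _.
by rewrite -mulrBr normrM normr_sign mul1r prod_lip.
Qed.

Lemma det_bound n (M : 'M[R]_n) (L : R) : 
  (forall r c, `|M r c| <= L) -> `|\det M| <= n`!%:R * L ^+ n.
Proof.
move=> ML; apply: le_trans (ler_norm_sum _ _ _) _.
rewrite mulr_natl -card_Sn -sumr_const; apply: ler_sum => s _.
rewrite normrM normr_sign mul1r normr_prod -[X in L ^+ X]card_ord -prodr_const.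
by apply: ler_prod => j _; rewrite normr_ge0 ML.
Qed.

Lemma nrm_le_card m n (M : 'M[R]_(m, n)) (b : R) : (forall r c, `|M r c| <= b) ->
  nrm M <= m%:R * n%:R * b.
Proof.
move=> Mb; apply: (@le_trans _ _ (\sum_(r < m) \sum_(c < n) b)).
  by apply: ler_sum => r _; apply: ler_sum => c _.
by rewrite !sumr_const !card_ord le_eqVlt; apply/orP; left; apply/eqP; ring.
Qed.

Lemma compound_lip i m n (L : R) : exists2 C : R, 0 <= C &
  forall A A' : 'M[R]_(m, n), nrm A <= L -> nrm A' <= L ->
    nrm (compound i A - compound i A') <= C * nrm (A - A').
Proof.
pose L' := Num.max 1 L.
exists (#|{: isub m i}|%:R * #|{: isub n i}|%:R * (i`!%:R * (i%:R * L' ^+ i))).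
  by rewrite !mulr_ge0 // exprn_ge0 // le_max ler01.
move=> A A' AL A'L; rewrite -!mulrA [leRHS]mulrA.
rewrite (mulrA i%:R); apply: nrm_le_card => r c; rewrite !mxE.
apply: det_lip => //.
- by rewrite le_max lexx.
- by move=> *; rewrite mxE (le_trans (entry_le_nrm _ _ _)) // le_max AL orbT.
- by move=> *; rewrite mxE (le_trans (entry_le_nrm _ _ _)) // le_max A'L orbT.
- by move=> x y; rewrite !mxE; have := entry_le_nrm (A - A') (sub_elt (enum_val r) x) (sub_elt (enum_val c) y); rewrite !mxE.
Qed.

Lemma compound_bound i m n (L : R) : exists2 C : R, 0 <= C &
  forall A : 'M[R]_(m, n), nrm A <= L -> nrm (compound i A) <= C.
Proof.
exists (#|{: isub m i}|%:R * #|{: isub n i}|%:R * (i`!%:R * `|L| ^+ i)).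
  by rewrite !mulr_ge0.
move=> A AL; apply: nrm_le_card => r c; rewrite mxE; apply: det_bound => x y.
by rewrite mxE (le_trans (entry_le_nrm _ _ _)) // (le_trans AL) // ler_norm.
Qed.

Section DiagonalCompound.
Variables (k : nat) (delta : nat -> R).
Hypothesis delta_ge0 : forall j, 0 <= delta j.
Hypothesis delta_anti : forall j l, (j <= l)%N -> delta l <= delta j.

Let D : 'M[R]_k := diag_mx (\row_(j < k) delta j).

Lemma isub_prod i (S : isub k i) :
  \prod_(s in val S) (\row_(j < k) delta j) 0 s = \prod_(r < i) delta (sub_elt S r).
Proof.
rewrite big_enum_val /= (reindex_onto (cast_ord (card_isub S)) (cast_ord (esym (card_isub S)))) /=; last first.
  by move=> r _; rewrite cast_ordKV.
apply: eq_big => [r|r _]; first by rewrite cast_ordK eqxx.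
rewrite mxE /sub_elt; congr (delta (nat_of_ord (enum_val _))); exact/val_inj.
Qed.

Lemma isub_prod_le i (S : isub k i) : \prod_(r < i) delta (sub_elt S r) <= \prod_(j < i) delta j.
Proof. by apply: ler_prod => r _; rewrite delta_ge0 delta_anti // sub_elt_ge. Qed.

Lemma first_isub_subproof i (hik : (i <= k)%N) : #|[set s : 'I_k | (s < i)%N]%SET| == i.
Proof.
rewrite -sum1_card (eq_bigl (fun s : 'I_k => (s < i)%N)); last by move=> s; rewrite inE.
by rewrite (big_ord_narrow hik) /= sum1_card card_ord.
Qed.

Definition first_isub i (hik : (i <= k)%N) : isub k i := exist (fun S : {set 'I_k} => is_true (#|S| == i)) _ (first_isub_subproof hik).

Lemma first_isub_prod i (hik : (i <= k)%N) :
  \prod_(s in val (first_isub hik)) (\row_(j < k) delta j) 0 s = \prod_(j < i) delta j.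
Proof.
rewrite (eq_bigl (fun s : 'I_k => (s < i)%N)); last by move=> s; rewrite inE.
rewrite (big_ord_narrow hik) /=.
by apply: eq_bigr => j _; rewrite mxE.
Qed.

(** An increasing list of i.+1 indices that differs from 0, ..., i has its last entry beyond i. This
    trades the factor [delta i] for [delta i.+1], which is where the spectral gap enters. *)
Lemma isub_prod_lt i (hik : (i < k)%N) (S : isub k i.+1) : S != first_isub hik ->
  \prod_(r < i.+1) delta (sub_elt S r) <= (\prod_(j < i) delta j) * delta i.+1.
Proof.
move=> SS; have lastS : (i < sub_elt S ord_max)%N.
  rewrite ltn_neqAle (sub_elt_ge S ord_max) andbT; apply: contra SS => /eqP e.
  rewrite -val_eqE eqEcard !card_isub leqnn andbT; apply/fintype.subsetP => s.
  move=> /sub_elt_surj[r <-]; rewrite inE ltnS; apply: (@leq_trans (sub_elt S ord_max)); last by rewrite -e.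
  have [rm|rm] := ltnP r i; first by apply: ltnW; apply: sub_elt_mono.
  have -> : r = ord_max by apply/val_inj/anti_leq; rewrite rm andbT -ltnS ltn_ord.
  exact: leqnn.
rewrite big_ord_recr /=; apply: ler_pM => //.
- exact: prodr_ge0.
- by apply: ler_prod => r _; rewrite delta_ge0 delta_anti // (sub_elt_ge S (widen_ord _ _)).
- exact: delta_anti.
Qed.

Lemma compound_diag_nrm_ge i : (i <= k)%N -> \prod_(j < i) delta j <= nrm (compound i D).
Proof.
move=> hik; rewrite -(first_isub_prod hik) compound_diag.
set S := first_isub hik; set M := diag_mx _.
have -> : \prod_(s in val S) (\row_(j < k) delta j) 0 s = M (enum_rank S) (enum_rank S).
  by rewrite !mxE eqxx enum_rankK mulr1n.
by apply: le_trans (ler_norm _) (entry_le_nrm _ _ _).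
Qed.

Lemma compound_diag_nrm_le i : nrm (compound i D) <=
  #|{: isub k i}|%:R * #|{: isub k i}|%:R * \prod_(j < i) delta j.
Proof.
have P0 : 0 <= \prod_(j < i) delta j by exact: prodr_ge0.
apply: nrm_le_card => r c; rewrite compound_diag !mxE.
case: eqP => _; rewrite ?mulr0n ?normr0 // mulr1n isub_prod ger0_norm ?isub_prod_le //.
exact: prodr_ge0.
Qed.

(** Two distinct diagonal entries of the compound cannot both belong to the first subset, so one of
    them is bounded with [delta i.+1] in place of [delta i]. *)
Lemma compound_diag_kap i : (i < k)%N -> kap (compound i.+1 D) <=
  2 * #|{: isub k i.+1}|%:R ^+ 4 *
   ((\prod_(j < i.+1) delta j) * ((\prod_(j < i) delta j) * delta i.+1)).
Proof.
move=> hik; rewrite compound_diag; apply: kap_diag.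
  by rewrite !mulr_ge0 ?prodr_ge0.
move=> r c rc; rewrite !mxE !isub_prod ger0_norm; last by rewrite mulr_ge0 // prodr_ge0.
have [e|e] := eqVneq (enum_val r : isub k i.+1) (first_isub hik).
  apply: ler_pM; rewrite ?prodr_ge0 ?isub_prod_le //; apply: (@isub_prod_lt _ hik).
  by rewrite -e (inj_eq enum_val_inj) eq_sym.
rewrite mulrC; apply: ler_pM; rewrite ?prodr_ge0 ?isub_prod_le //.
exact: isub_prod_lt e.
Qed.

End DiagonalCompound.
End Compound.

(** * Pivot decomposition and singular values *)

Section Decomposition.
Variable R : realType.

Definition ndiag k (delta : nat -> R) : 'M[R]_k := diag_mx (\row_(j < k) delta j).

(** A substitute for the singular value decomposition: X and Y need not be orthogonal, only
    one-sidedly invertible with bounds C. For decreasing [delta] this still gives the singular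
    values up to factors depending on C and the dimension. *)
Definition bounded_dec (C : R) d k (M : 'M[R]_d) (delta : nat -> R) : Prop :=
  exists (X : 'M[R]_(d, k)) (X' : 'M[R]_(k, d)) (Y : 'M[R]_(k, d)) (Y' : 'M[R]_(d, k)),
  [/\ M = X *m ndiag k delta *m Y, X' *m X = 1%:M, Y *m Y' = 1%:M,
      (nrm X <= C) && (nrm X' <= C) & (nrm Y <= C) && (nrm Y' <= C)].

Definition sv_seq k (delta : nat -> R) : Prop :=
  [/\ forall j, 0 <= delta j, forall j l, (j <= l)%N -> delta l <= delta j &
      forall j, (k <= j)%N -> delta j = 0].

Lemma nrm_block m1 m2 n1 n2 (A : 'M[R]_(m1, n1)) B D (E : 'M[R]_(m2, n2)) :
  nrm (block_mx A B D E) = (nrm A + nrm B) + (nrm D + nrm E).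
Proof.
rewrite /nrm big_split_ord /=; congr (_ + _); rewrite -big_split; apply: eq_bigr => i _.
  by rewrite big_split_ord /=; congr (_ + _); apply: eq_bigr => j _; rewrite ?block_mxEul ?block_mxEur.
by rewrite big_split_ord /=; congr (_ + _); apply: eq_bigr => j _; rewrite ?block_mxEdl ?block_mxEdr.
Qed.

Lemma nrm_tperm n (i j : 'I_n) : nrm (tperm_mx i j : 'M[R]_n) <= n%:R * n%:R.
Proof.
rewrite -[leRHS]mulr1; apply: nrm_le_card => r c; rewrite /tperm_mx /perm_mx !mxE.
by case: eqP => _; rewrite ?normr1 ?normr0.
Qed.

Lemma tperm_mxK n (i j : 'I_n) : tperm_mx i j *m tperm_mx i j = 1%:M :> 'M[R]_n.
Proof. by rewrite /tperm_mx -perm_mxM tperm2 perm_mx1. Qed.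

Definition cons_seq (a : R) (delta : nat -> R) j := if j is j'.+1 then delta j' else a.

Lemma ndiag_cons k a delta :
  ndiag (1 + k) (cons_seq a delta) = block_mx a%:M 0 0 (ndiag k delta).
Proof.
apply/matrixP => i j; rewrite !mxE; case: splitP => i' ei; rewrite !mxE; case: splitP => j' ej; rewrite !mxE.
- by rewrite !ord1 -val_eqE /= ei ej !ord1.
- by rewrite -val_eqE /= ei ej !ord1.
- by rewrite -val_eqE /= ei ej !ord1.
- by rewrite -!val_eqE /= ei ej !add1n.
Qed.

(** Block elimination with the Schur complement of the pivot a. The pivot is split as s t so that t
    can dominate the later diagonal entries, the rescaling being left in the triangular factor as
    s. *)
Lemma elimination_step k (a s t : R) (r : 'rV[R]_k) (c : 'cV[R]_k) (N X X' Y Y' : 'M[R]_k) delta :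
  a != 0 -> s != 0 -> s * t = a ->
  N - a^-1 *: (c *m r) = X *m ndiag k delta *m Y ->
  X' *m X = 1%:M -> Y *m Y' = 1%:M ->
  let L : 'M[R]_(1 + k) := block_mx s%:M 0 ((s / a) *: c) X in
  let L' : 'M[R]_(1 + k) := block_mx s^-1%:M 0 (- (a^-1 *: (X' *m c))) X' in
  let U : 'M[R]_(1 + k) := block_mx 1%:M (a^-1 *: r) 0 Y in
  let U' : 'M[R]_(1 + k) := block_mx 1%:M (- (a^-1 *: (r *m Y'))) 0 Y' in
  [/\ block_mx a%:M r c N = L *m ndiag (1 + k) (cons_seq t delta) *m U,
      L' *m L = 1%:M & U *m U' = 1%:M].
Proof.
move=> a0 s0 sta eN XX YY L L' U U'; split.
- rewrite ndiag_cons /L /U !mulmx_block !(mulmx0, mul0mx, addr0, add0r, mulmx1).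
  congr (block_mx _ _ _ _).
  + by rewrite -scalar_mxM sta.
  + by rewrite -scalar_mxM sta -scalemxAr mul_scalar_mx scalerA mulVf // scale1r.
  + by rewrite mul_mx_scalar scalerA mulrA (mulrC t) sta mulfV // scale1r.
  + rewrite -eN mul_mx_scalar !scalerA -scalemxAl -scalemxAr scalerA.
    have e : t * (s / a) * a^-1 = a^-1 by rewrite mulrA (mulrC t) sta mulfV // mul1r.
    by rewrite e [RHS]addrC subrK.
- rewrite /L /L' mulmx_block !mulmx0 !mul0mx !addr0 !add0r -scalar_mxM mulVf // XX.
  rewrite [RHS]scalar_mx_block; congr block_mx.
  rewrite mulNmx mul_mx_scalar -scalemxAr scalerA; apply/eqP; rewrite addrC subr_eq0; apply/eqP.
  by [].
- rewrite /U /U' mulmx_block !(mulmx0, mul0mx, addr0, add0r, mul1mx) YY.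
  rewrite [RHS]scalar_mx_block; congr block_mx.
  by rewrite -scalemxAl addNr.
Qed.

Lemma ndiag_entry_le k delta j : (j < k)%N -> `|delta j| <= nrm (ndiag k delta).
Proof.
move=> jk; have := entry_le_nrm (ndiag k delta) (Ordinal jk) (Ordinal jk).
by rewrite !mxE eqxx mulr1n.
Qed.

(* Gaussian elimination with complete pivoting: all entries of the triangular
   factors are at most 1 in absolute value, hence the uniform bound. *)
Lemma pivot_dec k : exists2 C : R, 1 <= C &
  forall M : 'M[R]_k, exists2 delta, sv_seq k delta & bounded_dec C k M delta.
Proof.
elim: k => [|k [C C1 IH]].
  exists 1 => // M; exists (fun=> 0); first by split.
  exists 1%:M, 1%:M, 1%:M, 1%:M; rewrite !mulmx1 nrm1 ler01; split=> //.
  by rewrite [M]flatmx0 [RHS]flatmx0.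
(* Chosen so that t = K |a| dominates the diagonal entries of the Schur complement, whose norm is at
   most 2 k^2 |a|. *)
pose K : R := C * (k%:R * k%:R * 2) * C + 1.
have K1 : 1 <= K by rewrite lerDr !mulr_ge0 // (le_trans _ C1).
have K0 : 0 < K by apply: lt_le_trans K1.
(* Bounds each of the four block triangular factors; [B] adds the cost of a permutation matrix. *)
pose Z : R := 1 + K + (C + 1) * (1 + k%:R) + C.
have Z1 : 1 <= Z.
  have : 0 <= (C + 1) * (1 + k%:R) by rewrite mulr_ge0 ?addr_ge0 // (le_trans ler01).
  by rewrite /Z; lra.
have n1 : 1 <= k.+1%:R :> R by rewrite ler1n.
pose B : R := k.+1%:R * k.+1%:R * Z.
have B' : k.+1%:R <= B.
  by rewrite /B -mulrA ler_peMr // mulr_ege1.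
have B1 : 1 <= B by apply: le_trans n1 B'.
exists B => // M.
have [[i0 j0] _ /= amax] := @Order.TotalTheory.arg_maxP _ R ('I_k.+1 * 'I_k.+1)%type
   (ord0, ord0) xpredT (fun ij => `|M ij.1 ij.2|) isT.
set a := M i0 j0 in amax.
have Ma i j : `|M i j| <= `|a| by exact: (amax (i, j)).
have [a0|a0] := eqVneq a 0.
  exists (fun=> 0); first by split.
  exists 1%:M, 1%:M, 1%:M, 1%:M; rewrite !mulmx1 nrm1 B'; split=> //.
  apply/matrixP => i j; rewrite mul1mx /ndiag !mxE mul0rn; apply/eqP.
  by rewrite -normr_le0 (le_trans (Ma i j)) // a0 normr0.
pose P : 'M[R]_(1 + k) := tperm_mx ord0 i0; pose Q : 'M[R]_(1 + k) := tperm_mx ord0 j0.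
have PP : P *m P = 1%:M by exact: tperm_mxK.
have QQ : Q *m Q = 1%:M by exact: tperm_mxK.
pose M1 : 'M[R]_(1 + k) := xrow ord0 i0 (xcol ord0 j0 M).
have MM1 : M = P *m M1 *m Q.
  rewrite /M1 xrowE xcolE -/P -/Q !mulmxA PP mul1mx -mulmxA QQ mulmx1 //.
have M1a i j : `|M1 i j| <= `|a| by rewrite !mxE.
have M100 : M1 ord0 ord0 = a by rewrite !mxE !tpermL.
pose r := ursubmx M1; pose c := dlsubmx M1; pose N := drsubmx M1.
have M1E : M1 = block_mx a%:M r c N.
  rewrite -[LHS]submxK; congr block_mx; apply/matrixP => i j; rewrite !mxE !ord1 eqxx mulr1n.
  rewrite -M100 !mxE; congr (M (tperm _ _ _) (tperm _ _ _)); exact/val_inj.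
have ra : nrm (a^-1 *: r) <= k%:R.
  rewrite -[leRHS]mulr1 -[k%:R]mul1r; apply: nrm_le_card => i j.
  by rewrite !mxE normrM normfV ler_pdivrMl ?normr_gt0 // mulr1 Ma.
have ca : nrm (a^-1 *: c) <= k%:R.
  rewrite -[leRHS]mulr1 -[k%:R]mulr1; apply: nrm_le_card => i j.
  by rewrite !mxE normrM normfV ler_pdivrMl ?normr_gt0 // mulr1 Ma.
pose N' := N - a^-1 *: (c *m r).
have N'a : nrm N' <= k%:R * k%:R * (2 * `|a|).
  apply: nrm_le_card => i j; rewrite !mxE big_ord1.
  apply: le_trans (ler_normB _ _) _; rewrite mulr2n mulrDl mul1r; apply: lerD.
    exact: Ma.
  rewrite !mxE mulrA !normrM normfV.
  apply: (@le_trans _ _ (1 * `|a|)); last by rewrite mul1r.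
  apply: ler_pM => //; rewrite ?mulr_ge0 ?invr_ge0 //.
  by rewrite ler_pdivrMl ?normr_gt0 // mulr1 Ma.
have [delta [d0 danti dz] [X [X' [Y [Y' [eN XX YY /andP[XC X'C] /andP[YC Y'C]]]]]]] := IH N'.
pose t := K * `|a|; pose s := a / t.
have t0 : 0 < t by rewrite mulr_gt0 // normr_gt0.
have s0 : s != 0 by rewrite mulf_neq0 // invr_eq0 gt_eqF.
have sta : s * t = a by rewrite /s divfK // gt_eqF.
have ns : `|s| = K^-1.
  rewrite /s normrM normfV (gtr0_norm t0) /t invfM mulrC -mulrA mulVf ?mulr1 //.
  by rewrite normr_eq0.
have [eM LL UU] := elimination_step a0 s0 sta eN XX YY.
move: eM LL UU; set L := block_mx s%:M _ _ _; set L' := block_mx s^-1%:M _ _ _.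
set U := block_mx 1%:M (_ *: r) _ _; set U' := block_mx 1%:M _ _ _.
rewrite /= => eM LL UU.
have nscal (x : R) : nrm (x%:M : 'M[R]_1) = `|x|.
  by rewrite /nrm !big_ord1 mxE eqxx mulr1n.
have KV : K^-1 <= 1 by rewrite invf_le1.
have nk : 0 <= k%:R :> R by [].
have C0 : 0 <= C by apply: le_trans C1.
have Ck : 0 <= C * k%:R by rewrite mulr_ge0.
have LB : nrm L <= Z.
  rewrite nrm_block nrm0 addr0 nscal ns (_ : (s / a) *: c = s *: (a^-1 *: c)); last by rewrite scalerA.
  rewrite nrmZ ns; have := ler_pM (_ : 0 <= K^-1) (nrm_ge0 _) KV ca.
  rewrite invr_ge0 (ltW K0) => /(_ isT); rewrite /Z; lra.
have L'B : nrm L' <= Z.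
  rewrite nrm_block nrm0 addr0 nscal normfV ns invrK nrmN scalemxAr.
  have := le_trans (nrm_mul X' (a^-1 *: c)) (ler_pM (nrm_ge0 _) (nrm_ge0 _) X'C ca); rewrite /Z; lra.
have UB : nrm U <= Z.
  by rewrite nrm_block nrm0 nscal normr1 /Z; lra.
have U'B : nrm U' <= Z.
  rewrite nrm_block nrm0 nscal normr1 nrmN scalemxAl.
  have := le_trans (nrm_mul (a^-1 *: r) Y') (ler_pM (nrm_ge0 _) (nrm_ge0 _) ra Y'C); rewrite /Z; lra.
have PB (W : 'M[R]_(1 + k)) i j : nrm W <= Z ->
    (nrm (tperm_mx i j *m W) <= B) /\ (nrm (W *m tperm_mx i j) <= B).
  move=> WB; split; apply: le_trans (nrm_mul _ _) _; last rewrite mulrC.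
    by apply: (ler_pM _ _ (@nrm_tperm k.+1 i j) WB); exact: nrm_ge0.
  by apply: (ler_pM _ _ (@nrm_tperm k.+1 i j) WB); exact: nrm_ge0.
exists (cons_seq t delta).
  split.
  - by case=> [|j] /=; [exact: ltW | exact: d0].
  (* The later diagonal entries are recovered as X' N' Y', so they are at most C |N'| C, hence at
     most K |a| = t. *)
  - have dt l : delta l <= t.
      have [lk|/dz ->] := ltnP l k; last exact: ltW.
      apply: le_trans (le_trans (ler_norm _) (ndiag_entry_le delta lk)) _.
      have -> : ndiag k delta = X' *m N' *m Y'.
        by rewrite eN !mulmxA XX mul1mx -mulmxA YY mulmx1.
      have h1 := le_trans (nrm_mul X' N') (ler_pM (nrm_ge0 _) (nrm_ge0 _) X'C N'a).
      have h2 := le_trans (nrm_mul (X' *m N') Y') (ler_pM (nrm_ge0 _) (nrm_ge0 _) h1 Y'C).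
      apply: le_trans h2 _; rewrite /t /K.
      rewrite [leLHS](_ : _ = C * (k%:R * k%:R * 2) * C * `|a|); last by ring.
      by rewrite ler_wpM2r // lerDl.
    by case=> [|j] [|l] //= jl; exact: danti.
  - by case=> [|j] //= /dz.
exists (P *m L), (L' *m P), (U *m Q), (Q *m U'); split.
- by rewrite {1}MM1 M1E eM !mulmxA.
- by rewrite !mulmxA -(mulmxA L' P) PP mulmx1.
- by rewrite !mulmxA -(mulmxA U Q) QQ mulmx1.
- by rewrite (PB _ _ _ LB).1 (PB _ _ _ L'B).2.
- by rewrite (PB _ _ _ UB).2 (PB _ _ _ U'B).1.
Qed.

End Decomposition.

(** * Singular values read off from a bounded decomposition *)

Section SingularValues.
Variable R : realType.

Lemma vnorm_ge0 n (v : 'cV[R]_n) : 0 <= vnorm v. Proof. exact: sqrtr_ge0. Qed.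
Hint Resolve vnorm_ge0 : core.

Lemma nrm_colE n (v : 'cV[R]_n) : nrm v = \sum_r `|v r 0|.
Proof. by apply: eq_bigr => r _; rewrite big_ord1. Qed.

Lemma vnorm_le_nrm n (v : 'cV[R]_n) : vnorm v <= nrm v.
Proof.
have {1}-> : nrm v = Num.sqrt (nrm v ^+ 2) by rewrite sqrtr_sqr ger0_norm ?nrm_ge0.
rewrite ler_wsqrtr // expr2 {1}nrm_colE mulr_suml.
apply: ler_sum => r _.
by rewrite -real_normK ?num_real // expr2 ler_wpM2l ?nrm_ge0 // entry_le_nrm.
Qed.

Lemma entry_le_vnorm n (v : 'cV[R]_n) r : `|v r 0| <= vnorm v.
Proof.
rewrite -sqrtr_sqr ler_wsqrtr // (bigD1 r) //= lerDl.
by apply: sumr_ge0 => *; exact: sqr_ge0.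
Qed.

Lemma nrm_le_vnorm n (v : 'cV[R]_n) : nrm v <= n%:R * vnorm v.
Proof.
rewrite nrm_colE mulr_natl -[X in _ *+ X]card_ord -sumr_const.
by apply: ler_sum => r _; exact: entry_le_vnorm.
Qed.

Lemma vnormZ n a (v : 'cV[R]_n) : vnorm (a *: v) = `|a| * vnorm v.
Proof.
rewrite /vnorm -sqrtr_sqr -sqrtrM ?sqr_ge0 // mulr_sumr; congr Num.sqrt.
by apply: eq_bigr => r _; rewrite mxE exprMn.
Qed.

Lemma vnorm_eq0 n (v : 'cV[R]_n) : vnorm v = 0 -> v = 0.
Proof.
move=> v0; apply/matrixP => r c; rewrite ord1 mxE; apply/eqP.
by rewrite -normr_le0 -v0 entry_le_vnorm.
Qed.

Lemma vnorm_delta n (r : 'I_n) : vnorm (delta_mx r 0 : 'cV[R]_n) = 1.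
Proof.
rewrite /vnorm (bigD1 r) //= big1 ?addr0 ?mxE ?eqxx ?expr1n ?sqrtr1 // => j jr.
by rewrite mxE (negbTE jr) expr0n.
Qed.

Lemma opnorm_bounds n (M : 'M[R]_n) : opnorm M <= nrm M * n%:R /\ nrm M <= n%:R * n%:R * opnorm M.
Proof.
have ub : ubound [set vnorm (M *m v) | v in [set v : 'cV[R]_n | vnorm v <= 1]] (nrm M * n%:R).
  move=> _ [v /= v1 <-]; apply: le_trans (vnorm_le_nrm _) _; apply: le_trans (nrm_mul _ _) _.
  rewrite ler_wpM2l ?nrm_ge0 // (le_trans (nrm_le_vnorm v)) // -[leRHS]mulr1 ler_wpM2l ?nrm_ge0 //.
have v00 : vnorm (0 : 'cV[R]_n) = 0.
  by apply/eqP; rewrite eq_le vnorm_ge0 andbT (le_trans (vnorm_le_nrm _)) // nrm0.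
split.
  apply: ge_sup => //; exists (vnorm (M *m 0)), 0 => //=.
  by rewrite v00 ler01.
apply: nrm_le_card => r c.
have <- : (M *m (delta_mx c 0 : 'cV_n)) r 0 = M r c by rewrite -colE mxE.
apply: le_trans (entry_le_vnorm _ _) _; apply: ub_le_sup; first by exists (nrm M * n%:R).
by exists (delta_mx c 0) => //=; rewrite vnorm_delta.
Qed.

Definition sv_inner d j (A : 'M[R]_d) (U : 'M[R]_(j, d)) : set R :=
  [set vnorm (A *m (x *m U)^T) | x in [set x : 'rV[R]_j | vnorm (x *m U)^T = 1]].

Lemma sv_inner_scale d j (A : 'M[R]_d) (U : 'M[R]_(j, d)) (x : 'rV[R]_j) : x *m U != 0 ->
  exists y, [/\ vnorm (y *m U)^T = 1 & exists a, y = a *: x].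
Proof.
move=> xU; set a := vnorm (x *m U)^T.
have a0 : a != 0.
  by apply: contra xU => /eqP /vnorm_eq0 h; rewrite -[x *m U]trmxK h trmx0.
exists (a^-1 *: x); split; last by exists a^-1.
by rewrite -scalemxAl linearZ /= vnormZ normfV (ger0_norm (vnorm_ge0 _)) mulVf.
Qed.

Lemma sv_inner_lb d j (A : 'M[R]_d) (U : 'M[R]_(j, d)) : lbound (sv_inner A U) 0.
Proof. by move=> _ [x _ <-]. Qed.

Lemma sv_inner_neq0 d j (A : 'M[R]_d) (U : 'M[R]_(j.+1, d)) : \rank U = j.+1 -> sv_inner A U !=set0.
Proof.
move=> rU; have U0 : U != 0 by apply/negP => /eqP U0; rewrite U0 mxrank0 in rU.
have /rowV0Pn[v /submxP[x xv]] := U0; rewrite xv => xU.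
have [y [y1 _]] := sv_inner_scale A xU.
by exists (vnorm (A *m (y *m U)^T)), y.
Qed.

Lemma sv_inf_le d j (A : 'M[R]_d) (U : 'M[R]_(j, d)) x : vnorm (x *m U)^T = 1 ->
  inf (sv_inner A U) <= vnorm (A *m (x *m U)^T).
Proof.
by move=> x1; apply: ge_inf; [exists 0; exact: sv_inner_lb | exists x].
Qed.

Lemma sv_inf_ub d j (A : 'M[R]_d) (U : 'M[R]_(j.+1, d)) : \rank U = j.+1 ->
  inf (sv_inner A U) <= nrm A * d%:R.
Proof.
move=> rU; have [z [x x1 _]] := sv_inner_neq0 A rU.
apply: le_trans (sv_inf_le A x1) _; apply: le_trans (vnorm_le_nrm _) _.
apply: le_trans (nrm_mul _ _) _; rewrite ler_wpM2l ?nrm_ge0 //.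
by apply: le_trans (nrm_le_vnorm _) _; rewrite x1 mulr1.
Qed.

Lemma nrm_ndiag_le k delta j (e : 'cV[R]_k) : (forall l, 0 <= delta l) ->
  (forall r : 'I_k, (r < j)%N -> e r 0 = 0) -> (forall l, (j <= l)%N -> delta l <= delta j) ->
  nrm (ndiag k delta *m e) <= delta j * nrm e.
Proof.
move=> d0 e0 danti; rewrite !nrm_colE mulr_sumr; apply: ler_sum => r _.
rewrite mul_diag_mx !mxE normrM (ger0_norm (d0 r)).
have [rj|jr] := ltnP r j; first by rewrite e0 // normr0 !mulr0.
by rewrite ler_wpM2r ?nrm_ge0 // danti.
Qed.

Lemma nrm_ndiag_ge k delta j (e : 'cV[R]_k) : (forall l, 0 <= delta l) ->
  (forall r : 'I_k, (j < r)%N -> e r 0 = 0) -> (forall l, (l <= j)%N -> delta j <= delta l) ->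
  delta j * nrm e <= nrm (ndiag k delta *m e).
Proof.
move=> d0 e0 danti; rewrite !nrm_colE mulr_sumr; apply: ler_sum => r _.
rewrite mul_diag_mx !mxE normrM (ger0_norm (d0 r)).
have [rj|jr] := ltnP j r; first by rewrite e0 // normr0 !mulr0.
by rewrite ler_wpM2r ?nrm_ge0 // danti.
Qed.

(** Dimension count: a subspace of dimension j.+1 contains a nonzero v such that the first j
    coordinates of Y v vanish, and on such vectors the diagonal matrix expands by at most [delta j].
    Singular values are counted from 1 and [delta] from 0. *)
Lemma singval_le (C : R) d k (M : 'M[R]_d) delta j : sv_seq k delta -> bounded_dec C k M delta ->
  singval j.+1 M <= C * C * d%:R * delta j.
Proof.
move=> [d0 danti dz] [X [X' [Y [Y' [eM XX YY /andP[XC X'C] /andP[YC Y'C]]]]]].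
have C0 : 0 <= C by exact: le_trans (nrm_ge0 _) XC.
rewrite /singval; case: ifP => [jd|_]; last by rewrite !mulr_ge0.
apply: ge_sup.
  exists (inf (sv_inner M (pid_mx j.+1 : 'M[R]_(j.+1, d)))), (pid_mx j.+1) => //=.
  by rewrite rank_pid_mx.
move=> _ [U /= rU <-].
(* Multiplication by F keeps the first j coordinates; its j columns cannot detect all of a
   (j.+1)-dimensional space. *)
pose F : 'M[R]_(k, j) := \matrix_(r, c) (r == c :> nat)%:R.
have /rowV0Pn[x xk x0] : kermx (U *m Y^T *m F) != 0.
  rewrite -mxrank_eq0 mxrank_ker subn_eq0 -ltnNge.
  by apply: leq_ltn_trans (rank_leq_col _) _.
have {xk} xk : x *m (U *m Y^T *m F) = 0 by apply/sub_kermxP.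
have xU : x *m U != 0.
  have /row_freeP[V UV] : row_free U by rewrite /row_free rU.
  by apply: contra x0 => /eqP h; rewrite -[x]mulmx1 -UV mulmxA h mul0mx.
have [y [y1 [a ya]]] := sv_inner_scale M xU.
apply: le_trans (sv_inf_le M y1) _.
set v := (y *m U)^T in y1 *.
have Yv (r : 'I_k) : (r < j)%N -> (Y *m v) r 0 = 0.
  move=> rj.
  have -> : Y *m v = a *: (x *m (U *m Y^T))^T.
    by rewrite /v ya -scalemxAl linearZ /= -scalemxAr !trmx_mul trmxK mulmxA.
  have := congr1 (fun Z : 'rV[R]_j => Z 0 (Ordinal rj)) xk.
  rewrite mulmxA mxE (bigD1 r) //= big1 => [|l lr]; last first.
    by move: lr; rewrite -val_eqE /= [F _ _]mxE => /negbTE ->; rewrite mulr0.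
  by rewrite addr0 [F _ _]mxE eqxx mulr1 !mxE => ->; rewrite mulr0.
apply: le_trans (vnorm_le_nrm _) _; rewrite eM -!mulmxA.
apply: le_trans (nrm_mul _ _) _.
have h1 : nrm (ndiag k delta *m (Y *m v)) <= delta j * nrm (Y *m v).
  by apply: nrm_ndiag_le => // l; exact: danti.
have h2 : nrm (Y *m v) <= C * d%:R.
  apply: le_trans (nrm_mul _ _) _; apply: ler_pM; rewrite ?nrm_ge0 //.
  by apply: le_trans (nrm_le_vnorm _) _; rewrite y1 mulr1.
have h3 := ler_wpM2l (d0 j) h2.
have h4 := ler_pM (nrm_ge0 X) (nrm_ge0 _) XC (le_trans h1 h3).
by apply: le_trans h4 _; rewrite le_eqVlt; apply/orP; left; apply/eqP; ring.
Qed.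

(** The test subspace is the image under Y' of the first j.+1 coordinate vectors: Y inverts Y', so
    the diagonal matrix acts there through its j.+1 largest entries. *)
Lemma singval_ge (C : R) d k (M : 'M[R]_d) delta j : sv_seq k delta -> bounded_dec C k M delta ->
  0 < C -> (k <= d)%N -> (j < k)%N -> delta j <= C * C * d%:R * singval j.+1 M.
Proof.
move=> [d0 danti dz] [X [X' [Y [Y' [eM XX YY /andP[XC X'C] /andP[YC Y'C]]]]]] C0 kd jk.
have dpos : 0 < d%:R :> R by rewrite ltr0n (leq_ltn_trans _ (leq_trans jk kd)).
rewrite /singval /= (leq_trans jk kd).
pose E : 'M[R]_(j.+1, k) := pid_mx j.+1.
pose U := E *m Y'^T.
have UY : U *m Y^T = E by rewrite /U -mulmxA -trmx_mul YY trmx1 mulmx1.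
have rU : \rank U = j.+1.
  apply/eqP; rewrite eqn_leq rank_leq_row /= -[X in (X <= _)%N](rank_pid_mx R (leqnn j.+1) jk).
  by rewrite -/E -UY mxrankM_maxl.
have c0 : 0 < C * C * d%:R by rewrite !mulr_gt0.
rewrite -ler_pdivrMl //; apply: le_trans (_ : inf (sv_inner M U) <= _); last first.
  apply: ub_le_sup; last by exists U.
  by exists (nrm M * d%:R) => _ [V /= rV <-]; exact: sv_inf_ub.
apply: lb_le_inf; first exact: sv_inner_neq0.
move=> _ [x x1 <-]; rewrite ler_pdivrMl //.
set v := (x *m U)^T in x1 *.
pose e := (x *m E)^T.
have ve : v = Y' *m e by rewrite /v /U /e !trmx_mul trmxK mulmxA.
have eMv : M *m v = X *m (ndiag k delta *m e).
  by rewrite ve eM -!mulmxA (mulmxA Y) YY mul1mx.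
have e0 (r : 'I_k) : (j < r)%N -> e r 0 = 0.
  move=> jr; rewrite !mxE big1 // => l _; rewrite !mxE.
  by rewrite (_ : (l == r :> nat) = false) ?mulr0 // ltn_eqF // (leq_trans (ltn_ord l)).
have h1 : delta j * nrm e <= nrm (ndiag k delta *m e).
  by apply: nrm_ndiag_ge => // l; exact: danti.
have h2 := nrm_inv_lb (ndiag k delta *m e) XX.
have h3 : 1 <= C * nrm e.
  have := vnorm_le_nrm v; rewrite x1 {1}ve => h; apply: le_trans h _.
  by apply: le_trans (nrm_mul _ _) _; rewrite ler_wpM2r ?nrm_ge0.
have h4 : nrm (M *m v) <= d%:R * vnorm (M *m v) by exact: nrm_le_vnorm.
have h5 : nrm X' * nrm (X *m (ndiag k delta *m e)) <= C * (d%:R * vnorm (M *m v)).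
  by apply: ler_pM; rewrite ?nrm_ge0 //; rewrite -eMv.
have h6 := le_trans h1 (le_trans h2 h5).
have h7 : delta j <= C * (delta j * nrm e) by rewrite mulrCA ler_peMr.
apply: le_trans h7 _; rewrite -!mulrA; apply: ler_wpM2l; first exact: ltW.
by apply: le_trans h6 _.
Qed.

Lemma nrm_conj_bounds (C : R) d k (X : 'M[R]_(d, k)) (X' Y : 'M[R]_(k, d)) (Y' : 'M[R]_(d, k)) (N : 'M[R]_k) :
  X' *m X = 1%:M -> Y *m Y' = 1%:M ->
  nrm X <= C -> nrm X' <= C -> nrm Y <= C -> nrm Y' <= C ->
  nrm (X *m N *m Y) <= C * C * nrm N /\ nrm N <= C * C * nrm (X *m N *m Y).
Proof.
move=> XX YY XC X'C YC Y'C; have C0 : 0 <= C by exact: le_trans (nrm_ge0 _) XC.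
split.
  have h1 := le_trans (nrm_mul X N) (ler_wpM2r (nrm_ge0 _) XC).
  have h2 := le_trans (nrm_mul (X *m N) Y) (ler_pM (nrm_ge0 _) (nrm_ge0 _) h1 YC).
  by apply: le_trans h2 _; rewrite mulrC mulrA.
have {1}-> : N = X' *m (X *m N *m Y) *m Y'.
  by rewrite !mulmxA XX mul1mx -mulmxA YY mulmx1.
set Z := X *m N *m Y.
have h1 := le_trans (nrm_mul X' Z) (ler_wpM2r (nrm_ge0 _) X'C).
have h2 := le_trans (nrm_mul (X' *m Z) Y') (ler_pM (nrm_ge0 _) (nrm_ge0 _) h1 Y'C).
by apply: le_trans h2 _; rewrite mulrC mulrA.
Qed.

(** Compounds preserve one-sided inverses and bounds, so only the compound of the diagonal factor
    counts. This is the rough form of |wedge_i M| = s_1 ... s_i. *)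
Lemma bounded_dec_compound (C : R) d k i : exists2 C' : R, 0 < C' & forall (M : 'M[R]_d) delta,
  sv_seq k delta -> bounded_dec C k M delta -> (i <= k)%N ->
  nrm (compound i M) <= C' * \prod_(j < i) delta j /\
  \prod_(j < i) delta j <= C' * nrm (compound i M).
Proof.
have [C1 C10 h1] := @compound_bound R i d k C.
have [C2 C20 h2] := @compound_bound R i k d C.
pose D := C1 + C2.
pose n := #|{: isub k i}|%:R : R.
exists (D * D * (n * n) + D * D + 1).
  by rewrite ltr_wpDl // ?addr_ge0 ?mulr_ge0 ?addr_ge0 // ler0n.
move=> M delta [d0 danti dz] [X [X' [Y [Y' [eM XX YY /andP[XC X'C] /andP[YC Y'C]]]]]] ik.
have XX' : compound i X' *m compound i X = 1%:M by rewrite -compound_mul XX compound1.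
have YY' : compound i Y *m compound i Y' = 1%:M by rewrite -compound_mul YY compound1.
have D1 x : x <= C1 -> x <= D by move=> h; apply: le_trans h _; rewrite lerDl.
have D2 x : x <= C2 -> x <= D by move=> h; apply: le_trans h _; rewrite lerDr.
have [] := nrm_conj_bounds (compound i (ndiag k delta)) XX' YY' (D1 _ (h1 _ XC)) (D2 _ (h2 _ X'C))
  (D2 _ (h2 _ YC)) (D1 _ (h1 _ Y'C)).
rewrite -!compound_mul -eM => h3 h4.
have DD : 0 <= D * D by rewrite mulr_ge0 // addr_ge0.
have P0 : 0 <= \prod_(j < i) delta j by exact: prodr_ge0.
split.
  apply: le_trans h3 _.
  have h5 := ler_wpM2l DD (compound_diag_nrm_le k d0 danti i).
  apply: le_trans h5 _.
  rewrite [leRHS](_ : _ = D * D * (n * n * \prod_(j < i) delta j) + (D * D + 1) * \prod_(j < i) delta j); last by ring.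
  by rewrite lerDl mulr_ge0 // addr_ge0.
have h5 := le_trans (compound_diag_nrm_ge delta ik) h4.
apply: le_trans h5 _.
rewrite [leRHS](_ : _ = D * D * nrm (compound i M) + (D * D * (n * n) + 1) * nrm (compound i M)); last by ring.
by rewrite lerDl mulr_ge0 ?nrm_ge0 // addr_ge0 // mulr_ge0 // mulr_ge0 // ler0n.
Qed.

Lemma bounded_dec_kap (C : R) k i : exists2 C' : R, 0 < C' & forall (M : 'M[R]_k) delta,
  sv_seq k delta -> bounded_dec C k M delta -> (i < k)%N ->
  kap (compound i.+1 M) <= C' * ((\prod_(j < i.+1) delta j) * ((\prod_(j < i) delta j) * delta i.+1)).
Proof.
have [C1 C10 h1] := @compound_bound R i.+1 k k C.
pose n := #|{: isub k i.+1}|%:R : R.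
exists ((2 * C1 ^+ 2) * (2 * n ^+ 4) * (2 * C1 ^+ 2) + 1).
  by rewrite ltr_wpDl // !mulr_ge0 // exprn_ge0 // ler0n.
move=> M delta [d0 danti dz] [X [X' [Y [Y' [eM XX YY /andP[XC X'C] /andP[YC Y'C]]]]]] ik.
rewrite eM !compound_mul.
set P := \prod_(j < i.+1) _ * _.
have P0 : 0 <= P by rewrite !mulr_ge0 // prodr_ge0.
have kC (Z : 'M[R]_k) : nrm Z <= C -> kap (compound i.+1 Z) <= 2 * C1 ^+ 2.
  move=> ZC; apply: le_trans (kap_le _) _; rewrite ler_wpM2l ?nrm_ge0 // lerXn2r ?nnegrE ?nrm_ge0 //.
  exact: h1.
have hd : kap (compound i.+1 (ndiag k delta)) <= 2 * n ^+ 4 * P by exact: compound_diag_kap.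
apply: le_trans (kap_mul _ _) _.
have h2 := le_trans (kap_mul (compound i.+1 X) (compound i.+1 (ndiag k delta)))
  (ler_pM (kap_ge0 _) (kap_ge0 _) (kC _ XC) hd).
have h3 := ler_pM (kap_ge0 _) (kap_ge0 _) h2 (kC _ YC).
apply: le_trans h3 _.
rewrite [leRHS](_ : _ = 2 * C1 ^+ 2 * (2 * n ^+ 4 * P) * (2 * C1 ^+ 2) + P); last by ring.
by rewrite lerDl.
Qed.

(* When the compound is a scalar there are no two distinct diagonal entries. *)
Lemma kap_compound_full k (M : 'M[R]_k) : kap (compound k M) = 0.
Proof.
have c1 : #|{: isub k k}| = 1%N.
  rewrite -(card1 (first_isub (leqnn k))); apply: eq_card => S; rewrite !inE; symmetry.
  by rewrite -val_eqE eqEcard !card_isub leqnn andbT; apply/fintype.subsetP => s _; rewrite inE.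
have z0 (z : 'I_#|{: isub k k}|) : nat_of_ord z = 0%N.
  by have := leq_trans (ltn_ord z) (eq_leq c1); rewrite ltnS leqn0 => /eqP.
have o (x y : 'I_#|{: isub k k}|) : x = y by apply: val_inj; rewrite /= !z0.
rewrite /kap big1 // => a _; rewrite big1 // => b _; rewrite big1 // => c _.
by rewrite big1 // => d _; rewrite /minor2 (o b a) (o d c) subrr normr0.
Qed.
End SingularValues.
#[global] Hint Resolve vnorm_ge0 : core.

(** * Expectations over finite words *)

Section Words.
Variable m : nat.
Local Notation word := (nat -> letter m).

Definition scons (a : letter m) (w : word) : word := fun t => if t is t'.+1 then w t' else a.
Definition wshift (n : nat) (w : word) : word := fun t => w (n + t)%N.
Definition pcat (n : nat) (u w : word) : word := fun t => if (t < n)%N then u t else w (t - n)%N.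

Definition depends (T : Type) (n : nat) (F : word -> T) : Prop :=
  forall w w', (forall t, (t < n)%N -> w t = w' t) -> F w = F w'.

Lemma scons_wshift w : scons (w 0%N) (wshift 1 w) = w.
Proof. by apply/funext => -[|t]. Qed.

Lemma wshift0 w : wshift 0 w = w. Proof. by []. Qed.

Lemma wshiftD j k w : wshift j (wshift k w) = wshift (k + j) w.
Proof. by apply/funext => t; rewrite /wshift addnA. Qed.

Lemma pcat0 u w : pcat 0 u w = w.
Proof. by apply/funext => t; rewrite /pcat subn0. Qed.

Lemma pcatS n a u w : pcat n.+1 (scons a u) w = scons a (pcat n u w).
Proof. by apply/funext => -[|t]. Qed.

Lemma wshift_pcat n u w : wshift n (pcat n u w) = w.
Proof. by apply/funext => t; rewrite /wshift /pcat ltnNge leq_addr /= addKn. Qed.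

Lemma depends_scons T n (F : word -> T) a : depends n.+1 F -> depends n (fun w => F (scons a w)).
Proof. by move=> h w w' ww'; apply: h => -[|t] //= tn; exact: ww'. Qed.

Lemma depends_shift T n j (F : word -> T) : depends n F -> depends (j + n) (fun w => F (wshift j w)).
Proof. by move=> h w w' ww'; apply: h => t tn; apply: ww'; rewrite ltn_add2l. Qed.

End Words.

(** * Finite expectations and Azuma's inequality *)

Section FiniteExpectation.
Variables (R : realType) (m : nat) (p : 'I_m.+1 -> R).
Hypotheses (p_pos : forall j, 0 < p j) (p_sum : \sum_j p j = 1).
Local Notation word := (nat -> letter m).

(** Expectation over n independent letters as a finite sum, so that conditioning on the first letter
    is one unfolding. Positions from n on hold the default letter [ord0], which is irrelevant for
    functions that satisfy [depends n]. *)
Fixpoint Ex (n : nat) (F : word -> R) : R :=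
  if n is n'.+1 then \sum_(a < m.+1) p a * Ex n' (fun w => F (scons a w))
  else F (fun=> ord0).

Lemma p_ge0 j : 0 <= p j. Proof. exact: ltW. Qed.

Lemma ExS n F : Ex n.+1 F = \sum_(a < m.+1) p a * Ex n (fun w => F (scons a w)).
Proof. by []. Qed.

Lemma eq_Ex n F G : (forall w, F w = G w) -> Ex n F = Ex n G.
Proof. by move=> /funext ->. Qed.

Lemma Ex_cst n (x : R) : Ex n (fun=> x) = x.
Proof. by elim: n => //= n IH; rewrite IH -mulr_suml p_sum mul1r. Qed.

Lemma ExD n F G : Ex n (fun w => F w + G w) = Ex n F + Ex n G.
Proof.
elim: n F G => //= n IH F G; rewrite -big_split; apply: eq_bigr => a _ /=.
by rewrite IH mulrDr.
Qed.

Lemma ExZ n c F : Ex n (fun w => c * F w) = c * Ex n F.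
Proof.
elim: n F => //= n IH F; rewrite mulr_sumr; apply: eq_bigr => a _.
by rewrite IH mulrCA.
Qed.

Lemma ExN n F : Ex n (fun w => - F w) = - Ex n F.
Proof. by rewrite -mulN1r -ExZ; apply: eq_Ex => w; rewrite mulN1r. Qed.

Lemma ExB n F G : Ex n (fun w => F w - G w) = Ex n F - Ex n G.
Proof. by rewrite ExD ExN. Qed.

Lemma Ex_sum n I (r : seq I) (P : pred I) (F : I -> word -> R) :
  Ex n (fun w => \sum_(i <- r | P i) F i w) = \sum_(i <- r | P i) Ex n (F i).
Proof.
elim: r => [|i r IH].
  by rewrite big_nil -[RHS](Ex_cst n); apply: eq_Ex => w; rewrite big_nil.
rewrite big_cons -IH; case: ifP => Pi; last by apply: eq_Ex => w; rewrite big_cons Pi.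
by rewrite -ExD; apply: eq_Ex => w; rewrite big_cons Pi.
Qed.

Lemma Ex_le n F G : (forall w, F w <= G w) -> Ex n F <= Ex n G.
Proof.
elim: n F G => //= n IH F G FG; apply: ler_sum => a _.
by apply: ler_wpM2l; [exact: p_ge0 | exact: IH].
Qed.

Lemma Ex_ge0 n F : (forall w, 0 <= F w) -> 0 <= Ex n F.
Proof. by move=> F0; rewrite -(Ex_cst n 0); exact: Ex_le. Qed.

Lemma Ex_norm_le n F c : (forall w, `|F w| <= c) -> `|Ex n F| <= c.
Proof.
move=> Fc; rewrite ler_norml -{1}(Ex_cst n c) -ExN -{2}(Ex_cst n c).
by apply/andP; split; apply: Ex_le => w; have := Fc w; rewrite ler_norml => /andP[].
Qed.

Lemma Ex_pcat n k F : Ex (n + k) F = Ex n (fun u => Ex k (fun w => F (pcat n u w))).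
Proof.
elim: n F => [|n IH] F; first by rewrite /=; apply: eq_Ex => w; rewrite pcat0.
rewrite addSn !ExS; apply: eq_bigr => a _; rewrite IH; congr (_ * _).
by apply: eq_Ex => u; apply: eq_Ex => w; rewrite pcatS.
Qed.

Lemma Ex_depends n k F : (n <= k)%N -> depends n F -> Ex k F = Ex n F.
Proof.
move=> /subnKC <- h; rewrite Ex_pcat; apply: eq_Ex => u.
rewrite -[RHS](Ex_cst (k - n)); apply: eq_Ex => w; apply: h => t tn.
by rewrite /pcat tn.
Qed.

Lemma Ex_shift n j F : Ex (j + n) (fun w => F (wshift j w)) = Ex n F.
Proof.
rewrite Ex_pcat -[RHS](Ex_cst j); apply: eq_Ex => u; apply: eq_Ex => w.
by rewrite wshift_pcat.
Qed.

Definition ind (A : word -> Prop) (w : word) : R := (`[< A w >] : nat)%:R.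

Lemma ind_ge0 A w : 0 <= ind A w. Proof. by rewrite /ind ler0n. Qed.
Lemma ind_le1 A w : ind A w <= 1. Proof. by rewrite /ind lern1 leq_b1. Qed.
Lemma ind1 (A : word -> Prop) w : A w -> ind A w = 1.
Proof. by move=> h; rewrite /ind asboolT. Qed.
Lemma ind0 (A : word -> Prop) w : ~ A w -> ind A w = 0.
Proof. by move=> h; rewrite /ind asboolF. Qed.

Lemma ind_le (A : word -> Prop) w x : 0 <= x -> (A w -> 1 <= x) -> ind A w <= x.
Proof. by move=> x0 h; have [Aw|Aw] := pselect (A w); [rewrite ind1 // h | rewrite ind0]. Qed.

Definition Prob n (A : word -> Prop) : R := Ex n (ind A).

Lemma Prob_ge0 n A : 0 <= Prob n A. Proof. by apply: Ex_ge0 => w; exact: ind_ge0. Qed.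

Lemma Prob_le n (A B : word -> Prop) : (forall w, A w -> B w) -> Prob n A <= Prob n B.
Proof.
by move=> AB; apply: Ex_le => w; apply: ind_le; [exact: ind_ge0 | move=> /AB Bw; rewrite ind1].
Qed.

Lemma ProbU n (A B : word -> Prop) : Prob n (fun w => A w \/ B w) <= Prob n A + Prob n B.
Proof.
rewrite -ExD; apply: Ex_le => w; apply: ind_le; first by rewrite addr_ge0 ?ind_ge0.
by case=> h; [rewrite (ind1 h) lerDl | rewrite (ind1 h) lerDr]; exact: ind_ge0.
Qed.

(** Bounded martingale differences: changing the next letter moves the mean over the later letters
    by at most c. The bound concerns means and not paths, because for log |M_n v| one letter may
    have a large effect along exceptional words. *)
Fixpoint bdiff (n : nat) (c : R) (F : word -> R) : Prop :=
  if n is n'.+1 then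
    (forall a a', `|Ex n' (fun w => F (scons a w)) - Ex n' (fun w => F (scons a' w))| <= c)
    /\ (forall a, bdiff n' c (fun w => F (scons a w)))
  else True.

Lemma expR_le_quadratic (x : R) : `|x| <= 2^-1 -> expR x <= 1 + x + 2 * x ^+ 2.
Proof.
rewrite ler_norml => /andP[x1 x2].
(* Since exp (-x) >= 1 - x, exp x is at most 1 / (1 - x), and this is compared with the
   quadratic. *)
have h : (1 - x) * expR x <= 1.
  rewrite -[leRHS](expR0 R) -(addNr x) expRD; apply: ler_wpM2r; first exact: expR_ge0.
  exact: expR_ge1Dx.
have x1' : 0 < 1 - x by lra.
have h2 : 1 <= (1 - x) * (1 + x + 2 * x ^+ 2).
  rewrite [leRHS](_ : _ = 1 + x ^+ 2 * (1 - 2 * x)); last by ring.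
  by rewrite lerDl mulr_ge0 ?sqr_ge0 //; lra.
by rewrite -(ler_pM2l x1') (le_trans h h2).
Qed.

(* By induction on n: conditioning on the first letter leaves a centred variable
   bounded by c. *)
Lemma azuma_mgf n c F t : 0 <= c -> `|t| * c <= 2^-1 -> bdiff n c F ->
  Ex n (fun w => expR (t * (F w - Ex n F))) <= expR (n%:R * (2 * (t * c) ^+ 2)).
Proof.
move=> c0 tc; elim: n F => [|n IH] F.
  by move=> _ /=; rewrite subrr mulr0 mul0r.
move=> [Fd Fb]; pose e a := Ex n (fun w => F (scons a w)).
have eE : Ex n.+1 F = \sum_a p a * e a by [].
rewrite ExS; set E := Ex n.+1 F.
pose y a := e a - E.
have yc a : `|y a| <= c.
  rewrite /y /E eE -[e a]mul1r -p_sum mulr_suml -sumrB.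
  apply: le_trans (ler_norm_sum _ _ _) _; rewrite -[leRHS]mul1r -p_sum mulr_suml.
  apply: ler_sum => b _; rewrite -mulrBr normrM ger0_norm ?p_ge0 //.
  by apply: ler_wpM2l; [exact: p_ge0 | exact: Fd].
have y0 : \sum_a p a * y a = 0.
  rewrite /y; under eq_bigr do rewrite mulrBr.
  by rewrite sumrB -mulr_suml p_sum mul1r -eE subrr.
apply: (@le_trans _ _ (\sum_a p a * (expR (t * y a) * expR (n%:R * (2 * (t * c) ^+ 2))))).
  apply: ler_sum => a _; rewrite ler_wpM2l ?p_ge0 //.
  apply: le_trans (_ : expR (t * y a) * Ex n (fun w => expR (t * (F (scons a w) - e a))) <= _).
    rewrite -ExZ; apply: Ex_le => w; rewrite -expRD ler_expR /y.
    by rewrite le_eqVlt; apply/orP; left; apply/eqP; ring.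
  by apply: ler_wpM2l; [exact: expR_ge0 | exact: (IH _ (Fb a))].
under eq_bigr do rewrite mulrA.
rewrite -mulr_suml -[n.+1%:R]natr1 (mulrDl n%:R) mul1r expRD mulrC ler_wpM2l ?expR_ge0 //.
apply: le_trans (expR_ge1Dx _).
apply: (@le_trans _ _ (\sum_a p a * (1 + t * y a + 2 * (t * c) ^+ 2))).
  apply: ler_sum => a _; rewrite ler_wpM2l ?p_ge0 //.
  have tce : `|t * c| = `|t| * c by rewrite normrM (ger0_norm c0).
  have h : `|t * y a| <= `|t| * c by rewrite normrM ler_wpM2l.
  apply: le_trans (expR_le_quadratic (le_trans h tc)) _.
  have h3 := ler_pM (normr_ge0 _) (normr_ge0 _) h h.
  rewrite lerD2l ler_wpM2l //; move: h3; rewrite -tce -!normrM -!expr2.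
  by rewrite !ger0_norm ?sqr_ge0.
under eq_bigr do rewrite mulrDr mulrDr mulr1 mulrCA.
by rewrite !big_split /= -mulr_sumr -mulr_suml p_sum y0 mulr0 addr0 mul1r.
Qed.

(** Markov's inequality for the exponential. The parameter t stays free: it is a constant in the law
    of large numbers below and proportional to the deviation in the large deviation estimate. *)
Lemma azuma n c F t x : 0 <= c -> 0 <= t -> t * c <= 2^-1 -> bdiff n c F ->
  Prob n (fun w => x <= F w - Ex n F) <= expR (n%:R * (2 * (t * c) ^+ 2) - t * x).
Proof.
move=> c0 t0 tc Fb; rewrite expRD.
apply: le_trans (_ : _ <= expR (- (t * x)) * Ex n (fun w => expR (t * (F w - Ex n F)))) _.
  rewrite -ExZ; apply: Ex_le => w; apply: ind_le; first by rewrite mulr_ge0 ?expR_ge0.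
  move=> h; rewrite -expRD -[X in X <= _](expR0 R) ler_expR addrC subr_ge0.
  by rewrite ler_wpM2l.
by rewrite mulrC ler_wpM2r ?expR_ge0 // azuma_mgf // ger0_norm.
Qed.

Lemma bdiffN n c F : bdiff n c F -> bdiff n c (fun w => - F w).
Proof.
elim: n F => //= n IH F [Fd Fb]; split=> [a a'|a]; last exact/IH/Fb.
by rewrite !ExN -opprD normrN; exact: Fd.
Qed.

Lemma bdiff_pathwise n c F : 0 <= c ->
  (forall t w w', (forall s, s != t -> w s = w' s) -> `|F w - F w'| <= c) -> bdiff n c F.
Proof.
move=> c0; elim: n F => //= n IH F h; split=> [a a'|a].
  rewrite -ExB; apply: Ex_norm_le => w; apply: (h 0%N) => -[|s] //.
by apply: IH => t w w' ww'; apply: (h t.+1) => -[|s] //= st; exact: ww'.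
Qed.

End FiniteExpectation.

(** * The Bernoulli measure *)

Section BernoulliMeasure.
Variables (R : realType) (m : nat) (p : 'I_m.+1 -> R).
Hypotheses (p_pos : forall j, 0 < p j) (p_sum : \sum_j p j = 1).
Variables (P : probability (Xspace m) R) (P_bern : is_bernoulli p P).
Local Notation word := (nat -> letter m).

Definition cyl (n : nat) (w : word) : set (Xspace m) :=
  [set om | forall t, (t < n)%N -> om t = w t].

Lemma measurable_cyl n w : measurable (cyl n w).
Proof. by apply: sub_sigma_algebra; exists n, w. Qed.

Lemma P_cyl n w : P (cyl n w) = (\prod_(t < n) p (w t))%:E.
Proof. exact: P_bern. Qed.

Lemma cyl_split n (w : word) :
  cyl n w = \big[setU/set0]_(a < m.+1) cyl n.+1 (pcat n w (fun=> a)).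
Proof.
apply/seteqP; split=> [om h|om].
  rewrite -bigcup_mkord_ord; exists (om n : nat); first exact: ltn_ord.
  move=> t; rewrite inord_val ltnS leq_eqVlt /pcat.
  by case: (ltngtP t n) => [tn _|//|->//]; exact: h.
rewrite -bigcup_mkord_ord => -[a _ h] t tn; rewrite h ?ltnS ?(ltnW tn) //.
by rewrite /pcat tn.
Qed.

(** Induction on the number n of undecided letters: a cylinder splits according to its next letter,
    and once nothing is undecided the event contains the cylinder or misses it. *)
Lemma cyl_word_event n (A : set (Xspace m)) j w : depends (j + n) (A : word -> Prop) ->
  measurable (A `&` cyl j w) /\
  P (A `&` cyl j w) = ((\prod_(t < j) p (w t)) * Ex p n (fun v => ind R A (pcat j w v)))%:E.
Proof.
elim: n j w => [|n IH] j w Aj.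
  have e : (A `&` cyl j w) = if `[< A w >] then cyl j w else set0.
    case: asboolP => Aw; apply/seteqP; split=> om //=; last 1 first.
    - by move=> [Ao h]; apply: Aw; rewrite -(Aj om) // => t; rewrite addn0; exact: h.
    - by move=> [].
    - by move=> h; split => //; rewrite (Aj _ w) // => t; rewrite addn0; exact: h.
  have eA : ind R A (pcat j w (fun=> ord0)) = ind R A w.
    rewrite /ind; congr (_%:R); congr (nat_of_bool (asbool _)); apply: Aj => t.
    by rewrite addn0 /pcat => ->.
  rewrite /= eA e /ind; case: asboolP => _ /=.
    by rewrite mulr1 P_cyl; split => //; exact: measurable_cyl.
  by rewrite mulr0 measure0; split.
have {}IH (a : 'I_m.+1) := IH j.+1 (pcat j w (fun=> a)).
have e : A `&` cyl j w = \big[setU/set0]_(a < m.+1) (A `&` cyl j.+1 (pcat j w (fun=> a))).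
  by rewrite {1}cyl_split big_distrr.
have Aj' : depends (j.+1 + n) (A : word -> Prop) by rewrite addSnnS.
rewrite e; split; first by apply: bigsetU_measurable => a _; have [] := IH a Aj'.
rewrite (measure_bigsetU_ord P xpredT); last 2 first.
- by move=> a; have [] := IH a Aj'.
- move=> a b _ _ [om [[_ ha] [_ hb]]].
  by have := hb j (ltnSn j); have := ha j (ltnSn j); rewrite /pcat ltnn => <- <-.
transitivity ((\sum_(a < m.+1) ((\prod_(t < j) p (w t)) * p a * Ex p n (fun v => ind R A (pcat j w (scons a v)))))%:E).
  rewrite -sumEFin; apply: eq_bigr => a _; apply: (etrans (IH a Aj').2); congr (_%:E).
  rewrite big_ord_recr /= /pcat ltnn; congr (_ * _ * _).
    by apply: eq_bigr => t _; rewrite /pcat ltn_ord.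
  apply: eq_Ex => v; congr (ind R A _); apply/funext => t.
  rewrite /pcat ltnS leq_eqVlt; case: (ltngtP t j) => //= [jt|->]; last by rewrite subnn.
  by rewrite subnS; case: (t - j)%N (subn_gt0 j t) => [|s]; rewrite jt.
by congr (_%:E); rewrite mulr_sumr; apply: eq_bigr => a _; rewrite mulrA.
Qed.

Lemma word_event n (A : set (Xspace m)) : depends n (A : word -> Prop) ->
  measurable A /\ P A = (Prob p n A)%:E.
Proof.
move=> An; have := @cyl_word_event n A 0 (fun=> ord0) An.
rewrite (_ : cyl _ _ = setT) ?setIT ?big_ord0 ?mul1r; last by apply/seteqP; split.
by under eq_Ex do rewrite pcat0.
Qed.

Lemma measurable_shift (n : nat) : @measurable_fun _ _ (Xspace m) (Xspace m) setT (wshift n).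
Proof.
apply: (@measurability _ _ (Xspace m) (Xspace m) setT (wshift n) (@cylinders m)) => //.
move=> _ [C [k [w ->]] <-]; rewrite setTI.
have h : depends (n + k) ((fun om => cyl k w (wshift n om)) : word -> Prop).
  move=> u v uv; apply: propext.
  by split=> h t tk; rewrite -(h t tk) /wshift uv // ltn_add2l.
exact: (word_event h).1.
Qed.

(** The empty set is added because incompatible cylinders are disjoint; with it the family is stable
    under intersection. *)
Definition pi_cyl : set (set (Xspace m)) := [set A | A = set0 \/ @cylinders m A].

Lemma pi_cyl_measurable : pi_cyl `<=` measurable.
Proof. by move=> A [->//|h]; apply: sub_sigma_algebra. Qed.

Lemma setI_pi_cyl : setI_closed pi_cyl.
Proof.
suff h n w k w' : (n <= k)%N -> pi_cyl (cyl n w `&` cyl k w').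
  move=> A B [->|[n [w eA]]]; first by rewrite set0I; left.
  case=> [->|[k [w' eB]]]; first by rewrite setI0; left.
  rewrite eA eB; have [nk|kn] := leqP n k; first exact: h.
  by rewrite setIC; apply: h; exact: ltnW.
move=> nk; have [ww'|ww'] := pselect (forall t, (t < n)%N -> w t = w' t).
  right; exists k, w'; apply/seteqP; split=> om /=; first by case.
  by move=> h; split=> // t tn; rewrite ww' // h // (leq_trans tn).
left; apply/seteqP; split=> om //= [h h']; apply: ww' => t tn.
by rewrite -h // h' // (leq_trans tn).
Qed.

Lemma cylinder_measure_unique (m1 m2 : {measure set (Xspace m) -> \bar R}) :
  (m1 setT < +oo)%E -> (forall n w, m1 (cyl n w) = m2 (cyl n w)) ->
  forall E, measurable E -> m1 E = m2 E.
Proof.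
move=> m1oo h E mE.
apply: (g_sigma_algebra_measure_unique pi_cyl pi_cyl_measurable (fun=> setT)) => //.
- by move=> _; right; exists 0%N, (fun=> ord0); apply/seteqP; split.
- by apply/seteqP; split=> // x _; exists 0%N.
- exact: setI_pi_cyl.
- by move=> A [->|[n [w ->]]]; [rewrite !measure0 | exact: h].
- by move: E mE; apply: sub_sigma_algebra2 => A cA; right.
Qed.

Lemma P_fin (E : set (Xspace m)) : measurable E -> P E \is a fin_num.
Proof. by move=> mE; apply: fin_num_measure. Qed.

(** Both sides are finite measures in E. They agree on cylinders, where the condition on the first n
    letters and the one after the shift join into a longer cylinder. *)
Lemma cyl_indep n w (E : set (Xspace m)) : measurable E ->
  P (cyl n w `&` (wshift n @^-1` E)) = (P (cyl n w) * P E)%E.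
Proof.
move=> mE.
have ms : @measurable_fun _ _ (Xspace m) (Xspace m) setT (wshift n) by exact: measurable_shift.
pose m1 : {measure set (Xspace m) -> \bar R} :=
  pushforward (mrestr P (measurable_cyl n w)) (wshift n : Xspace m -> Xspace m).
have pw0 : 0 <= \prod_(t < n) p (w t) by apply: prodr_ge0 => t _; exact: ltW.
pose m2 : {measure set (Xspace m) -> \bar R} := mscale (NngNum pw0) P.
have := @cylinder_measure_unique (m1 ms) m2 _ _ E mE.
rewrite /m1 /m2 /pushforward /mrestr /mscale /= setIC P_cyl; apply.
  rewrite /pushforward /mrestr /= (_ : _ `&` _ = cyl n w) ?P_cyl ?ltry //; apply/seteqP; split=> [om []//|om ?]; by split.
move=> k v; rewrite /m1 /m2 /pushforward /mrestr /mscale /=.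
pose u := pcat n w v.
rewrite (_ : _ `&` _ = cyl (n + k) u); last first.
  apply/seteqP; split=> [om [h1 h2] t|om h].
    rewrite /u /pcat; case: (ltnP t n) => [tn _|nt tnk]; first exact: h2.
    by rewrite -h1 ?ltn_subLR // /wshift subnKC.
  split=> t th; last by rewrite h ?ltn_addr // /u /pcat th.
  by rewrite /wshift h ?ltn_add2l // /u /pcat ltnNge leq_addr /= addKn.
rewrite !P_cyl -EFinM big_split_ord /=; congr ((_ * _)%:E); apply: eq_bigr => t _.
  by rewrite /u /pcat /= ltn_ord.
by rewrite /u /pcat /= ltnNge leq_addr /= addKn.
Qed.

(** Invariance makes E independent of every cylinder, hence of every measurable set, hence of
    itself: P E is its own square. *)
Lemma zero_one (E : set (Xspace m)) : measurable E -> (forall om, E om <-> E (wshift 1 om)) ->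
  P E = 0%E \/ P E = 1%E.
Proof.
move=> mE Einv.
have Esh n (om : word) : E (wshift n om) <-> E om.
  elim: n om => [//|n IH] om; rewrite -add1n -wshiftD.
  split=> h; first by apply/Einv; apply: (IH _).1.
  by apply: (IH (wshift 1 om)).2; apply: (Einv om).1.
have EinvE n : wshift n @^-1` E = E.
  by apply/seteqP; split=> om /= h; [exact: (Esh n om).1 | exact: (Esh n om).2].
have mI F : measurable F -> P (F `&` E) = (P F * P E)%E.
  have PE0 : 0 <= fine (P E) by rewrite fine_ge0.
  pose m1 : {measure set (Xspace m) -> \bar R} := mrestr P mE.
  pose m2 : {measure set (Xspace m) -> \bar R} := mscale (NngNum PE0) P.
  have m2E G : m2 G = (P E * P G)%E.
    by rewrite /m2 /= /mscale /= fineK // P_fin.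
  move=> mF; have h := @cylinder_measure_unique m1 m2 _ _ F mF.
  rewrite m2E muleC in h; apply: h.
    by apply: le_lt_trans (ltry 1); apply: (@probability_le1 _ _ _ P (setT `&` E)); exact: measurableI.
  by move=> n w; rewrite m2E muleC -(cyl_indep n w mE) EinvE.
have := mI E mE; rewrite setIid -(fineK (P_fin mE)) -EFinM => -[] h.
have : fine (P E) * (fine (P E) - 1) = 0 by rewrite mulrBr mulr1 -h subrr.
by move=> /eqP; rewrite mulf_eq0 => /orP[/eqP ->|]; [left | rewrite subr_eq0 => /eqP ->; right].
Qed.

Lemma ae_mono (A B : set (Xspace m)) : (forall om, A om -> B om) ->
  {ae P, forall om, A om} -> {ae P, forall om, B om}.
Proof. by move=> AB [N [mN N0 h]]; exists N; split=> // om nB; apply: h => /AB. Qed.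

Lemma ae_and (A B : set (Xspace m)) :
  {ae P, forall om, A om} -> {ae P, forall om, B om} -> {ae P, forall om, A om /\ B om}.
Proof.
move=> hA hB; apply: negligibleS (negligibleU hA hB) => om /= h.
have [Ao|nA] := pselect (A om); last by left.
by right => Bo; apply: h.
Qed.

Lemma Prob_le1 n A : Prob p n A <= 1.
Proof. by rewrite -(Ex_cst p_sum n 1); apply: Ex_le => // w; exact: ind_le1. Qed.

Lemma ae_eventually_not (A : nat -> set (Xspace m)) (C r : R) : 0 <= r -> r < 1 ->
  (forall n, measurable (A n)) -> (forall n, (P (A n) <= (C * r ^+ n)%:E)%E) ->
  {ae P, forall om, exists N, forall n, (N <= n)%N -> ~ A n om}.
Proof.
move=> r0 r1 mA hA.
have C0 : 0 <= C.
  by have := le_trans (measure_ge0 P (A 0%N)) (hA 0%N); rewrite expr0 mulr1 lee_fin.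
have h0 : P (lim_sup_set A) = 0%E.
  apply: lim_sup_set_cvg0 => //.
  apply: (@le_lt_trans _ _ (C / (1 - r))%:E); last exact: ltry.
  apply: lime_le; first by apply: is_cvg_ereal_nneg_natsum => n _; exact: measure_ge0.
  apply: nearW => n; apply: (@le_trans _ _ (\sum_(0 <= k < n) (C * r ^+ k)%:E)%E).
    by apply: lee_sum => k _; exact: hA.
  rewrite sumEFin lee_fin.
  have [->|rn0] := eqVneq r 0.
    case: n => [|n]; first by rewrite big_geq // subr0 divr1.
    rewrite big_nat_recl // expr0 mulr1 big1 ?addr0 ?subr0 ?divr1 // => k _.
    by rewrite exprS mul0r mulr0.
  have rp : 0 < r by rewrite lt_neqAle eq_sym rn0.
  by have := geometric_le_lim n C0 rp; rewrite ger0_norm // => /(_ r1).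
exists (lim_sup_set A); split => //.
  by apply: bigcap_measurable => // n _; apply: bigcup_measurable => k _; exact: mA.
move=> om /= h n _; apply: contrapT => h'; apply: h; exists n => k nk Ak.
by apply: h'; exists k.
Qed.

End BernoulliMeasure.

(** * Subadditive sequences *)

Section Kingman.
Variables (R : realType) (m : nat) (p : 'I_m.+1 -> R).
Hypotheses (p_pos : forall j, 0 < p j) (p_sum : \sum_j p j = 1).
Variables (P : probability (Xspace m) R) (P_bern : is_bernoulli p P).
Local Notation word := (nat -> letter m).

Lemma Ex_wshift_depends n j k (F : word -> R) : (j + n <= k)%N -> depends n F ->
  Ex p k (fun w => F (wshift j w)) = Ex p n F.
Proof.
by move=> jnk h; rewrite (Ex_depends p_sum jnk (depends_shift h (j := j))) Ex_shift.
Qed.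

Definition visits (N : nat) (B : word -> Prop) n (w : word) : R := \sum_(j < n) ind R B (wshift j w).

(** One letter influences only the windows of length N containing it, so [visits] has bounded
    differences; Azuma's inequality then gives a geometric bound, to which Borel-Cantelli
    applies. *)
Lemma visits_lln (N : nat) (B : word -> Prop) (eta : R) : depends N B ->
  0 < eta -> Prob p N B <= eta ->
  {ae P, forall om, exists n0, forall n, (n0 <= n)%N -> visits N B n om <= n%:R * (2 * eta)}.
Proof.
move=> BN eta0 Beta; pose c : R := N.+1%:R.
have c1 : 1 <= c by rewrite ler1n.
have c0 : 0 < c by apply: lt_le_trans c1.
have bdep (w w' : word) : (forall t, (t < N)%N -> w t = w' t) -> ind R B w = ind R B w'.
  by move=> h; rewrite /ind (BN w w' h).
have vdep n : depends (n + N) (visits N B n).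
  move=> w w' ww'; apply: eq_bigr => j _; apply: bdep => t tN; apply: ww'.
  by rewrite (leq_ltn_trans (leq_add (ltnW (ltn_ord j)) (leqnn t))) // ltn_add2l.
have vdiff n : bdiff p (n + N) c (visits N B n).
  apply: (bdiff_pathwise p_pos p_sum); first exact: ltW.
  move=> t w w' ww'; rewrite /visits -sumrB.
  apply: le_trans (ler_norm_sum _ _ _) _.
  pose J := fun j : 'I_n => (j <= t < j + N)%N.
  rewrite (bigID J) /= [X in _ + X]big1 ?addr0 => [|j jJ]; last first.
    apply/normr0P; rewrite subr_eq0; apply/eqP; apply: bdep => s sN; apply: ww'.
    by apply: contra jJ; rewrite /J => /eqP <-; rewrite leq_addr ltn_add2l.
  apply: (@le_trans _ _ (\sum_(j < n | J j) 1)).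
    apply: ler_sum => j _; rewrite ler_norml /ind.
    by case: (`[< _ >]); case: (`[< _ >]) => /=; lra.
  rewrite sumr_const -[_ *+ _]/(_%:R) ler_nat.
  have [N0|N0] := posnP N.
    rewrite eq_card0 // => j; rewrite unfold_in /J N0 addn0.
    by apply/negP => /andP[h1 h2]; have := leq_ltn_trans h1 h2; rewrite ltnn.
  (* The windows containing position t are told apart by t - j in [0, N], so at most N.+1 terms
     change. *)
  have inj : {in [pred j | J j] &, injective (fun j : 'I_n => inord (t - j) : 'I_N.+1)}.
    have tj (j : 'I_n) : J j -> (t - j < N.+1)%N.
      by rewrite /J => /andP[_ /ltnW h]; rewrite ltnS leq_subLR.
    move=> j j'; rewrite !inE => Jj Jj' /(congr1 val) /=; rewrite !inordK ?tj // => e.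
    move: Jj Jj'; rewrite /J => /andP[a1 _] /andP[b1 _].
    by apply/val_inj => /=; rewrite -(subKn a1) -(subKn b1) e.
  by rewrite -(card_in_imset inj) -[X in (_ <= X)%N]card_ord max_card.
have vE n : Ex p (n + N) (visits N B n) = n%:R * Prob p N B.
  rewrite /visits Ex_sum // mulr_natl -[X in _ *+ X]card_ord -sumr_const.
  apply: eq_bigr => j _; rewrite (Ex_wshift_depends (n := N) (j := j)) //.
  by rewrite leq_add2r ltnW.
(* The first bound gives t c <= 1/2, as [azuma] requires; the second makes the quadratic term at
   most half of the linear gain t eta. *)
pose t : R := Num.min (2 * c)^-1 (eta / (4 * c ^+ 2)).
have t0 : 0 < t by rewrite lt_min invr_gt0 divr_gt0 ?mulr_gt0 ?exprn_gt0.
have tc : t * c <= 2^-1 by rewrite -ler_pdivlMr // -invfM ge_min lexx.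
have tc2 : 2 * (t * c) ^+ 2 <= t * eta / 2.
  have h2 : t * c ^+ 2 <= eta / 4.
    by rewrite -ler_pdivlMr ?exprn_gt0 // -mulrA -invfM ge_min lexx orbT.
  have := ler_wpM2l (ltW t0) h2; rewrite exprMn; lra.
pose A n : set (Xspace m) := fun om => n%:R * (2 * eta) < visits N B n om.
have Adep n : depends (n + N) (A n : word -> Prop).
  by move=> w w' ww'; rewrite /A (vdep n w w' ww').
have mA n : measurable (A n) by exact: (word_event P_bern (Adep n)).1.
apply: ae_mono (ae_eventually_not (P := P) (A := A) (C := expR (N%:R * (2 * (t * c) ^+ 2)))
  (r := expR (- (t * eta / 2))) (expR_ge0 _) _ mA _).
- by move=> om [n0 h]; exists n0 => n n0n; rewrite leNgt; apply/negP; exact: h.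
- by rewrite expR_lt1 oppr_lt0 divr_gt0 // mulr_gt0.
move=> n; rewrite (word_event P_bern (Adep n)).2 lee_fin.
apply: le_trans (Prob_le p_pos (n + N) (B := fun w => n%:R * eta <= visits N B n w - Ex p (n + N) (visits N B n)) _) _.
  move=> w /ltW h; rewrite vE; have := ler_wpM2l (ler0n R n) Beta; lra.
apply: le_trans (azuma p_pos p_sum (n%:R * eta) (ltW c0) (ltW t0) tc (vdiff n)) _.
rewrite -expRM_natl -expRD ler_expR natrD.
have := ler_wpM2l (ler0n R n) tc2; lra.
Qed.

Section Subadditive.
Variables (f : nat -> word -> R) (K : R).
(** One letter more than the index: in the application letter 0 is only the initial state of a
    product of n factors. *)
Hypothesis f_dep : forall n, depends n.+1 (f n).
Hypothesis f_bd : forall n w, `|f n w| <= K * n.+1%:R.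
Hypothesis f_sub : forall n k w, f (n + k) w <= f n w + f k (wshift n w).
Hypothesis f_sh : forall n w, `|f n.+1 w - f n (wshift 1 w)| <= K.

Lemma K_ge0 : 0 <= K.
Proof. by apply: le_trans (f_sh 0 (fun=> ord0)). Qed.

Definition often_below (t : R) : set (Xspace m) :=
  [set om | forall N, exists2 n, (N <= n)%N & f n om < n%:R * t].

(** This is liminf f n / n < t. The margin 1 / (k + 1) leaves linear room, which makes the event
    insensitive to bounded errors. *)
Definition liminf_below (t : R) : set (Xspace m) :=
  [set om | exists k : nat, often_below (t - k.+1%:R^-1) om].

Lemma measurable_f_lt n x : measurable ([set om : Xspace m | f n om < x]).
Proof.
apply: (word_event P_bern (n := n.+1) _).1.
by move=> w w' ww'; rewrite /= (f_dep ww').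
Qed.

Lemma measurable_liminf_below t : measurable (liminf_below t).
Proof.
rewrite (_ : liminf_below t = \bigcup_k \bigcap_N \bigcup_(n in [set n | (N <= n)%N])
   [set om | f n om < n%:R * (t - k.+1%:R^-1)]).
  apply: bigcup_measurable => k _; apply: bigcap_measurable => // N _.
  by apply: bigcup_measurable => n _; exact: measurable_f_lt.
apply/seteqP; split=> om [k].
  by move=> h; exists k => // N _; have [n Nn hn] := h N; exists n.
by move=> _ h; exists k => N; have [n Nn hn] := h N I; exists n.
Qed.

Lemma archi_above (x : R) : exists n : nat, x < n%:R.
Proof.
exists (Num.truncn `|x|).+1; apply: le_lt_trans (ler_norm x) _.
exact: truncnS_gt.
Qed.

(** Shifting costs at most K, and changing n by one costs at most |t| + 1. Replacing k by k.+1 gains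
    a positive multiple of n, which beats both. *)
Lemma liminf_below_shift t om : liminf_below t om <-> liminf_below t (wshift 1 om).
Proof.
have inv k : exists N : nat, forall n : nat, (N <= n)%N ->
    `|t| + 1 + K <= n%:R * (k.+1%:R^-1 - k.+2%:R^-1 :> R).
  have e0 : 0 < k.+1%:R^-1 - k.+2%:R^-1 :> R.
    by rewrite subr_gt0 ltf_pV2 ?posrE // ltr_nat.
  have [N hN] := archi_above ((`|t| + 1 + K) / (k.+1%:R^-1 - k.+2%:R^-1)).
  exists N => n Nn; rewrite -ler_pdivrMr // (le_trans (ltW hN)) // ler_nat //.
have kt (k : nat) : `|t - k.+1%:R^-1| <= `|t| + 1.
  apply: le_trans (ler_normB _ _) _; rewrite lerD2l normfV ger0_norm //.
  by rewrite invf_le1 // ler1n.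
split=> -[k h].
  have [N0 hN0] := inv k; exists k.+1 => N.
  have [[|n] Nn hn] := h (maxn N0 N).+1; first by [].
  move: Nn; rewrite ltnS geq_max => /andP[N0n Nn]; exists n => //.
  have := f_sh n om; rewrite ler_norml => /andP[h1 h2].
  have := kt k; rewrite ler_norml => /andP[h3 h4].
  move: hn (hN0 _ N0n) h3 h4; rewrite -[n.+1%:R]natr1.
  by move: (k.+1%:R^-1) (k.+2%:R^-1) => a b; lra.
have [N0 hN0] := inv k; exists k.+1 => N.
have [n Nn hn] := h (maxn N0 N).
move: Nn; rewrite geq_max => /andP[N0n Nn]; exists n.+1; first exact: leqW.
have := f_sh n om; rewrite ler_norml => /andP[h1 h2].
have := kt k.+1; rewrite ler_norml => /andP[h3 h4].
move: hn (hN0 _ N0n) h3 h4; rewrite -[n.+1%:R]natr1.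
by move: (k.+1%:R^-1) (k.+2%:R^-1) => a b; lra.
Qed.

Lemma liminf_below_mono t t' : t <= t' -> liminf_below t `<=` liminf_below t'.
Proof.
move=> tt' om [k h]; exists k => N; have [n Nn hn] := h N; exists n => //.
by apply: lt_le_trans hn _; rewrite ler_wpM2l // lerB.
Qed.

(** The almost sure value of the liminf: by the zero-one law each event [liminf_below t] has
    probability 0 or 1, these events increase with t, and the linear bounds on f keep the threshold
    finite. *)
Lemma liminf_threshold : exists l : R, forall e, 0 < e ->
  P (liminf_below (l + e)) = 1%E /\ P (liminf_below (l - e)) = 0%E.
Proof.
pose S : set R := [set t | P (liminf_below t) = 0%E].
have K0 := K_ge0.
have S1 t : P (liminf_below t) = 0%E \/ P (liminf_below t) = 1%E.
  apply: (zero_one p_pos P_bern); first exact: measurable_liminf_below.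
  exact: liminf_below_shift.
have Slow : S (- (2 * K + 1)).
  rewrite /S /= (_ : liminf_below _ = set0) ?measure0 //; apply/seteqP; split=> om //= -[k h].
  have [n n1 hn] := h 1%N; have := f_bd n om; rewrite ler_norml => /andP[h1 _].
  have k0 : 0 <= n%:R * k.+1%:R^-1 :> R by rewrite mulr_ge0.
  have n1' : 1 <= n%:R :> R by rewrite ler1n.
  have : K <= K * n%:R by rewrite ler_peMr.
  by move: h1 hn k0; rewrite -[n.+1%:R]natr1; move: (k.+1%:R^-1) => b; lra.
have Sup t : S t -> t <= 2 * K + 2.
  move=> St; rewrite leNgt; apply/negP => ht; move: St; rewrite /S /=.
  rewrite (_ : liminf_below t = setT).
    by rewrite probability_setT => /eqP; rewrite onee_eq0.
  apply/seteqP; split=> om //= _; exists 0%N => N; exists N.+1 => //.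
  have := f_bd N.+1 om; rewrite ler_norml => /andP[_ h1]; apply: le_lt_trans h1 _.
  rewrite -[N.+2%:R]natr1 mulrDr mulr1 invr1.
  have n1' : 1 <= N.+1%:R :> R by rewrite ler1n.
  have : K <= K * N.+1%:R by rewrite ler_peMr.
  have : N.+1%:R * (2 * K + 1) < N.+1%:R * (t - 1) by rewrite ltr_pM2l ?ltr0n //; lra.
  lra.
have Sub : has_ubound S by exists (2 * K + 2).
exists (sup S) => e e0; split.
  case: (S1 (sup S + e)) => // h; exfalso.
  have : sup S + e <= sup S by exact: ub_le_sup.
  lra.
have [t St ht] : exists2 t, S t & sup S - e < t.
  by apply: sup_adherent => //; split => //; exists (- (2 * K + 1)).
have h : (P (liminf_below (sup S - e)) <= P (liminf_below t))%E.
  apply: le_measure; rewrite ?inE; try exact: measurable_liminf_below.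
  exact: liminf_below_mono (ltW ht).
have St' : P (liminf_below t) = 0%E := St.
by move: h; rewrite St' measure_le0 => /eqP.
Qed.

Definition slow (t : R) (N : nat) (w : word) : Prop :=
  forall n, (0 < n <= N)%N -> n%:R * t <= f n w.

(** Greedy cutting from the left. Where a good block starts, it is removed by subadditivity; at a
    slow point one letter is skipped, costing at most 2 K + |t| beyond t; a remainder of length at
    most N goes into the constant. *)
Lemma slow_bound t N n w :
  f n w <= n%:R * t + (2 * K + `|t|) * visits N.+1 (slow t N) n w + (K + `|t|) * N.+1%:R.
Proof.
have K0 := K_ge0.
have vis0 k v : 0 <= visits N.+1 (slow t N) k v.
  by apply: sumr_ge0 => j _; exact: ind_ge0.
have visD k l v : visits N.+1 (slow t N) (k + l) v =
    visits N.+1 (slow t N) k v + visits N.+1 (slow t N) l (wshift k v).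
  by rewrite /visits big_split_ord /=; congr (_ + _); apply: eq_bigr => j _; rewrite wshiftD.
have Kt : 0 <= 2 * K + `|t| by rewrite addr_ge0 // mulr_ge0.
elim: n {-2}n (leqnn n) w => [|n0 IH] n nn0 w.
  move: nn0; rewrite leqn0 => /eqP ->; rewrite mul0r add0r.
  have := f_bd 0 w; rewrite ler_norml => /andP[_ h].
  have := mulr_ge0 Kt (vis0 0%N w).
  have : K * 1 <= (K + `|t|) * N.+1%:R.
    by apply: ler_pM => //; rewrite ?lerDl ?ler1n.
  lra.
have [nN|Nn] := leqP n N.
  have := f_bd n w; rewrite ler_norml => /andP[_ h].
  have := mulr_ge0 Kt (vis0 n w).
  have h1 : (K + `|t|) * n.+1%:R <= (K + `|t|) * N.+1%:R.
    by rewrite ler_wpM2l ?addr_ge0 // ler_nat.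
  have h2 : - (n%:R * t) <= n.+1%:R * `|t|.
    rewrite -mulrN; apply: le_trans (_ : n%:R * `|t| <= _).
      by rewrite ler_wpM2l // -normrN ler_norm.
    by rewrite ler_wpM2r // ler_nat.
  lra.
have [sl|nsl] := pselect (slow t N w).
  case: n nn0 Nn => // n nn0 Nn.
  have h1 := f_sub 1 n w; have := IH n nn0 (wshift 1 w).
  have := f_bd 1 w; rewrite ler_norml => /andP[_ h2].
  have e : visits N.+1 (slow t N) n.+1 w = 1 + visits N.+1 (slow t N) n (wshift 1 w).
    by rewrite -[n.+1]add1n visD {1}/visits big_ord1 wshift0 ind1.
  rewrite e; move: h1; rewrite add1n -[n.+1%:R]natr1.
  have := ler_norm (- t); rewrite normrN; move: h2; lra.
have [k /andP[k0 kN] hk] : exists2 k, (0 < k <= N)%N & f k w < k%:R * t.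
  apply: contrapT => h; apply: nsl => k kN; rewrite leNgt; apply/negP => h'.
  by apply: h; exists k.
have kn : (k <= n)%N by rewrite (leq_trans kN) // ltnW.
have h1 := f_sub k (n - k) w.
have := IH (n - k)%N _ (wshift k w); rewrite leq_subLR.
have -> : (n <= k + n0)%N by rewrite (leq_trans nn0) // -[n0.+1]add1n leq_add2r.
move=> /(_ isT) h2.
have e : visits N.+1 (slow t N) n w = visits N.+1 (slow t N) k w + visits N.+1 (slow t N) (n - k) (wshift k w).
  by rewrite -visD subnKC.
have e2 : n%:R * t = k%:R * t + (n - k)%:R * t by rewrite -mulrDl -natrD subnKC.
rewrite e e2; move: h1; rewrite subnKC //.
have := mulr_ge0 Kt (vis0 k w); move: h2 hk; lra.
Qed.

Lemma slow_dep t N : depends N.+1 (slow t N).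
Proof.
move=> w w' ww'; apply: propext; split=> h n nN.
  rewrite -(f_dep (w := w)) ?h // => s sn; apply: ww'.
  by rewrite (leq_trans sn) // ltnS; case/andP: nN.
rewrite (f_dep (w' := w')) ?h // => s sn; apply: ww'.
by rewrite (leq_trans sn) // ltnS; case/andP: nN.
Qed.

(** Where the liminf is below t some good block exists, so the events [slow t N] decrease in N to a
    null set. *)
Lemma slow_small t eta : 0 < eta -> P (liminf_below t) = 1%E ->
  exists N, Prob p N.+1 (slow t N) <= eta.
Proof.
move=> eta0 ht.
pose F N : set (Xspace m) := slow t N.
have mF N : measurable (F N) by exact: (word_event P_bern (A := F N) (@slow_dep t N)).1.
have cv : P (F n) @[n --> \oo] --> P (\bigcap_n F n).
  apply: nonincreasing_cvg_mu => //.
  - by rewrite -ge0_fin_numE // P_fin.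
  - by apply: bigcap_measurable => // n _.
  - move=> a b ab; apply/subsetPset => om h n /andP[n0 nb]; apply: h.
    by rewrite n0 (leq_trans nb).
have P0 : P (\bigcap_n F n) = 0%E.
  apply/eqP; rewrite eq_le measure_ge0 andbT.
  have mL := measurable_liminf_below t.
  rewrite -(_ : P (~` liminf_below t) = 0%E); last by rewrite probability_setC // ht subee.
  apply: le_measure; rewrite ?inE; [exact: bigcap_measurable | exact: measurableC |].
  move=> om h [k hk]; have [n n1 hn] := hk 1%N.
  have := h n I n; rewrite n1 leqnn => /(_ isT) h'.
  have : n%:R * (t - k.+1%:R^-1) <= n%:R * t by rewrite ler_wpM2l // lerBlDr lerDl.
  by move=> h2; have := lt_le_trans hn h2; rewrite ltNge h'.
rewrite P0 in cv; have /fine_cvgP[_ /cvgrPdist_le /(_ _ eta0)] := cv.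
move=> [N _ /(_ N (leqnn _))]; rewrite /= sub0r normrN => h.
exists N; apply: le_trans h; rewrite (word_event P_bern (A := F N) (@slow_dep t N)).2 /=.
exact: ler_norm.
Qed.

(* With l the almost sure liminf of f n / n: cut an orbit into blocks of length at
   most N on which f stays below its length times l + e; the points where no such
   block starts are the visits to slow, and these have small density. Together with
   the liminf bound from below this gives convergence. *)
Lemma kingman : exists l : R, {ae P, forall om, forall e, 0 < e ->
   exists N, forall n, (N <= n)%N -> `|f n om - n%:R * l| <= n%:R * e}.
Proof.
have [l hl] := liminf_threshold; exists l.
have K0 := K_ge0.
have lower : {ae P, forall om, forall j : nat, ~ liminf_below (l - j.+1%:R^-1) om}.
  apply/ae_foralln => j; exists (liminf_below (l - j.+1%:R^-1)); split.
  - exact: measurable_liminf_below.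
  - by apply: (hl j.+1%:R^-1 _).2; rewrite invr_gt0.
  - by move=> om /= /contrapT.
have upper : {ae P, forall om, forall j : nat, exists N, forall n, (N <= n)%N ->
    f n om <= n%:R * (l + 3 * j.+1%:R^-1)}.
  apply/ae_foralln => j; set e : R := j.+1%:R^-1.
  have e0 : 0 < e by rewrite invr_gt0.
  set t := l + e.
  have Kt : 0 <= 2 * K + `|t| by rewrite addr_ge0 // mulr_ge0.
  (* At density at most 2 eta the slow points cost at most e per letter in [slow_bound]. *)
  pose eta := e / (2 * (2 * K + `|t| + 1)).
  have Kt1 : 0 < 2 * K + `|t| + 1 by lra.
  have eta0 : 0 < eta by rewrite divr_gt0 // mulr_gt0.
  have etae : (2 * K + `|t|) * (2 * eta) <= e.
    have -> : (2 * K + `|t|) * (2 * eta) = e * ((2 * K + `|t|) / (2 * K + `|t| + 1)).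
      by rewrite /eta; field; rewrite gt_eqF.
    by rewrite ler_piMr ?(ltW e0) // ler_pdivrMr // mul1r lerDl.
  have [N hN] := slow_small eta0 (hl e e0).1.
  apply: ae_mono (visits_lln (@slow_dep t N) eta0 hN) => om [n0 hn0].
  have [n1 hn1] := archi_above ((K + `|t|) * N.+1%:R / e).
  exists (maxn n0 n1) => n; rewrite geq_max => /andP[n0n n1n].
  have h1 := slow_bound t N n om.
  have h2 := ler_wpM2l Kt (hn0 n n0n).
  have h3 : (K + `|t|) * N.+1%:R <= n%:R * e.
    by rewrite -ler_pdivrMr // (le_trans (ltW hn1)) // ler_nat.
  have h4 := ler_wpM2l (ler0n R n) etae.
  apply: le_trans h1 _; move: h2 h3 h4; rewrite /t; lra.
apply: ae_mono (ae_and lower upper) => om [hlow hup] e e0.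
have [j hj] := archi_above (4 / e).
have je : 4 * j.+1%:R^-1 <= e.
  rewrite ler_pdivrMr // mulrC -ler_pdivrMr // (le_trans (ltW hj)) // ler_nat //.
have [N hN] := hup j.
have [N' hN'] : exists N', forall n, (N' <= n)%N -> n%:R * (l - j.+1%:R^-1 - j.+1%:R^-1) <= f n om.
  apply: contrapT => h; apply: (hlow j); exists j => M; apply: contrapT => h'.
  apply: h; exists M => n Mn; rewrite leNgt; apply/negP => h''; apply: h'; by exists n.
exists (maxn N N') => n; rewrite geq_max => /andP[Nn N'n].
have h1 := hN n Nn; have h2 := hN' n N'n.
have h3 := ler_wpM2l (ler0n R n) je.
have h4 : 0 <= n%:R * j.+1%:R^-1 :> R by rewrite mulr_ge0.
move: h1 h2 h3 h4; move: (j.+1%:R^-1) => b h1 h2 h3 h4.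
by rewrite ler_norml; apply/andP; split; lra.
Qed.

End Subadditive.
End Kingman.

(** * Products of transition matrices *)

Section RealLemmas.
Variable R : realType.

Lemma ln_sub_le (x y : R) : 0 < x -> 0 < y -> ln x - ln y <= (x - y) / y.
Proof.
move=> x0 y0; rewrite -ln_div ?posrE // (_ : x / y = 1 + (x - y) / y).
  by apply: le_ln1Dx; rewrite mulrBl divff ?gt_eqF // ltrBrDr addrC subrr divr_gt0.
by rewrite mulrBl divff ?gt_eqF // addrC subrK.
Qed.

Lemma ln_close (x y s : R) : 0 < x -> 0 < y -> s <= 2^-1 -> `|x - y| <= s * x ->
  `|ln x - ln y| <= 2 * s.
Proof.
move=> x0 y0 s2; rewrite ler_norml => /andP[h1 h2].
have hy : x / 2 <= y by have := ler_wpM2r (ltW x0) s2; lra.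
have s0 : 0 <= s by rewrite -(pmulr_lge0 s x0); lra.
rewrite ler_norml; apply/andP; split.
  have h : ln y - ln x <= s.
    by apply: le_trans (ln_sub_le y0 x0) _; rewrite ler_pdivrMr //; lra.
  lra.
apply: le_trans (ln_sub_le x0 y0) _; rewrite ler_pdivrMr //.
have := ler_wpM2l s0 hy; lra.
Qed.

Lemma le_2powR (x al : R) : 0 <= x -> x <= 2 -> 0 < al -> al <= 1 -> x <= 2 * x `^ al.
Proof.
move=> x0 x2 al0 al1; have [x1|x1] := leP x 1.
  have [->|xn0] := eqVneq x 0; first by rewrite powR0 ?mulr0 // gt_eqF.
  have xp : 0 < x by rewrite lt_neqAle eq_sym xn0.
  have h : x <= x `^ al by apply: ger1_powR => //; rewrite xp.
  by have := powR_ge0 x al; lra.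
have : x `^ 0 <= x `^ al by apply: ler_powR; exact: ltW.
rewrite powRr0.
lra.
Qed.

Lemma powR_prod_amgm (x y z al : R) : 0 <= x -> 0 <= y -> 0 <= z -> z ^+ 2 = x * y ->
  2 * z `^ al <= x `^ al + y `^ al.
Proof.
move=> x0 y0 z0 zxy.
have e : (z `^ al) ^+ 2 = x `^ al * y `^ al by rewrite expr2 -powRM // -expr2 zxy powRM.
have := powR_ge0 x al; have := powR_ge0 y al; have := powR_ge0 z al.
move: e; move: (z `^ al) (x `^ al) (y `^ al) => Z X Y e Z0 Y0 X0.
rewrite -(@ler_pXn2r _ 2) ?nnegrE ?mulr_ge0 ?addr_ge0 // exprMn e.
have := sqr_ge0 (X - Y); rewrite sqrrB sqrrD; lra.
Qed.

(** Evaluating a at a common multiple of n and k in two ways shows that (a n - K) / n never exceeds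
    (a k + K) / k; a number L separates the two families. *)
Lemma quasi_additive (a : nat -> R) (K : R) :
  (forall n k, `|a (n + k)%N - a n - a k| <= K) ->
  exists L, forall n, `|a n - n%:R * L| <= K.
Proof.
move=> h.
have K0 : 0 <= K by apply: le_trans (h 0%N 0%N).
have hm n k : `|a (k * n)%N - k%:R * a n| <= (k%:R + 1) * K.
  elim: k => [|k IH].
    rewrite mul0n mul0r subr0 add0r mul1r; have := h 0%N 0%N.
    by rewrite addn0 subrr sub0r normrN.
  rewrite mulSn; have := h n (k * n)%N; move: IH; rewrite -[k.+1%:R]natr1 !ler_norml.
  by move=> /andP[h1 h2] /andP[h3 h4]; apply/andP; split; lra.
have hnk n k : (0 < n)%N -> (0 < k)%N -> (a n - K) / n%:R <= (a k + K) / k%:R.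
  move=> n0 k0; have n0' : 0 < n%:R :> R by rewrite ltr0n.
  have k0' : 0 < k%:R :> R by rewrite ltr0n.
  rewrite ler_pdivrMr // mulrAC ler_pdivlMr //.
  (* The extra factor j is an amplification: errors proportional to j are already part of the gap d,
     and the leftover 2 K cannot compete with j d. *)
  have hh (j : nat) : `|a (j * (k * n))%N - (j * k)%:R * a n| <= ((j * k)%:R + 1) * K.
    by rewrite mulnA hm.
  have hh2 (j : nat) : `|a (j * (k * n))%N - (j * n)%:R * a k| <= ((j * n)%:R + 1) * K.
    by rewrite (mulnC k) mulnA hm.
  rewrite leNgt; apply/negP => gap.
  pose d := (a n - K) * k%:R - (a k + K) * n%:R.
  have d0 : 0 < d by rewrite /d; lra.
  pose j := (Num.truncn (2 * K / d)).+1.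
  have jd : 2 * K < j%:R * d.
    by rewrite -ltr_pdivrMr // truncnS_gt.
  move: (hh j) (hh2 j); rewrite !ler_norml !natrM => /andP[h1 h2] /andP[h3 h4].
  move: jd; rewrite /d; lra.
pose S : set R := [set x | exists2 n, (0 < n)%N & x = (a n - K) / n%:R].
have S0 : S !=set0 by exists ((a 1%N - K) / 1%:R), 1%N.
have Sub k : (0 < k)%N -> ubound S ((a k + K) / k%:R).
  by move=> k0 _ [n n0 ->]; exact: hnk.
exists (sup S) => -[|n].
  by have := h 0%N 0%N; rewrite addn0 subrr sub0r normrN mul0r subr0.
have n0' : 0 < n.+1%:R :> R by rewrite ltr0n.
have h1 : (a n.+1 - K) / n.+1%:R <= sup S.
  by apply: ub_le_sup; [exists ((a 1%N + K) / 1%:R); exact: Sub | exists n.+1].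
have h2 : sup S <= (a n.+1 + K) / n.+1%:R by apply: ge_sup => //; exact: Sub.
move: h1 h2; rewrite ler_pdivrMr // ler_pdivlMr // ler_norml [sup S * _]mulrC => h1 h2.
by apply/andP; split; lra.
Qed.

End RealLemmas.

Section MarkovCocycle.
Variables (R : realType) (m : nat) (q : nat).
Local Notation word := (nat -> letter m).
Local Notation trans := ('I_m.+1 -> 'I_m.+1 -> 'M[R]_q).
Implicit Type T : trans.

(* T a b is the factor of the letter a when the preceding letter is b. *)
Fixpoint Mprod T (n : nat) (b : 'I_m.+1) (w : word) : 'M[R]_q :=
  if n is n'.+1 then Mprod T n' (w 0%N) (wshift 1 w) *m T (w 0%N) b else 1%:M.

Definition lastl (n : nat) (b : 'I_m.+1) (w : word) : 'I_m.+1 := if n is n'.+1 then w n' else b.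

Lemma lastlS n b w : lastl n (w 0%N) (wshift 1 w) = lastl n.+1 b w.
Proof. by case: n. Qed.

Lemma MprodD T n k b w :
  Mprod T (n + k) b w = Mprod T k (lastl n b w) (wshift n w) *m Mprod T n b w.
Proof.
elim: n b w => [|n IH] b w; first by rewrite mulmx1.
by rewrite addSn /= IH (lastlS n b) wshiftD mulmxA.
Qed.

Lemma MprodSr T n b w : Mprod T n.+1 b w = T (w n) (lastl n b w) *m Mprod T n b w.
Proof. by rewrite -addn1 MprodD /= mul1mx /wshift addn0. Qed.

Lemma Mprod_depends T n b : depends n (Mprod T n b).
Proof.
elim: n b => [//|n IH] b w w' ww' /=; rewrite ww' // (IH _ _ (wshift 1 w')) // => t tn.
exact: ww'.
Qed.

Lemma lastl_pcat n b u w : lastl n b (pcat n u w) = lastl n b u.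
Proof. by case: n => //= n; rewrite /pcat ltnSn. Qed.

Lemma Mprod_pcat T n b u w : Mprod T n b (pcat n u w) = Mprod T n b u.
Proof. by apply: Mprod_depends => t tn; rewrite /pcat tn. Qed.

(** The second clause bounds the inverse of [T a b] without forming it, and it multiplies along
    products. *)
Definition tame (Lam : R) T : Prop :=
  (forall a b, nrm (T a b) <= Lam) /\ (forall a b (v : 'cV[R]_q), nrm v <= Lam * nrm (T a b *m v)).

Section Tame.
Variables (Lam : R) (T : trans).
Hypotheses (Lam1 : 1 <= Lam) (hT : tame Lam T).

Let Lam0 : 0 <= Lam. Proof. exact: le_trans Lam1. Qed.

Lemma tame_ub n b w (v : 'cV[R]_q) : nrm (Mprod T n b w *m v) <= Lam ^+ n * nrm v.
Proof.
elim: n b w v => [|n IH] b w v /=; first by rewrite mul1mx mul1r.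
rewrite -mulmxA; apply: le_trans (IH _ _ _) _; rewrite exprSr -mulrA.
rewrite ler_wpM2l ?exprn_ge0 //; apply: le_trans (nrm_mul _ _) _.
by rewrite ler_wpM2r ?nrm_ge0 // hT.1.
Qed.

Lemma tame_lb n b w (v : 'cV[R]_q) : nrm v <= Lam ^+ n * nrm (Mprod T n b w *m v).
Proof.
elim: n b w v => [|n IH] b w v /=; first by rewrite mul1mx mul1r.
rewrite -mulmxA; apply: le_trans (hT.2 (w 0%N) b v) _; rewrite exprS -mulrA.
by rewrite ler_wpM2l.
Qed.

Lemma Mprod_neq0 n b w (v : 'cV[R]_q) : v != 0 -> Mprod T n b w *m v != 0.
Proof.
rewrite -!nrm_gt0 => v0; have := lt_le_trans v0 (tame_lb n b w v).
by rewrite pmulr_rgt0 // exprn_gt0 // (lt_le_trans ltr01).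
Qed.

Lemma ln_Mprod_le n b w (v : 'cV[R]_q) : v != 0 ->
  `|ln (nrm (Mprod T n b w *m v)) - ln (nrm v)| <= n%:R * ln Lam.
Proof.
move=> v0; have Mv := Mprod_neq0 n b w v0.
rewrite -!nrm_gt0 in v0 Mv.
have L0 : 0 < Lam ^+ n by rewrite exprn_gt0 // (lt_le_trans ltr01).
have lnL : ln (Lam ^+ n) = n%:R * ln Lam by rewrite lnXn ?mulr_natl // (lt_le_trans ltr01).
rewrite ler_norml; apply/andP; split.
  have := tame_lb n b w v; rewrite -ler_ln ?posrE ?mulr_gt0 // lnM ?posrE // lnL; lra.
have := tame_ub n b w v; rewrite -ler_ln ?posrE ?mulr_gt0 // lnM ?posrE // lnL; lra.
Qed.

End Tame.

(** Comparable with the sine of the angle between the two lines; with entrywise norms its upper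
    bound is 2. *)
Definition pdist (v w : 'cV[R]_q) : R := nrm (wedge v w) / (nrm v * nrm w).

Lemma pdist_ge0 v w : 0 <= pdist v w.
Proof. by rewrite divr_ge0 ?mulr_ge0 ?nrm_ge0. Qed.

Lemma pdist_le2 v w : v != 0 -> w != 0 -> pdist v w <= 2.
Proof.
by rewrite -!nrm_gt0 => v0 w0; rewrite ler_pdivrMr ?mulr_gt0 // nrm_wedge.
Qed.

(* When v and w are close in projective space, v is close to a multiple of w,
   and the logarithmic growth is scaling invariant. *)
Lemma log_growth_lip (L : R) : 1 <= L -> exists2 C : R, 0 <= C & forall (M : 'M[R]_q) (v w : 'cV[R]_q),
  nrm M <= L -> (forall x : 'cV[R]_q, nrm x <= L * nrm (M *m x)) -> v != 0 -> w != 0 ->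
  `|(ln (nrm (M *m v)) - ln (nrm v)) - (ln (nrm (M *m w)) - ln (nrm w))| <= C * pdist v w.
Proof.
move=> L1; have L0 : 0 < L by apply: lt_le_trans L1.
have lnL0 : 0 <= ln L by rewrite ln_ge0.
exists (q%:R * (4 * L ^+ 2 * (ln L + 1))).
  by apply: mulr_ge0 => //; apply: mulr_ge0; [rewrite mulr_ge0 ?sqr_ge0 | lra].
move=> M v w ML Mx v0 w0.
have Mn (x : 'cV[R]_q) : x != 0 -> 0 < nrm (M *m x).
  by rewrite -nrm_gt0 => x0; have := lt_le_trans x0 (Mx x); rewrite pmulr_rgt0.
have gb (x : 'cV[R]_q) : x != 0 -> `|ln (nrm (M *m x)) - ln (nrm x)| <= ln L.
  move=> x0; have Mx0 := Mn x x0; rewrite -nrm_gt0 in x0; rewrite ler_norml; apply/andP; split.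
    have := Mx x; rewrite -ler_ln ?posrE ?mulr_gt0 // lnM ?posrE //; lra.
  have : nrm (M *m x) <= L * nrm x by apply: le_trans (nrm_mul _ _) _; rewrite ler_wpM2r ?nrm_ge0.
  rewrite -ler_ln ?posrE ?mulr_gt0 // lnM ?posrE //; lra.
set rho := q%:R * pdist v w.
have rho0 : 0 <= rho by rewrite mulr_ge0 // pdist_ge0.
have -> : q%:R * (4 * L ^+ 2 * (ln L + 1)) * pdist v w = rho * (4 * L ^+ 2 * (ln L + 1)).
  by rewrite /rho; ring.
have LL : 1 <= L ^+ 2 by rewrite expr2 mulr_ege1.
(* For distant directions the trivial bound 2 ln L is already at most a multiple of rho. Otherwise v
   is so close to c w that their images differ by less than half of |M v|, and logarithms can be
   compared. *)
have [big|small] := leP 1 (2 * L ^+ 2 * rho).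
  have := gb v v0; have := gb w w0; rewrite !ler_norml => /andP[h1 h2] /andP[h3 h4].
  have h5 : 2 * ln L <= (2 * L ^+ 2 * rho) * (2 * ln L) by rewrite ler_peMl // mulr_ge0.
  have h6 : 0 <= rho * (4 * L ^+ 2) by rewrite mulr_ge0 // mulr_ge0 // sqr_ge0.
  by apply/andP; split; lra.
have [c hc] := wedge_close v w0.
have nv := v0; rewrite -nrm_gt0 in nv; have nw := w0; rewrite -nrm_gt0 in nw.
have hvc : nrm (v - c *: w) <= rho * nrm v.
  rewrite -(ler_pM2r nw); apply: le_trans hc _.
  rewrite /rho /pdist -!mulrA [_^-1 * _]mulVf ?mulr1 //.
  by rewrite mulf_neq0 // gt_eqF.
have rho2 : rho <= 2^-1.
  have : rho <= L ^+ 2 * rho by rewrite ler_peMl.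
  by move: small; lra.
have cw0 : 0 < nrm (c *: w).
  have := nrmD (v - c *: w) (c *: w); rewrite subrK.
  have := ler_wpM2r (ltW nv) rho2; lra.
have cwn0 : c *: w != 0 by rewrite -nrm_gt0.
have c0 : 0 < `|c| by move: cw0; rewrite nrmZ pmulr_lgt0.
have e : ln (nrm (M *m w)) - ln (nrm w) = ln (nrm (M *m (c *: w))) - ln (nrm (c *: w)).
  by rewrite -scalemxAr !nrmZ !lnM ?posrE ?Mn //; ring.
rewrite e.
have h1 : `|ln (nrm v) - ln (nrm (c *: w))| <= 2 * rho.
  by apply: ln_close => //; apply: le_trans (nrm_dist _ _) _.
have h2 : `|ln (nrm (M *m v)) - ln (nrm (M *m (c *: w)))| <= 2 * (L ^+ 2 * rho).
  apply: ln_close; rewrite ?Mn //; first by move: small; lra.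
  apply: le_trans (nrm_dist _ _) _; rewrite -mulmxBr; apply: le_trans (nrm_mul _ _) _.
  apply: le_trans (ler_pM (nrm_ge0 _) (nrm_ge0 _) ML hvc) _.
  have := ler_wpM2l (mulr_ge0 (ltW L0) rho0) (Mx v); rewrite expr2; lra.
have h3 : rho <= L ^+ 2 * rho by rewrite ler_peMl.
have h4 : 0 <= rho * (4 * L ^+ 2) * ln L by rewrite mulr_ge0 // mulr_ge0 // mulr_ge0 // sqr_ge0.
move: h1 h2; rewrite !ler_norml => /andP[a1 a2] /andP[b1 b2].
by apply/andP; split; lra.
Qed.

End MarkovCocycle.

Lemma cV_dim_gt0 (R : realType) q (v : 'cV[R]_q) : v != 0 -> (0 < q)%N.
Proof. by case: q v => // v; rewrite (flatmx0 v) eqxx. Qed.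

(** * Contracting cocycles *)

Section ContractingCocycles.
Variables (R : realType) (m : nat) (p : 'I_m.+1 -> R).
Hypotheses (p_pos : forall j, 0 < p j) (p_sum : \sum_j p j = 1).
Variables (q : nat).
Local Notation word := (nat -> letter m).
Local Notation trans := ('I_m.+1 -> 'I_m.+1 -> 'M[R]_q).
Implicit Type T : trans.

(* Bounds the projective Lipschitz constant of the product at v. *)
Definition expansion T n b (v : 'cV[R]_q) (w : word) : R :=
  kap (Mprod T n b w) * nrm v ^+ 2 / nrm (Mprod T n b w *m v) ^+ 2.

Definition contracting n0 (al kp : R) T : Prop := forall b (v : 'cV[R]_q), v != 0 ->
  Ex p n0 (fun w => expansion T n0 b v w `^ al) <= kp.

Definition log_growth T n b (v : 'cV[R]_q) : R :=
  Ex p n (fun w => ln (nrm (Mprod T n b w *m v)) - ln (nrm v)).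

Lemma expansion_ge0 T n b v w : 0 <= expansion T n b v w.
Proof. by apply: divr_ge0; [apply: mulr_ge0; rewrite ?kap_ge0 ?sqr_ge0 | exact: sqr_ge0]. Qed.

Lemma log_growthD T n k b v : (forall n b w, Mprod T n b w *m v != 0) ->
  log_growth T (n + k) b v = log_growth T n b v +
    Ex p n (fun u => log_growth T k (lastl n b u) (Mprod T n b u *m v)).
Proof.
move=> Mv; rewrite /log_growth Ex_pcat -ExD; apply: eq_Ex => u.
set x := ln _ - _.
rewrite -[x](Ex_cst p_sum k) -ExD; apply: eq_Ex => w.
rewrite MprodD wshift_pcat lastl_pcat Mprod_pcat -mulmxA /x; lra.
Qed.

Lemma bdiffD_cst n c (F : word -> R) y : bdiff p n c F -> bdiff p n c (fun w => F w + y).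
Proof.
elim: n F => //= n IH F [h1 h2]; split=> [a a'|a]; last exact: (IH _ (h2 a)).
by rewrite !ExD !Ex_cst // opprD addrACA subrr addr0.
Qed.

Section Fixed.
Variables (Lam : R) (n0 : nat) (al kp : R).
Hypotheses (Lam1 : 1 <= Lam) (n0_gt0 : (0 < n0)%N) (al0 : 0 < al) (al1 : al <= 1) (kp1 : kp < 1).

Definition admissible T := tame Lam T /\ contracting n0 al kp T.

(** The stretching of the pair (v, w) is at most the geometric mean of the expansions at v and at w;
    the arithmetic-geometric inequality separates them into two averages, each at most kp. *)
Lemma pdist_contract T : admissible T -> forall b (v w : 'cV[R]_q), v != 0 -> w != 0 ->
  Ex p n0 (fun u => pdist (Mprod T n0 b u *m v) (Mprod T n0 b u *m w) `^ al) <=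
    kp * pdist v w `^ al.
Proof.
move=> [hT hc] b v w v0 w0.
have h u : pdist (Mprod T n0 b u *m v) (Mprod T n0 b u *m w) `^ al <=
    pdist v w `^ al * 2^-1 * expansion T n0 b v u `^ al + pdist v w `^ al * 2^-1 * expansion T n0 b w u `^ al.
  set M := Mprod T n0 b u.
  have Mv : 0 < nrm (M *m v) by rewrite nrm_gt0 (Mprod_neq0 Lam1 hT).
  have Mw : 0 < nrm (M *m w) by rewrite nrm_gt0 (Mprod_neq0 Lam1 hT).
  have nv : 0 < nrm v by rewrite nrm_gt0.
  have nw : 0 < nrm w by rewrite nrm_gt0.
  pose z := kap M * (nrm v * nrm w) / (nrm (M *m v) * nrm (M *m w)).
  have z0 : 0 <= z by rewrite divr_ge0 ?mulr_ge0 ?kap_ge0 ?nrm_ge0.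
  have zxy : z ^+ 2 = expansion T n0 b v u * expansion T n0 b w u.
    by rewrite /expansion -/M /z; field; rewrite !gt_eqF.
  have hz := powR_prod_amgm al (expansion_ge0 T n0 b v u) (expansion_ge0 T n0 b w u) z0 zxy.
  have hd : pdist (M *m v) (M *m w) <= pdist v w * z.
    rewrite (_ : pdist v w * z = kap M * nrm (wedge v w) / (nrm (M *m v) * nrm (M *m w))).
      by rewrite /pdist ler_wpM2r ?invr_ge0 ?mulr_ge0 ?nrm_ge0 // nrm_wedge_mul.
    by rewrite /pdist /z; field; rewrite !gt_eqF.
  apply: le_trans (_ : (pdist v w * z) `^ al <= _).
    apply: ge0_ler_powR => //; rewrite ?nnegrE; [exact: ltW | exact: pdist_ge0 |].
    by rewrite mulr_ge0 // pdist_ge0.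
  rewrite powRM ?pdist_ge0 //.
  have := ler_wpM2l (powR_ge0 (pdist v w) al) hz; lra.
apply: le_trans (Ex_le p_pos n0 h) _; rewrite ExD !ExZ.
have d0 : 0 <= pdist v w `^ al * 2^-1 by rewrite mulr_ge0 ?powR_ge0.
have := ler_wpM2l d0 (hc b v v0); have := ler_wpM2l d0 (hc b w w0); lra.
Qed.

Lemma kp_ge0 T : admissible T -> 0 < q%:R :> R -> 0 <= kp.
Proof.
move=> [_ hc]; rewrite ltr0n => q0.
apply: le_trans (hc ord0 (delta_mx (Ordinal q0) 0) _); last by rewrite -nrm_gt0 nrm_delta.
by apply: Ex_ge0 => // w; exact: powR_ge0.
Qed.

(** The first n0 letters contribute at most 2 C times the distance to the power alpha; the rest is
    compared by induction after an average contraction by kp. H solves H = 2 C + kp H. *)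
Lemma log_growth_holder : exists2 H : R, 0 <= H & forall T, admissible T ->
  forall n b (v w : 'cV[R]_q), v != 0 -> w != 0 ->
  `|log_growth T n b v - log_growth T n b w| <= H * pdist v w `^ al.
Proof.
have L1 : 1 <= Num.max (q%:R * Lam ^+ n0) 1 by rewrite le_max lexx orbT.
have [C C0 hC] := @log_growth_lip R q _ L1.
have kp1' : 0 < 1 - kp by rewrite subr_gt0.
exists (2 * C / (1 - kp)); first by rewrite divr_ge0 ?mulr_ge0 // ltW.
move=> T aT; have [hT hc] := aT.
set H := 2 * C / (1 - kp).
have HE : 2 * C + kp * H = H by rewrite /H; field; rewrite gt_eqF.
have Lam0 : 0 < Lam by apply: lt_le_trans Lam1.
have short n b v w : (n <= n0)%N -> v != 0 -> w != 0 ->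
    `|log_growth T n b v - log_growth T n b w| <= 2 * C * pdist v w `^ al.
  move=> nn0 v0 w0; rewrite -ExB; apply: (Ex_norm_le p_pos p_sum) => u.
  have LL : Lam ^+ n <= Lam ^+ n0 by apply: ler_weXn2l.
  have M1 (x : 'cV[R]_q) : nrm (Mprod T n b u *m x) <= Lam ^+ n0 * nrm x.
    by apply: le_trans (tame_ub Lam1 hT n b u x) _; rewrite ler_wpM2r ?nrm_ge0.
  have ML : nrm (Mprod T n b u) <= Num.max (q%:R * Lam ^+ n0) 1.
    rewrite le_max; apply/orP; left; rewrite nrm_cols mulr_natl -[X in _ *+ X]card_ord -sumr_const.
    by apply: ler_sum => j _; apply: le_trans (M1 _) _; rewrite nrm_delta mulr1.
  have q0 := cV_dim_gt0 v0.
  have Mx (x : 'cV[R]_q) : nrm x <= Num.max (q%:R * Lam ^+ n0) 1 * nrm (Mprod T n b u *m x).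
    apply: le_trans (tame_lb Lam1 hT n b u x) _; rewrite ler_wpM2r ?nrm_ge0 //.
    rewrite le_max; apply/orP; left; apply: le_trans LL _.
    by rewrite ler_peMl ?exprn_ge0 ?(ltW Lam0) // ler1n.
  apply: le_trans (hC _ _ _ ML Mx v0 w0) _; rewrite [2 * C]mulrC -mulrA ler_wpM2l //.
  by apply: le_2powR => //; [exact: pdist_ge0 | exact: pdist_le2].
have [q0|q0] := posnP q.
  by move=> n b v w /cV_dim_gt0 h; move: q0 => /eqP; rewrite gtn_eqF.
have kp0 : 0 <= kp by apply: (kp_ge0 aT); rewrite ltr0n.
have H0 : 0 <= H by rewrite divr_ge0 ?mulr_ge0 // ltW.
have CH : 2 * C <= H by rewrite -[leRHS]HE lerDl mulr_ge0.
elim/ltn_ind => n IH b v w v0 w0.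
have [nn0|nn0] := leqP n n0.
  by apply: le_trans (short n b v w nn0 v0 w0) _; rewrite ler_wpM2r ?powR_ge0.
rewrite -(subnKC (ltnW nn0)) !log_growthD; try by move=> *; exact: (Mprod_neq0 Lam1 hT).
set k := (n - n0)%N.
have kn : (k < n)%N by rewrite /k ltn_subrL n0_gt0 (leq_ltn_trans _ nn0).
have h1 := short n0 b v w (leqnn _) v0 w0.
have h2 : `|Ex p n0 (fun u => log_growth T k (lastl n0 b u) (Mprod T n0 b u *m v)) -
   Ex p n0 (fun u => log_growth T k (lastl n0 b u) (Mprod T n0 b u *m w))| <= H * (kp * pdist v w `^ al).
  rewrite -ExB; apply: le_trans (_ : Ex p n0 (fun u => H * pdist (Mprod T n0 b u *m v) (Mprod T n0 b u *m w) `^ al) <= _).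
    rewrite ler_norml -ExN; apply/andP; split; apply: (Ex_le p_pos) => u;
    have := IH k kn (lastl n0 b u) _ _ (Mprod_neq0 Lam1 hT n0 b u v0) (Mprod_neq0 Lam1 hT n0 b u w0);
    by rewrite ler_norml => /andP[].
  by rewrite ExZ ler_wpM2l // pdist_contract.
set X := Ex p n0 _ in h2 *; set Y := Ex p n0 _ in h2 *.
rewrite -HE mulrDl; move: h1 h2; rewrite !ler_norml => /andP[a1 a2] /andP[b1 b2].
by apply/andP; split; lra.
Qed.

(** Fed with the same letters, both products share the preceding letter after one step, so the
    dependence on b is lost and only the directions differ; these are handled by the Hoelder
    bound. *)
Lemma log_growth_osc : exists2 K : R, 0 <= K & forall T, admissible T ->
  forall n b b' (v w : 'cV[R]_q), v != 0 -> w != 0 ->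
  `|log_growth T n b v - log_growth T n b' w| <= K.
Proof.
have [H H0 hH] := log_growth_holder.
have lnL0 : 0 <= ln Lam by rewrite ln_ge0.
exists (2 * ln Lam + 2 * H); first lra.
move=> T aT; have [hT hc] := aT; case=> [|n] b b' v w v0 w0.
  by rewrite /log_growth /= !mul1mx !subrr normr0; lra.
rewrite -add1n !log_growthD; try by move=> *; exact: (Mprod_neq0 Lam1 hT).
have g1 c x : x != 0 -> `|log_growth T 1 c x| <= ln Lam.
  move=> x0; apply: (Ex_norm_le p_pos p_sum) => u.
  by have := ln_Mprod_le Lam1 hT 1 c u x0; rewrite mul1r.
have h1 := g1 b v v0; have h2 := g1 b' w w0.
have h3 : `|Ex p 1 (fun u => log_growth T n (lastl 1 b u) (Mprod T 1 b u *m v)) -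
   Ex p 1 (fun u => log_growth T n (lastl 1 b' u) (Mprod T 1 b' u *m w))| <= 2 * H.
  rewrite -ExB; apply: (Ex_norm_le p_pos p_sum) => u.
  set v' := Mprod T 1 b u *m v; set w' := Mprod T 1 b' u *m w.
  have v'0 : v' != 0 by exact: (Mprod_neq0 Lam1 hT).
  have w'0 : w' != 0 by exact: (Mprod_neq0 Lam1 hT).
  apply: le_trans (hH T aT n (u 0%N) v' w' v'0 w'0) _; rewrite mulrC ler_wpM2r //.
  have p2 := pdist_le2 v'0 w'0.
  apply: le_trans (_ : (2 : R) `^ al <= _).
    by apply: ge0_ler_powR; rewrite ?nnegrE ?pdist_ge0 // ltW.
  by rewrite -[leRHS]powRr1 // ler_powR // ler1n.
set X := Ex p 1 _ in h3 *; set Y := Ex p 1 _ in h3 *.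
move: h1 h2 h3; rewrite !ler_norml => /andP[a1 a2] /andP[b1 b2] /andP[c1 c2].
by apply/andP; split; lra.
Qed.

Lemma log_growth_bdiff : exists2 c : R, 1 <= c & forall T, admissible T ->
  forall n b (v : 'cV[R]_q), v != 0 ->
  bdiff p n c (fun w => ln (nrm (Mprod T n b w *m v)) - ln (nrm v)).
Proof.
have [K K0 hK] := log_growth_osc.
have lnL0 : 0 <= ln Lam by rewrite ln_ge0.
(* Two one-step changes and one oscillation of the remaining mean; the summand 1 gives c >= 1, hence
   c <= c^2 in the choice of t later. *)
exists (2 * ln Lam + K + 1); first lra.
move=> T aT; have [hT hc] := aT.
elim=> [//|n IH] b v v0.
have T0 a : T a b *m v != 0.
  by have := Mprod_neq0 Lam1 hT 1 b (fun=> a) v0; rewrite /= mul1mx.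
have gE a : (fun w => ln (nrm (Mprod T n.+1 b (scons a w) *m v)) - ln (nrm v)) =
   (fun w => (ln (nrm (Mprod T n a w *m (T a b *m v))) - ln (nrm (T a b *m v))) +
             (ln (nrm (T a b *m v)) - ln (nrm v))).
  apply/funext => w /=; rewrite (_ : wshift 1 _ = w) // mulmxA; lra.
split=> [a a'|a].
  have e a0 : Ex p n (fun w => ln (nrm (Mprod T n.+1 b (scons a0 w) *m v)) - ln (nrm v)) =
      log_growth T n a0 (T a0 b *m v) + (ln (nrm (T a0 b *m v)) - ln (nrm v)).
    by rewrite gE ExD Ex_cst.
  rewrite !e.
  have g1 a0 : `|ln (nrm (T a0 b *m v)) - ln (nrm v)| <= ln Lam.
    by have := ln_Mprod_le Lam1 hT 1 b (fun=> a0) v0; rewrite mul1r /= mul1mx.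
  have := g1 a; have := g1 a'; have := hK T aT n a a' _ _ (T0 a) (T0 a').
  rewrite !ler_norml => /andP[a1 a2] /andP[b1 b2] /andP[c1 c2].
  by apply/andP; split; lra.
by rewrite gE; apply: bdiffD_cst; exact: IH.
Qed.

Lemma lyapunov_rate : exists2 K : R, 0 <= K & forall T, admissible T ->
  exists L : R, forall n b (v : 'cV[R]_q), v != 0 -> `|log_growth T n b v - n%:R * L| <= K.
Proof.
have [K K0 hK] := log_growth_osc.
exists (2 * K); first lra.
move=> T aT; have [hT hc] := aT.
have [q0|q0] := posnP q.
  by exists 0 => n b v /cV_dim_gt0 h; move: q0 => /eqP; rewrite gtn_eqF.
pose v0 : 'cV[R]_q := delta_mx (Ordinal q0) 0.
have v00 : v0 != 0 by rewrite -nrm_gt0 nrm_delta.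
have [L hL] : exists L, forall n, `|log_growth T n ord0 v0 - n%:R * L| <= K.
  apply: quasi_additive => n k.
  rewrite log_growthD; last by move=> *; exact: (Mprod_neq0 Lam1 hT).
  rewrite (addrC (log_growth T n ord0 v0)) addrK -[X in _ - X](Ex_cst p_sum n) -ExB; apply: (Ex_norm_le p_pos p_sum) => u.
  by apply: hK => //; exact: (Mprod_neq0 Lam1 hT).
exists L => n b v vn0; have := hL n; have := hK T aT n b ord0 v v0 vn0 v00.
rewrite !ler_norml => /andP[b1 b2] /andP[c1 c2].
by apply/andP; split; lra.
Qed.

(** Azuma's inequality is applied to the q columns and to both tails, hence the factor 2 q;
    replacing the norm of the product by its largest column costs ln q. *)
Lemma large_deviations : exists2 c : R, 0 < c & forall T, admissible T ->
  forall K L, (forall n b (v : 'cV[R]_q), v != 0 -> `|log_growth T n b v - n%:R * L| <= K) ->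
  (0 < q)%N -> forall n b y, 0 <= y -> y <= 1 ->
  Prob p n (fun w => K + ln q%:R + n%:R * y <= `|ln (nrm (Mprod T n b w)) - n%:R * L|) <=
    q%:R * 2 * expR (- (n%:R * c * y ^+ 2)).
Proof.
have [c c1 hc] := log_growth_bdiff.
have c0 : 0 < c by apply: lt_le_trans c1.
exists (8 * c ^+ 2)^-1; first by rewrite invr_gt0 mulr_gt0 // exprn_gt0.
move=> T aT K L hL q0 n b y y0 y1; have [hT _] := aT.
pose e j : 'cV[R]_q := delta_mx j 0.
have e0 j : e j != 0 by rewrite -nrm_gt0 nrm_delta.
pose F j w := ln (nrm (Mprod T n b w *m e j)) - ln (nrm (e j)).
(* The minimiser of the exponent; t c <= 1/2 follows from y <= 1 <= c. *)
pose t := y / (4 * c ^+ 2).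
have c20 : 0 < c ^+ 2 by rewrite exprn_gt0.
have t0 : 0 <= t by rewrite divr_ge0 // mulr_ge0 // ltW.
have tc : t * c <= 2^-1.
  rewrite /t mulrAC ler_pdivrMr ?mulr_gt0 //.
  have : y * c <= c by rewrite ler_piMl // ltW.
  have : c <= c ^+ 2 by rewrite expr2 ler_peMl // ltW.
  lra.
have te : n%:R * (2 * (t * c) ^+ 2) - t * (n%:R * y) = - (n%:R * (8 * c ^+ 2)^-1 * y ^+ 2).
  by rewrite /t; field; rewrite gt_eqF.
have tail j : Prob p n (fun w => n%:R * y <= F j w - Ex p n (F j)) <= expR (- (n%:R * (8 * c ^+ 2)^-1 * y ^+ 2)).
  by rewrite -te; apply: (azuma p_pos p_sum _ (ltW c0) t0 tc); exact: hc.
have tailN j : Prob p n (fun w => n%:R * y <= - F j w - Ex p n (fun w => - F j w)) <= expR (- (n%:R * (8 * c ^+ 2)^-1 * y ^+ 2)).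
  by rewrite -te; apply: (azuma p_pos p_sum _ (ltW c0) t0 tc); apply: bdiffN; exact: hc.
have lne j : ln (nrm (e j)) = 0 by rewrite nrm_delta ln1.
have lq0 : 0 <= ln q%:R :> R by rewrite ln_ge0 // ler1n.
apply: le_trans (_ : Ex p n (fun w => \sum_(j < q) (ind R (fun w => n%:R * y <= F j w - Ex p n (F j)) w +
    ind R (fun w => n%:R * y <= - F j w - Ex p n (fun w => - F j w)) w)) <= _).
  apply: (Ex_le p_pos) => w; apply: ind_le.
    by apply: sumr_ge0 => j _; rewrite addr_ge0 ?ind_ge0.
  move=> hw.
  suff [j hj] : exists j, n%:R * y <= F j w - Ex p n (F j) \/ n%:R * y <= - F j w - Ex p n (fun w => - F j w).
    rewrite (bigD1 j) //= -[leLHS]addr0; apply: lerD.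
      by case: hj => h; rewrite (ind1 R h) ?lerDl ?lerDr ind_ge0.
    by apply: sumr_ge0 => i _; rewrite addr_ge0 ?ind_ge0.
  set M := Mprod T n b w in hw *.
  have M0 : 0 < nrm (M *m e (Ordinal q0)) by rewrite nrm_gt0; exact: (Mprod_neq0 Lam1 hT).
  have Mge j : nrm (M *m e j) <= nrm M.
    by rewrite [leRHS]nrm_cols (bigD1 j) //= lerDl; apply: sumr_ge0 => i _; exact: nrm_ge0.
  have Mp : 0 < nrm M by apply: lt_le_trans M0 (Mge _).
  (* An upward deviation of the norm is inherited by the largest column; a downward one by every
     column, since columns are bounded by the norm. *)
  have [hp|hn] := leP 0 (ln (nrm M) - n%:R * L).
    rewrite ger0_norm // in hw.
    have [j hj] : exists j, nrm M <= q%:R * nrm (M *m e j).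
      have gen k (N : 'M[R]_k) : (0 < k)%N -> exists j, nrm N <= k%:R * nrm (N *m delta_mx j (0 : 'I_1)).
        by case: k N => // k N _; exact: nrm_max_col.
      exact: gen.
    exists j; left.
    have Mj : 0 < nrm (M *m e j) by rewrite nrm_gt0; exact: (Mprod_neq0 Lam1 hT).
    have := hj; rewrite -ler_ln ?posrE ?mulr_gt0 ?ltr0n // lnM ?posrE ?ltr0n // => h1.
    have := hL n b (e j) (e0 j); rewrite /log_growth ler_norml => /andP[h2 h3].
    by rewrite [F j w]/F lne -/M; move: h3 h1 hw; rewrite -/(F j); lra.
  rewrite ltr0_norm // in hw.
  exists (Ordinal q0); right.
  have := Mge (Ordinal q0); rewrite -ler_ln ?posrE // => h1.
  have := hL n b (e (Ordinal q0)) (e0 _); rewrite /log_growth ler_norml => /andP[h2 h3].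
  by rewrite ExN [F _ w]/F lne -/M; move: h2 h1 hw; rewrite -/(F (Ordinal q0)); lra.
rewrite Ex_sum //; apply: le_trans (_ : \sum_(j < q) (2 * expR (- (n%:R * (8 * c ^+ 2)^-1 * y ^+ 2))) <= _).
  by apply: ler_sum => j _; rewrite ExD mulr2n mulrDl mul1r; apply: lerD; [exact: tail | exact: tailN].
by rewrite sumr_const card_ord -[leLHS]mulr_natl mulrA.
Qed.

(** Changing one letter from T to T' costs Lam delta directly and displaces the direction by at most
    2 Lam delta, which the Hoelder bound turns into a power of delta. The error per letter gives the
    error of the rate. *)
Lemma rate_holder : exists2 C : R, 0 <= C & forall T T' (K L L' delta : R), admissible T -> admissible T' ->
  (0 < q)%N -> 0 < delta -> delta <= 1 -> (forall a b, nrm (T a b - T' a b) <= delta) ->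
  (forall n b (v : 'cV[R]_q), v != 0 -> `|log_growth T n b v - n%:R * L| <= K) ->
  (forall n b (v : 'cV[R]_q), v != 0 -> `|log_growth T' n b v - n%:R * L'| <= K) ->
  `|L - L'| <= C * delta `^ al.
Proof.
have [H H0 hH] := log_growth_holder.
have Lam0 : 0 < Lam by apply: lt_le_trans Lam1.
pose C := Lam + H * (2 * Lam).
exists C; first by rewrite /C addr_ge0 ?mulr_ge0 // ltW.
move=> T T' K L L' delta aT aT' q0 d0 d1 hd hL hL'.
have [hT _] := aT; have [hT' _] := aT'.
have dal : delta <= delta `^ al by apply: ger1_powR => //; rewrite d0.
have step a b (v : 'cV[R]_q) : v != 0 ->
    `|ln (nrm (T a b *m v)) - ln (nrm (T' a b *m v))| <= Lam * delta.
  move=> v0; have nv := v0; rewrite -nrm_gt0 in nv.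
  have Tv : 0 < nrm (T a b *m v) by have := lt_le_trans nv (hT.2 a b v); rewrite pmulr_rgt0.
  have T'v : 0 < nrm (T' a b *m v) by have := lt_le_trans nv (hT'.2 a b v); rewrite pmulr_rgt0.
  have h : `|nrm (T a b *m v) - nrm (T' a b *m v)| <= delta * nrm v.
    apply: le_trans (nrm_dist _ _) _; rewrite -mulmxBl; apply: le_trans (nrm_mul _ _) _.
    by rewrite ler_wpM2r // ltW.
  have := ler_wpM2l (ltW d0) (hT.2 a b v); have := ler_wpM2l (ltW d0) (hT'.2 a b v) => u1 u2.
  move: h; rewrite !ler_norml => /andP[h1 h2]; apply/andP; split.
    rewrite -opprB lerN2; apply: le_trans (ln_sub_le T'v Tv) _.
    by rewrite ler_pdivrMr //; lra.
  apply: le_trans (ln_sub_le Tv T'v) _.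
  by rewrite ler_pdivrMr //; lra.
have pd a b (v : 'cV[R]_q) : v != 0 -> pdist (T a b *m v) (T' a b *m v) <= 2 * Lam * delta.
  move=> v0; have nv := v0; rewrite -nrm_gt0 in nv.
  have Tv : 0 < nrm (T a b *m v) by have := lt_le_trans nv (hT.2 a b v); rewrite pmulr_rgt0.
  have T'v : 0 < nrm (T' a b *m v) by have := lt_le_trans nv (hT'.2 a b v); rewrite pmulr_rgt0.
  rewrite ler_pdivrMr ?mulr_gt0 //.
  have -> : wedge (T a b *m v) (T' a b *m v) = wedge ((T a b - T' a b) *m v) (T' a b *m v).
    by apply/matrixP => i j; rewrite mulmxBl !wedgeE !mxE; ring.
  apply: le_trans (nrm_wedge _ _) _.
  have h : nrm ((T a b - T' a b) *m v) <= delta * nrm v.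
    by apply: le_trans (nrm_mul _ _) _; rewrite ler_wpM2r // ltW.
  have h2 := le_trans h (ler_wpM2l (ltW d0) (hT.2 a b v)).
  have := ler_wpM2r (ltW T'v) h2; lra.
have hn n : forall b (v : 'cV[R]_q), v != 0 ->
    `|log_growth T n b v - log_growth T' n b v| <= n%:R * (C * delta `^ al).
  elim: n => [|n IH] b v v0; first by rewrite /log_growth /= !mul1mx !subrr normr0 mul0r.
  have Tv a : T a b *m v != 0.
    by have := Mprod_neq0 Lam1 hT 1 b (fun=> a) v0; rewrite /= mul1mx.
  have T'v a : T' a b *m v != 0.
    by have := Mprod_neq0 Lam1 hT' 1 b (fun=> a) v0; rewrite /= mul1mx.
  rewrite -[n.+1]add1n !log_growthD; last 2 first.
    by move=> *; exact: (Mprod_neq0 Lam1 hT').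
    by move=> *; exact: (Mprod_neq0 Lam1 hT).
  rewrite opprD addrACA -!ExB.
  have h1 : `|Ex p 1 (fun w => ln (nrm (Mprod T 1 b w *m v)) - ln (nrm v)
       - (ln (nrm (Mprod T' 1 b w *m v)) - ln (nrm v)))| <= Lam * delta `^ al.
    apply: (Ex_norm_le p_pos p_sum) => w /=; rewrite !mul1mx.
    apply: le_trans (_ : Lam * delta <= _); last by rewrite ler_wpM2l // ltW.
    by have := step (w 0%N) b v v0; rewrite opprB addrA subrK.
  have h2 : `|Ex p 1 (fun u => log_growth T n (lastl 1 b u) (Mprod T 1 b u *m v) -
      log_growth T' n (lastl 1 b u) (Mprod T' 1 b u *m v))| <= H * (2 * Lam) * delta `^ al + n%:R * (C * delta `^ al).
    apply: (Ex_norm_le p_pos p_sum) => u /=; rewrite !mul1mx; set a := u 0%N.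
    have g1 := hH T aT n a _ _ (Tv a) (T'v a).
    have g2 := IH a _ (T'v a).
    have g3 : pdist (T a b *m v) (T' a b *m v) `^ al <= 2 * Lam * delta `^ al.
      apply: le_trans (_ : (2 * Lam * delta) `^ al <= _).
        apply: ge0_ler_powR; rewrite ?nnegrE ?pdist_ge0 ?mulr_ge0 //; [exact: ltW|exact: ltW|exact: ltW|exact: pd].
      rewrite powRM ?mulr_ge0 //; try exact: ltW.
      by rewrite ler_wpM2r ?powR_ge0 // ler1_powR //; move: Lam1; lra.
    have := ler_wpM2l H0 g3; move: g1 g2; rewrite !ler_norml => /andP[a1 a2] /andP[b1 b2] g4.
    by apply/andP; split; lra.
  apply: le_trans (ler_normD _ _) _; rewrite natrD.
  move: h1 h2; rewrite /C; set X := `|Ex p 1 _|; set Y := `|Ex p 1 _|; lra.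
pose v0 : 'cV[R]_q := delta_mx (Ordinal q0) 0.
have v00 : v0 != 0 by rewrite -nrm_gt0 nrm_delta.
(* K does not grow with n, so it disappears from the rate and C is independent of it. *)
have hN n : n%:R * (`|L - L'| - C * delta `^ al) <= 2 * K.
  have := hn n ord0 v0 v00; have := hL n ord0 v0 v00; have := hL' n ord0 v0 v00.
  have nn : n%:R * `|L - L'| = `|n%:R * (L - L')| by rewrite normrM ger0_norm.
  rewrite mulrBr nn.
  set x := log_growth _ _ _ _; set y := log_growth _ _ _ _ => g1 g2 g3.
  have : `|n%:R * (L - L')| <= `|y - n%:R * L| + `|y - x| + `|x - n%:R * L'|.
    have -> : n%:R * (L - L') = - (y - n%:R * L) + (y - x) + (x - n%:R * L') by ring.
    apply: le_trans (ler_normD _ _) _; rewrite lerD2r; apply: le_trans (ler_normD _ _) _.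
    by rewrite normrN.
  lra.
rewrite -subr_le0 leNgt; apply/negP => gap.
have := hN (Num.truncn (2 * K / (`|L - L'| - C * delta `^ al))).+1.
rewrite leNgt -ltr_pdivrMr // truncnS_gt //.
Qed.

End Fixed.
End ContractingCocycles.

(** * Contraction from irreducibility and a spectral gap *)

Section RelativeGrowth.
Variables (R : realType) (q : nat).

(** For M close to rank one this is, up to bounded factors, the pairing of the direction of v with
    the dominant row of M; it is small when v is near the hyperplane that M nearly kills. *)
Definition phi (M : 'M[R]_q) (v : 'cV[R]_q) : R := nrm (M *m v) / (nrm M * nrm v).

Lemma phi_ge0 M v : 0 <= phi M v.
Proof. by rewrite divr_ge0 ?mulr_ge0 ?nrm_ge0. Qed.

Lemma phi_le1 M v : phi M v <= 1.
Proof.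
have [vz|v0] := eqVneq v 0; first by rewrite /phi vz mulmx0 nrm0 mul0r.
have [Mz|M0] := eqVneq M 0; first by rewrite /phi Mz mul0mx !nrm0 !mul0r.
by rewrite ler_pdivrMr ?mulr_gt0 ?nrm_gt0 // mul1r nrm_mul.
Qed.

(* A matrix with small kap is nearly of rank one, so the relative growth of a
   vector hardly changes when one more factor D is applied. *)
Lemma phi_step (Lam : R) : 1 <= Lam -> exists2 C : R, 0 <= C & forall (M D : 'M[R]_q) (kappa : R) (v : 'cV[R]_q),
  kap M <= kappa * nrm M ^+ 2 -> kappa <= 1 -> M != 0 -> v != 0 ->
  nrm D <= Lam -> (forall x : 'M[R]_q, nrm x <= Lam * nrm (D *m x)) ->
  `|phi (D *m M) v - phi M v| <= C * kappa.
Proof.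
move=> Lam1; have Lam0 : 0 < Lam by apply: lt_le_trans Lam1.
pose Q : R := q%:R.
have Q0 : 0 <= Q by [].
exists (Lam ^+ 2 * (2 * Q ^+ 2) * (2 + 2 * Q * (1 + 2 * Q ^+ 2))).
  by do ![done | exact: ltW | apply: sqr_ge0 | apply: mulr_ge0 | apply: addr_ge0].
move=> M D kappa v hk k1 M0 v0 DL Dx.
have nM : 0 < nrm M by rewrite nrm_gt0.
have nv : 0 < nrm v by rewrite nrm_gt0.
have q0 := cV_dim_gt0 v0.
have k0 : 0 <= kappa.
  by have := le_trans (kap_ge0 M) hk; rewrite pmulr_lge0 // exprn_gt0.
have [j0 hj0] : exists j, nrm M <= Q * nrm (M *m delta_mx j (0 : 'I_1)).
  rewrite /Q; have gen k (N : 'M[R]_k) : (0 < k)%N -> exists j, nrm N <= k%:R * nrm (N *m delta_mx j (0 : 'I_1)).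
    by case: k N => // k N _; exact: nrm_max_col.
  exact: gen.
(* A basis vector with almost maximal expansion, so that M w approximately spans the range of M. *)
set w : 'cV[R]_q := delta_mx j0 0 in hj0.
have Qp : 0 < Q by rewrite ltr0n.
have Mw0 : M *m w != 0 by rewrite -nrm_gt0 -(pmulr_rgt0 _ Qp) (lt_le_trans nM).
have nMw : 0 < nrm (M *m w) by rewrite nrm_gt0.
pose E := 2 * Q ^+ 2 * kappa.
have E0 : 0 <= E by rewrite mulr_ge0 // mulr_ge0 // sqr_ge0.
set mm := nrm M in hk nM hj0.
have approx (x : 'cV[R]_q) : exists c, nrm (M *m x - c *: (M *m w)) <= E * mm * nrm x.
  have [c hc] := wedge_close (M *m x) Mw0; exists c.
  rewrite -(ler_pM2r nMw); apply: le_trans hc _.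
  have h1 := nrm_wedge_mul M x w.
  have h2 := nrm_wedge x w; rewrite nrm_delta mulr1 in h2.
  have h3 : nrm (wedge (M *m x) (M *m w)) <= kappa * mm ^+ 2 * (2 * nrm x).
    by apply: le_trans h1 _; apply: ler_pM; rewrite ?kap_ge0 ?nrm_ge0.
  have h4 := ler_wpM2l Q0 h3.
  apply: le_trans h4 _.
  rewrite [leLHS](_ : _ = (2 * Q * kappa * mm * nrm x) * mm); last by ring.
  rewrite [leRHS](_ : _ = (2 * Q * kappa * mm * nrm x) * (Q * nrm (M *m w))); last by rewrite /E; ring.
  by apply: ler_wpM2l hj0; rewrite mulr_ge0 ?nrm_ge0 // mulr_ge0 ?nrm_ge0 // mulr_ge0 // mulr_ge0.
have [c hc] := approx v.
have [cj hcj] := choice (fun j : 'I_q => approx (delta_mx j 0)).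
pose x := nrm (M *m w); pose y := nrm (D *m (M *m w)); pose M' := nrm (D *m M).
pose g := \sum_j `|cj j|.
have b1 (u : 'cV[R]_q) d : nrm (M *m u - d *: (M *m w)) <= E * mm * nrm u ->
    `|nrm (M *m u) - `|d| * x| <= E * mm * nrm u.
  by move=> h; apply: le_trans h; rewrite -nrmZ nrm_dist.
have b2 (u : 'cV[R]_q) d : nrm (M *m u - d *: (M *m w)) <= E * mm * nrm u ->
    `|nrm (D *m (M *m u)) - `|d| * y| <= Lam * (E * mm * nrm u).
  move=> h; rewrite -nrmZ; apply: le_trans (nrm_dist _ _) _.
  rewrite scalemxAr -mulmxBr; apply: le_trans (nrm_mul _ _) _.
  by apply: ler_pM; rewrite ?nrm_ge0.
have b3 : `|mm - g * x| <= Q * (E * mm).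
  rewrite {1}(nrm_cols M : mm = _) /g mulr_suml -sumrB; apply: le_trans (ler_norm_sum _ _ _) _.
  rewrite /Q mulr_natl -[X in _ *+ X]card_ord -sumr_const; apply: ler_sum => j _.
  by have := b1 _ _ (hcj j); rewrite nrm_delta mulr1.
have b4 : `|M' - g * y| <= Q * (Lam * (E * mm)).
  rewrite {1}(nrm_cols (D *m M) : M' = _) /g mulr_suml -sumrB; apply: le_trans (ler_norm_sum _ _ _) _.
  rewrite /Q mulr_natl -[X in _ *+ X]card_ord -sumr_const; apply: ler_sum => j _.
  by have := b2 _ _ (hcj j); rewrite nrm_delta mulr1 mulmxA.
have b5 := b1 _ _ hc; have b6 := b2 _ _ hc.
have M'le : M' <= Lam * mm by apply: le_trans (nrm_mul _ _) _; rewrite ler_wpM2r ?nrm_ge0.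
have mle : mm <= Lam * M' by exact: Dx.
have M'0 : 0 < M' by rewrite -(pmulr_rgt0 _ Lam0) (lt_le_trans nM).
have DMv : nrm (D *m (M *m v)) <= Lam * (mm * nrm v).
  apply: le_trans (nrm_mul _ _) _; apply: ler_pM; rewrite ?nrm_ge0 //; exact: nrm_mul.
have Mv : nrm (M *m v) <= mm * nrm v by exact: nrm_mul.
set Y := nrm (D *m (M *m v)) in b6 DMv *; set X := nrm (M *m v) in b5 Mv *.
set C := `|c| in b5 b6.
have C0 : 0 <= C := normr_ge0 c.
have x0 : 0 <= x by exact: nrm_ge0.
have y0 : 0 <= y by exact: nrm_ge0.
have X0 : 0 <= X by exact: nrm_ge0.
set V := nrm v in nv b5 b6 DMv Mv *.
have Cx : C * x <= mm * V * (1 + E).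
  by move: b5; rewrite ler_norml => /andP[h _]; lra.
have Cy : C * y <= Lam * (mm * V) * (1 + E).
  by move: b6; rewrite ler_norml => /andP[h _]; lra.
(* For an exact rank-one M this difference is (C y)(g x) - (C x)(g y) = 0; the four terms below are
   the deviations from that case. *)
have num : `|Y * mm - X * M'| <= mm ^+ 2 * V * (Lam * E * (2 + 2 * Q * (1 + E))).
  have -> : Y * mm - X * M' = (Y - C * y) * mm + (C * y) * (mm - g * x)
      - (C * x) * (M' - g * y) - (X - C * x) * M' by ring.
  have t1 : `|(Y - C * y) * mm| <= Lam * (E * mm * V) * mm.
    by rewrite normrM (gtr0_norm nM) ler_wpM2r // ltW.
  have t2 : `|(C * y) * (mm - g * x)| <= (Lam * (mm * V) * (1 + E)) * (Q * (E * mm)).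
    by rewrite normrM (ger0_norm (mulr_ge0 C0 y0)); apply: ler_pM; rewrite ?mulr_ge0.
  have t3 : `|(C * x) * (M' - g * y)| <= (mm * V * (1 + E)) * (Q * (Lam * (E * mm))).
    by rewrite normrM (ger0_norm (mulr_ge0 C0 x0)); apply: ler_pM; rewrite ?mulr_ge0.
  have t4 : `|(X - C * x) * M'| <= (E * mm * V) * (Lam * mm).
    by rewrite normrM (gtr0_norm M'0); apply: ler_pM => //; exact: ltW.
  apply: le_trans (ler_normB _ _) _; apply: le_trans (lerD (ler_normB _ _) (lexx _)) _.
  apply: le_trans (lerD (lerD (ler_normD _ _) (lexx _)) (lexx _)) _.
  apply: le_trans (lerD (lerD (lerD t1 t2) t3) t4) _.
  by rewrite le_eqVlt; apply/orP; left; apply/eqP; ring.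
have eq : phi (D *m M) v - phi M v = (Y * mm - X * M') / (M' * mm * V).
  rewrite /phi -mulmxA -/Y -/X -/M' -/mm -/V; field.
  by rewrite !gt_eqF.
rewrite eq normrM normfV [`|M' * mm * V|]ger0_norm; last by rewrite !mulr_ge0 ?ltW.
rewrite ler_pdivrMr ?mulr_gt0 //; apply: le_trans num _.
have EQ : E <= 2 * Q ^+ 2 by rewrite /E ler_piMr // mulr_ge0 // sqr_ge0.
have f1 : 2 + 2 * Q * (1 + E) <= 2 + 2 * Q * (1 + 2 * Q ^+ 2).
  by rewrite lerD2l ler_wpM2l ?mulr_ge0 // lerD2l.
have f2 : Lam * E * (2 + 2 * Q * (1 + E)) <= Lam * E * (2 + 2 * Q * (1 + 2 * Q ^+ 2)).
  by rewrite ler_wpM2l // mulr_ge0 // ltW.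
have Z0 : 0 <= Lam * E * (2 + 2 * Q * (1 + 2 * Q ^+ 2)).
  by do ![done | exact: ltW | apply: sqr_ge0 | apply: mulr_ge0 | apply: addr_ge0].
have f3 : mm ^+ 2 * V <= Lam * M' * mm * V.
  by rewrite expr2 ler_wpM2r ?(ltW nv) // ler_wpM2r // ltW.
apply: le_trans (ler_wpM2l _ f2) _; first by rewrite mulr_ge0 ?sqr_ge0 // ltW.
apply: le_trans (ler_wpM2r Z0 f3) _.
by rewrite le_eqVlt; apply/orP; left; apply/eqP; rewrite /E; ring.
Qed.

End RelativeGrowth.

(** * Orbits span under irreducibility *)

Section Spanning.
Variables (R : realType) (m : nat) (q : nat).
Local Notation word := (nat -> letter m).
Variable T : 'I_m.+1 -> 'I_m.+1 -> 'M[R]_q.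
Hypothesis T_unit : forall a b, T a b \in unitmx.

Definition trans_reducible : Prop := exists V : 'I_m.+1 -> 'M[R]_q,
  (forall a, V a != 0) /\ (forall a, (\rank (V a) < q)%N) /\
  (forall a b, (V b *m (T a b)^T == V a)%MS).

(** In row form, the span of the images of v along words of length 1 to j that end in a, with b as
    the preceding letter. *)
Fixpoint orbit_span (b : 'I_m.+1) (v : 'cV[R]_q) (j : nat) (a : 'I_m.+1) : 'M[R]_q :=
  if j is j'.+1 then (\sum_c (orbit_span b v j' c *m (T a c)^T) + (T a b *m v)^T)%MS else 0.

Lemma orbit_span_mono b v j a : (orbit_span b v j a <= orbit_span b v j.+1 a)%MS.
Proof.
elim: j a => [|j IH] a; first exact: sub0mx.
apply: addsmxS => //; apply: sumsmxS => c _; exact: submxMr (IH c).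
Qed.

Lemma orbit_span_kill b v j a (s : 'rV[R]_q) :
  (forall l (w : word), (l < j)%N -> lastl l.+1 b w = a -> s *m (Mprod T l.+1 b w *m v) = 0) ->
  orbit_span b v j a *m s^T = 0.
Proof.
elim: j a s => [|j IH] a s h; first by rewrite mul0mx.
apply/eqP; rewrite -submx0; apply: submx_trans (submxMr s^T (_ : _ <= _)%MS) _.
  exact: submx_refl.
rewrite addsmxMr addsmx_sub; apply/andP; split; last first.
  rewrite submx0 -trmx_mul trmx_eq0; apply/eqP.
  by have := h 0%N (fun=> a) (ltn0Sn j) erefl; rewrite /= mul1mx.
rewrite sumsmxMr_gen; apply/sumsmx_subP => c _; rewrite genmxE submx0 -mulmxA -trmx_mul; apply/eqP.
apply: IH => l w lj lc.
pose w' : word := fun t => if t == l.+1 then a else w t.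
have ww' t : (t < l.+1)%N -> w t = w' t by move=> tl; rewrite /w' ltn_eqF.
have := h l.+1 w' lj; rewrite MprodSr (_ : w' l.+1 = a); last by rewrite /w' eqxx.
rewrite (_ : lastl l.+1 b w' = c); last by rewrite -lc /= ww'.
rewrite -(Mprod_depends T b ww') !mulmxA; apply.
by rewrite /= /w' eqxx.
Qed.

(** The spans increase with word length inside a space of total dimension m.+1 * q, so they
    stabilise. A stable family is invariant, and invertibility equalises the ranks; irreducibility
    leaves only full rank, where a row annihilating the span is zero. *)
Lemma spanning_words : ~ trans_reducible -> forall b (v : 'cV[R]_q) a (s : 'rV[R]_q), v != 0 ->
  (forall l (w : word), (l < (m.+1 * q).+1)%N -> lastl l.+1 b w = a ->
     s *m (Mprod T l.+1 b w *m v) = 0) -> s = 0.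
Proof.
move=> irr b v a s v0 h; apply: contrapT => /eqP s0; apply: irr.
pose V := orbit_span b v.
have [j jle Vst] : exists2 j, (j <= m.+1 * q)%N & forall c, (V j.+1 c <= V j c)%MS.
  apply: contrapT => nst.
  (* Without stabilisation every step raises the total dimension by at least one. *)
  have grow j : (j <= (m.+1 * q).+1)%N -> (j <= \sum_c \rank (V j c))%N.
    elim: j => [//|j IH] jle; apply: leq_ltn_trans (IH (ltnW jle)) _.
    have [c hc] : exists c, ~~ (V j.+1 c <= V j c)%MS.
      apply: contrapT => hc; apply: nst; exists j => // c; apply: contrapT => h'.
      by apply: hc; exists c; apply/negP.
    rewrite (bigD1 c) //= [X in (_ < X)%N](bigD1 c) //= -addSn; apply: leq_add.
      by rewrite ltn_neqAle mxrankS ?orbit_span_mono // andbT (eqn_leq) mxrankS ?orbit_span_mono //=;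
        apply: contra hc => rk; have := mxrank_leqif_sup (orbit_span_mono b v j c) => -[_ <-];
        rewrite eqn_leq mxrankS ?orbit_span_mono.
    by apply: leq_sum => d _; rewrite mxrankS // orbit_span_mono.
  have ub : (\sum_c \rank (V (m.+1 * q).+1 c) <= m.+1 * q)%N.
    apply: leq_trans (_ : \sum_(c < m.+1) q <= _)%N; last by rewrite sum_nat_const card_ord.
    by apply: leq_sum => c _; exact: rank_leq_col.
  by have := leq_trans (grow _ (leqnn _)) ub; rewrite ltnn.
have Vkill : V j a *m s^T = 0.
  by apply: orbit_span_kill => l w lj; apply: h; rewrite (leq_trans lj) // ltnW // ltnS.
have TV c d : (V j d *m (T c d)^T <= V j c)%MS.
  apply: submx_trans (Vst c); apply: submx_trans (addsmxSl _ _).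
  exact: (sumsmx_sup d).
have uT c d : (T c d)^T \in unitmx by rewrite unitmx_tr.
have rkT c d : \rank (V j d *m (T c d)^T) = \rank (V j d).
  by rewrite mxrankMfree // row_free_unit.
have rkle c d : (\rank (V j d) <= \rank (V j c))%N by rewrite -(rkT c d) mxrankS.
have rkE c d : \rank (V j d) = \rank (V j c) by apply/eqP; rewrite eqn_leq !rkle.
have V0 c : V j c != 0.
  have : ((T c b *m v)^T <= V j c)%MS by apply: submx_trans (Vst c); exact: addsmxSr.
  apply: contraTneq => ->; rewrite submx0 trmx_eq0; apply: contra v0 => /eqP Tv.
  by rewrite -[v](mulKmx (T_unit c b)) Tv mulmx0.
exists (V j); split=> //; split=> [c|c d].
  rewrite (rkE a c) ltnNge; apply/negP => full; case/negP: s0.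
  have /row_fullP[B BV] : row_full (V j a) by rewrite /row_full eqn_leq rank_leq_col.
  by rewrite -[s]trmxK -[s^T]mul1mx -BV -mulmxA Vkill mulmx0 trmx0.
by have [_ <-] := mxrank_leqif_eq (TV c d); rewrite rkT (rkE c d) eqxx.
Qed.

End Spanning.

(** * Continuity and compactness *)

Section Compactness.
Variable R : realType.

Lemma fin_lower_bound n (c : 'I_n -> R) : (forall i, 0 < c i) -> exists2 c0 : R, 0 < c0 & forall i, c0 <= c i.
Proof.
move=> cp; exists (\big[Num.min/1]_(i < n) c i).
  by apply: lt_bigmin => // i _; exact: cp.
by move=> i; apply: bigmin_le_cond.
Qed.

Lemma continuous_sum (T : topologicalType) n (F : 'I_n -> T -> R) :
  (forall i, continuous (F i)) -> continuous (fun x => \sum_(i < n) F i x).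
Proof.
move=> h; apply: (@continuous_big _ _ _ _ xpredT) => [x|i _]; last exact: h.
exact: add_continuous.
Qed.

Lemma continuous_mul (T : topologicalType) (F G : T -> R) :
  continuous F -> continuous G -> continuous (fun x => F x * G x).
Proof. by move=> hF hG x; exact: cvgM (hF x) (hG x). Qed.

Lemma continuous_abs (T : topologicalType) (F : T -> R) :
  continuous F -> continuous (fun x => `|F x|).
Proof. by move=> hF x; exact: cvg_norm (hF x). Qed.

Lemma Ex_continuous (T : topologicalType) m (p : 'I_m.+1 -> R) n (F : T -> (nat -> letter m) -> R) :
  (forall w, continuous (fun z => F z w)) -> continuous (fun z => Ex p n (F z)).
Proof.
elim: n F => [|n IH] F h /=; first exact: h.
apply: continuous_sum => a; apply: continuous_mul; first exact: cst_continuous.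
by apply: (IH (fun z w => F z (scons a w))) => w; exact: h.
Qed.

(** The pair (v, r) is stored in one row of length q + q, so that a single closed bounded set
    carries both normalisations. *)
Lemma spheres_lower_bound q (f : 'rV[R]_(q + q) -> R) : (0 < q)%N -> continuous f ->
  (forall v r : 'rV[R]_q, v != 0 -> r != 0 -> 0 < f (row_mx v r)) ->
  exists2 c : R, 0 < c & forall v r : 'rV[R]_q, nrm v = 1 -> nrm r = 1 -> c <= f (row_mx v r).
Proof.
move=> q0 fc fpos.
pose nl (z : 'rV[R]_(q + q)) : R := \sum_(j < q) `|z 0 (lshift q j)|.
pose nr (z : 'rV[R]_(q + q)) : R := \sum_(j < q) `|z 0 (rshift q j)|.
have nlc : continuous nl.
  by apply: continuous_sum => j; apply: continuous_abs; exact: coord_continuous.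
have nrc : continuous nr.
  by apply: continuous_sum => j; apply: continuous_abs; exact: coord_continuous.
have nlE (v r : 'rV[R]_q) : nl (row_mx v r) = nrm v.
  by rewrite /nl /nrm big_ord1; apply: eq_bigr => j _; rewrite row_mxEl.
have nrE (v r : 'rV[R]_q) : nr (row_mx v r) = nrm r.
  by rewrite /nr /nrm big_ord1; apply: eq_bigr => j _; rewrite row_mxEr.
pose K : set 'rV[R]_(q + q) := nl @^-1` [set 1] `&` nr @^-1` [set 1].
have Kcl : closed K.
  by apply: closedI; apply: closed_comp => //; try (by move=> x _; exact: nlc || exact: nrc);
     exact: closed_eq.
have Kb : bounded_set K.
  exists 1; split; first exact: num_real.
  move=> M M1 z [/= z1 z2]; rewrite [leLHS]/Num.norm /= mx_normrE; apply: bigmax_le; first by rewrite (le_trans _ (ltW M1)).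
  move=> [i j] _ /=; rewrite ord1; apply: le_trans (ltW M1).
  case: (splitP j) => k ek.
    rewrite -z1 /nl (_ : j = lshift q k); last exact/val_inj.
    by rewrite (bigD1 k) //= lerDl; apply: sumr_ge0.
  rewrite -z2 /nr (_ : j = rshift q k); last exact/val_inj.
  by rewrite (bigD1 k) //= lerDl; apply: sumr_ge0.
have K0 : K !=set0.
  exists (row_mx (delta_mx 0 (Ordinal q0)) (delta_mx 0 (Ordinal q0))).
  by split; rewrite /= ?nlE ?nrE nrm_delta.
have [z zK zmin] := compact_EVT_min K0 (bounded_closed_compact Kb Kcl) (continuous_subspaceT fc).
rewrite inE in zK; have [/= z1 z2] := zK.
rewrite -[z]hsubmxK nlE in z1; rewrite -[z]hsubmxK nrE in z2.
exists (f z); first by rewrite -[z]hsubmxK; apply: fpos; rewrite -nrm_gt0 ?z1 ?z2 ltr01.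
by move=> v r v1 r1; apply: zmin; rewrite inE; split; rewrite /= ?nlE ?nrE.
Qed.

End Compactness.

(** * Lower bounds for averaged matrix coefficients *)

Section WordForms.
Variables (R : realType) (m : nat) (p : 'I_m.+1 -> R).
Hypotheses (p_pos : forall j, 0 < p j) (p_sum : \sum_j p j = 1).
Variable q : nat.
Local Notation word := (nat -> letter m).
Variable T : 'I_m.+1 -> 'I_m.+1 -> 'M[R]_q.

Lemma Ex_eq0 n (F : word -> R) : (forall w, 0 <= F w) -> depends n F -> Ex p n F = 0 -> forall w, F w = 0.
Proof.
elim: n F => [|n IH] F F0 Fn /=; first by move=> h w; rewrite -h; exact: Fn.
move=> /eqP; rewrite psumr_eq0; last first.
  by move=> a _; rewrite mulr_ge0 ?(ltW (p_pos a)) // (Ex_ge0 p_pos p_sum).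
move=> /allP h w; rewrite -[w]scons_wshift.
apply: (IH (fun w' => F (scons (w 0%N) w'))) => //; first exact: depends_scons.
have := h (w 0%N) (mem_index_enum _); rewrite mulf_eq0 gt_eqF //= => /eqP.
by [].
Qed.

Definition word_form J b a (v : 'cV[R]_q) (r : 'rV[R]_q) : R :=
  \sum_(l < J) Ex p l.+1 (fun w => ind R (fun w => lastl l.+1 b w = a) w *
                                   `|(r *m Mprod T l.+1 b w *m v) 0 0|).

(** Positive on nonzero pairs by [spanning_words], hence bounded below by compactness and
    homogeneity. Only words ending in the fixed letter a count, so that the same continuation can
    follow all of them. *)
Lemma word_form_lower_bound a : (forall a b, T a b \in unitmx) -> ~ trans_reducible T -> (0 < q)%N ->
  exists2 c : R, 0 < c & forall b (v : 'cV[R]_q) (r : 'rV[R]_q),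
    c * (nrm v * nrm r) <= word_form (m.+1 * q).+1 b a v r.
Proof.
move=> Tu irr q0; set J := (m.+1 * q).+1.
have term0 b l (v : 'cV[R]_q) (r : 'rV[R]_q) (w : word) : 0 <= ind R (fun w => lastl l.+1 b w = a) w * `|(r *m Mprod T l.+1 b w *m v) 0 0|.
  by rewrite mulr_ge0 ?ind_ge0.
have hb b : exists2 c : R, 0 < c & forall v r : 'rV[R]_q, nrm v = 1 -> nrm r = 1 ->
    c <= word_form J b a v^T r.
  pose f (z : 'rV[R]_(q + q)) := \sum_(l < J) Ex p l.+1 (fun w => ind R (fun w => lastl l.+1 b w = a) w *
      `|\sum_(j < q) (\sum_(k < q) z 0 (rshift q k) * Mprod T l.+1 b w k j) * z 0 (lshift q j)|).
  have fE v r : f (row_mx v r) = word_form J b a v^T r.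
    apply: eq_bigr => l _; apply: eq_Ex => w; congr (_ * `|_|); rewrite mxE; apply: eq_bigr => j _.
    by rewrite row_mxEl !mxE; congr (_ * _); apply: eq_bigr => k _; rewrite row_mxEr.
  have fc : continuous f.
    apply: continuous_sum => l; apply: Ex_continuous => w.
    apply: continuous_mul; first exact: cst_continuous.
    apply: continuous_abs; apply: continuous_sum => j.
    apply: continuous_mul; last exact: coord_continuous.
    apply: continuous_sum => k; apply: continuous_mul; last exact: cst_continuous.
    exact: coord_continuous.
  have [v r v0 r0|c c0 hc] := spheres_lower_bound q0 fc; last first.
    by exists c => // v r v1 r1; rewrite -fE; exact: hc.
  rewrite fE lt_neqAle; apply/andP; split; last first.
    by apply: sumr_ge0 => l _; apply: (Ex_ge0 p_pos p_sum) => w; exact: term0.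
  rewrite eq_sym; apply: contra r0 => /eqP S0; apply/eqP.
  apply: (spanning_words Tu irr (b := b) (v := v^T) (a := a)); first by rewrite trmx_eq0.
  move=> l w lJ lw.
  have hE : Ex p l.+1 (fun w => ind R (fun w => lastl l.+1 b w = a) w * `|(r *m Mprod T l.+1 b w *m v^T) 0 0|) = 0.
    exact: (psumr_eq0P (fun (i : 'I_J) _ => Ex_ge0 p_pos p_sum i.+1 (term0 b i v^T r)) S0 (i := Ordinal lJ)).
  have hd : depends l.+1 (fun w => ind R (fun w => lastl l.+1 b w = a) w * `|(r *m Mprod T l.+1 b w *m v^T) 0 0|).
    by move=> u u' uu'; rewrite (Mprod_depends T b uu') /ind /lastl (uu' l).
  have := Ex_eq0 (term0 b l v^T r) hd hE w.
  rewrite (ind1 R lw) mul1r => /normr0_eq0 h.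
  by rewrite mulmxA [LHS]mx11_scalar h raddf0.
have [c hc] := choice (fun b => let: ex_intro2 c c0 h := hb b in ex_intro _ c (conj c0 h)).
have [c0 c00 hc0] := fin_lower_bound (fun b => (hc b).1).
exists c0 => // b v r.
have [->|v0] := eqVneq v 0.
  rewrite nrm0 mul0r mulr0; apply: sumr_ge0 => l _.
  by apply: (Ex_ge0 p_pos p_sum) => w; exact: term0.
have [->|r0] := eqVneq r 0.
  rewrite nrm0 !mulr0; apply: sumr_ge0 => l _.
  by apply: (Ex_ge0 p_pos p_sum) => w; exact: term0.
have nv : 0 < nrm v by rewrite nrm_gt0.
have nr : 0 < nrm r by rewrite nrm_gt0.
pose v1 := ((nrm v)^-1 *: v)^T; pose r1 := (nrm r)^-1 *: r.
have v11 : nrm v1 = 1 by rewrite nrm_tr nrmZ gtr0_norm ?invr_gt0 // mulVf // gt_eqF.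
have r11 : nrm r1 = 1 by rewrite nrmZ gtr0_norm ?invr_gt0 // mulVf // gt_eqF.
have := le_trans (hc0 b) ((hc b).2 v1 r1 v11 r11).
have -> : word_form J b a v r = nrm v * nrm r * word_form J b a v1^T r1.
  rewrite /word_form mulr_sumr; apply: eq_bigr => l _; rewrite -ExZ; apply: eq_Ex => w.
  rewrite trmxK /r1 -!scalemxAl -scalemxAr !mxE.
  rewrite !normrM !normfV !(gtr0_norm nv) !(gtr0_norm nr); field.
  by rewrite !gt_eqF.
by move=> h; rewrite mulrC ler_wpM2l // mulr_ge0 // ltW.
Qed.

End WordForms.

(** * Relative growth stays away from zero *)

Section Gap.
Variables (R : realType) (m : nat) (p : 'I_m.+1 -> R).
Hypotheses (p_pos : forall j, 0 < p j) (p_sum : \sum_j p j = 1).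
Variable q : nat.
Local Notation word := (nat -> letter m).

Lemma exprn_small (r x : R) : 0 <= r -> r < 1 -> 0 < x -> exists n, forall k, (n <= k)%N -> r ^+ k <= x.
Proof.
move=> r0 r1 x0.
have := @cvg_geometric R 1 r; rewrite ger0_norm // => /(_ r1) /cvgrPdist_le /(_ x x0) [n _ h].
exists n => k nk; have := h k nk; rewrite /= mul1r sub0r normrN ger0_norm // exprn_ge0 //.
Qed.

Lemma Ex_exchange n k (G : word -> word -> R) :
  Ex p n (fun u => Ex p k (fun w => G u w)) = Ex p k (fun w => Ex p n (fun u => G u w)).
Proof.
elim: n G => [//|n IH] G; rewrite ExS.
rewrite [RHS](_ : _ = Ex p k (fun w => \sum_(a < m.+1) p a * Ex p n (fun u => G (scons a u) w))) //.
rewrite Ex_sum //; apply: eq_bigr => a _; rewrite ExZ; congr (_ * _).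
exact: (IH (fun u w => G (scons a u) w)).
Qed.

Lemma phi_mul_ge (M1 M2 : 'M[R]_q) (v : 'cV[R]_q) : M1 *m v != 0 -> M2 *m M1 != 0 -> v != 0 ->
  phi M2 (M1 *m v) * phi M1 v <= phi (M2 *m M1) v.
Proof.
move=> M1v M21 v0.
have M10 : M1 != 0 by apply: contra M1v => /eqP ->; rewrite mul0mx.
have M20 : M2 != 0 by apply: contra M21 => /eqP ->; rewrite mul0mx.
rewrite -!nrm_gt0 in M1v M21 v0 M10 M20.
rewrite (_ : phi M2 _ * _ = nrm (M2 *m M1 *m v) / (nrm M2 * nrm M1 * nrm v)); last first.
  by rewrite /phi mulmxA; field; rewrite !gt_eqF.
rewrite /phi ler_wpM2l ?nrm_ge0 // lef_pV2 ?posrE ?mulr_gt0 //.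
by rewrite ler_wpM2r ?nrm_ge0 // nrm_mul.
Qed.

Variables (Lam : R) (T : 'I_m.+1 -> 'I_m.+1 -> 'M[R]_q).
Hypotheses (Lam1 : 1 <= Lam) (hT : tame Lam T) (q_gt0 : (0 < q)%N).

Let Lam0 : 0 < Lam. Proof. exact: lt_le_trans Lam1. Qed.
Let Qp : 0 < q%:R :> R. Proof. by rewrite ltr0n. Qed.

Lemma tame_unit a b : T a b \in unitmx.
Proof.
rewrite -unitmx_tr -row_free_unit -kermx_eq0; apply/negPn/negP => /rowV0Pn[u uk u0].
have ut : T a b *m u^T = 0.
  by apply: trmx_inj; rewrite trmx_mul trmxK trmx0; apply/sub_kermxP.
have := hT.2 a b u^T; rewrite ut nrm0 mulr0 nrm_tr leNgt nrm_gt0 u0 //.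
Qed.

Lemma Mprod_nrm_le n b w : nrm (Mprod T n b w) <= q%:R * Lam ^+ n.
Proof.
rewrite nrm_cols mulr_natl -[X in _ *+ X]card_ord -sumr_const; apply: ler_sum => j _.
by apply: le_trans (tame_ub Lam1 hT n b w _) _; rewrite nrm_delta mulr1.
Qed.

Lemma Mprod_nonzero n b w : Mprod T n b w != 0.
Proof.
have e0 : (delta_mx (Ordinal q_gt0) 0 : 'cV[R]_q) != 0 by rewrite -nrm_gt0 nrm_delta.
by apply: contra (Mprod_neq0 Lam1 hT n b w e0) => /eqP ->; rewrite mul0mx.
Qed.

Lemma phi_Mprod_ge n b w (v : 'cV[R]_q) : v != 0 ->
  (q%:R * (Lam ^+ n) ^+ 2)^-1 <= phi (Mprod T n b w) v.
Proof.
move=> v0; have nv := v0; rewrite -nrm_gt0 in nv.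
have nM := Mprod_nonzero n b w; rewrite -nrm_gt0 in nM.
have Ln : 0 < Lam ^+ n by rewrite exprn_gt0.
rewrite /phi ler_pdivlMr ?mulr_gt0 // ler_pdivrMl ?mulr_gt0 ?exprn_gt0 //.
have h1 := ler_pM (ltW nM) (ltW nv) (Mprod_nrm_le n b w) (tame_lb Lam1 hT n b w v).
by apply: le_trans h1 _; rewrite le_eqVlt; apply/orP; left; apply/eqP; ring.
Qed.

Variable r : R.
Hypotheses (r0 : 0 < r) (r1 : r < 1).
Definition gap_event (n0 N : nat) b (w : word) : Prop :=
  forall n, (n0 <= n <= N)%N -> kap (Mprod T n b w) <= r ^+ n * nrm (Mprod T n b w) ^+ 2.
Hypothesis gap : forall eta : R, 0 < eta -> exists n0, forall N b,
  Prob p N (fun w => ~ gap_event n0 N b w) <= eta.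
Hypothesis irr : ~ trans_reducible T.

Definition stable_event (eps : R) (n1 N : nat) b (w : word) : Prop :=
  forall n (v : 'cV[R]_q), (n1 <= n <= N)%N -> v != 0 ->
    `|phi (Mprod T N b w) v - phi (Mprod T n b w) v| <= eps.

(** On the gap event the successive changes of [phi] are at most C r^k by [phi_step]; the tail of
    this geometric series is small from some time on, uniformly in v and N. *)
Lemma phi_stable (eps eta : R) : 0 < eps -> 0 < eta -> exists n1, forall N b,
  Prob p N (fun w => ~ stable_event eps n1 N b w) <= eta.
Proof.
move=> eps0 eta0; have [n0 hn0] := gap eta0.
have [C C0 hC] := @phi_step R q _ Lam1.
have r1' : 0 < 1 - r by rewrite subr_gt0.
pose C' := C / (1 - r).
have C'0 : 0 <= C' by rewrite divr_ge0 // ltW.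
have [n1 hn1] := @exprn_small r (eps / (C' + 1)) (ltW r0) r1 (divr_gt0 eps0 (ltr_wpDl C'0 ltr01)).
exists (maxn n0 n1) => N b; apply: le_trans (hn0 N b); apply: (Prob_le p_pos) => w; apply: contra_not => hg.
move=> n v /andP[nn nN] v0.
move: nn; rewrite geq_max => /andP[n0n n1n].
have tele k : (n <= k <= N)%N -> `|phi (Mprod T k b w) v - phi (Mprod T n b w) v| <= C' * (r ^+ n - r ^+ k).
  elim: k => [|k IH].
    by rewrite leqn0 => /andP[/eqP -> _]; rewrite !subrr normr0 mulr0.
  rewrite leq_eqVlt => /andP[/orP[/eqP <- _|nk kN]]; first by rewrite !subrr normr0 mulr0.
  rewrite ltnS in nk.
  have h1 := IH (introT andP (conj nk (ltnW kN))).
  have h2 : `|phi (Mprod T k.+1 b w) v - phi (Mprod T k b w) v| <= C * r ^+ k.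
    rewrite MprodSr; apply: hC => //.
    - by apply: hg; rewrite (leq_trans n0n nk) ltnW.
    - by rewrite exprn_ile1 // ltW.
    - exact: Mprod_nonzero.
    - exact: hT.1.
    - move=> x; apply: le_trans (_ : \sum_j nrm (x *m delta_mx j (0 : 'I_1)) <= _); first by rewrite -nrm_cols.
      rewrite [X in _ * X]nrm_cols mulr_sumr; apply: ler_sum => j _.
      by rewrite -mulmxA; exact: hT.2.
  have -> : phi (Mprod T k.+1 b w) v - phi (Mprod T n b w) v =
     (phi (Mprod T k.+1 b w) v - phi (Mprod T k b w) v) + (phi (Mprod T k b w) v - phi (Mprod T n b w) v) by ring.
  apply: le_trans (ler_normD _ _) _; apply: le_trans (lerD h2 h1) _.
  rewrite le_eqVlt; apply/orP; left; apply/eqP; rewrite /C' exprS; field.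
  by rewrite gt_eqF.
apply: le_trans (tele N _) _; first by rewrite nN leqnn.
apply: le_trans (_ : C' * r ^+ n <= _).
  by rewrite ler_wpM2l // lerBlDr lerDl exprn_ge0 // ltW.
have h := hn1 n n1n; rewrite ler_pdivlMr ?ltr_wpDl // in h.
by have := exprn_ge0 n (ltW r0); lra.
Qed.

(** For a fixed continuation, averaging over short prefixes bounds the relative growth below:
    [word_form] is applied to each row of the continuation. Stability transfers this from time l.+1
    + N back to time N. *)
Lemma mean_phi : exists2 c1 : R, 0 < c1 & exists N1, forall N b (v : 'cV[R]_q), (N1 <= N)%N -> v != 0 ->
  c1 <= Ex p N (fun w => phi (Mprod T N b w) v).
Proof.
have [c c0 hc] := word_form_lower_bound p_pos p_sum ord0 tame_unit irr q_gt0.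
set J := (m.+1 * q).+1 in hc.
pose D := q%:R * Lam ^+ J * J%:R.
have J0 : 0 < J%:R :> R by rewrite ltr0n.
have D0 : 0 < D by rewrite !mulr_gt0 // exprn_gt0.
(* Then c = 4 D eps; losing 2 eps through stability leaves half of the bound c / D. *)
pose eps := c / (4 * D).
have eps0 : 0 < eps by rewrite divr_gt0 // mulr_gt0.
have [n1 hn1] := phi_stable eps0 eps0.
exists (c / (2 * D)); first by rewrite divr_gt0 // mulr_gt0.
exists n1 => N b v n1N v0.
have nv := v0; rewrite -nrm_gt0 in nv.
set X := Ex p N _.
pose Y l := Ex p (l.+1 + N) (fun w => phi (Mprod T (l.+1 + N) b w) v).
(* One eps is the change of [phi] on the stable event, the other is the probability of the
   complement, where [phi] is at most 1. *)
have YX l : Y l <= X + 2 * eps.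
  have -> : X = Ex p (l.+1 + N) (fun w => phi (Mprod T N b w) v).
    apply/esym/(Ex_depends p_sum); first exact: leq_addl.
    by move=> w w' ww'; rewrite (Mprod_depends T b ww').
  apply: le_trans (_ : Ex p (l.+1 + N) (fun w => (phi (Mprod T N b w) v + eps) +
     ind R (fun w => ~ stable_event eps n1 (l.+1 + N) b w) w) <= _).
    apply: (Ex_le p_pos) => w; have [st|nst] := pselect (stable_event eps n1 (l.+1 + N) b w).
      have := st N v; rewrite n1N leq_addl => /(_ isT v0); rewrite ler_norml => /andP[_ h].
      by have := @ind_ge0 R m (fun w => ~ stable_event eps n1 (l.+1 + N) b w) w; lra.
    rewrite (ind1 R nst); have := phi_le1 (Mprod T (l.+1 + N) b w) v.
    by have := phi_ge0 (Mprod T N b w) v; lra.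
  rewrite !ExD Ex_cst //; have := hn1 (l.+1 + N)%N b; rewrite /Prob; lra.
have main : c <= q%:R * Lam ^+ J * \sum_(l < J) Y l.
  have pw (w' : word) : c <= q%:R * Lam ^+ J * \sum_(l < J) Ex p l.+1 (fun u => phi (Mprod T (l.+1 + N) b (pcat l.+1 u w')) v).
    set M := Mprod T N ord0 w'.
    have nM : 0 < nrm M by rewrite nrm_gt0 Mprod_nonzero.
    have h1 : c * (nrm v * nrm M) <= \sum_(l < J) Ex p l.+1 (fun u => ind R (fun w => lastl l.+1 b w = ord0) u *
        nrm (M *m Mprod T l.+1 b u *m v)).
      have -> : c * (nrm v * nrm M) = \sum_(i < q) c * (nrm v * nrm (row i M)).
        rewrite -mulr_sumr -mulr_sumr; congr (_ * (_ * _)); apply: eq_bigr => i _.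
        by rewrite /nrm big_ord1; apply: eq_bigr => j _; rewrite mxE.
      apply: le_trans (ler_sum _ (fun i _ => hc b v (row i M))) _.
      rewrite /word_form exchange_big; apply: ler_sum => l _.
      rewrite -Ex_sum //; apply: (Ex_le p_pos) => u; rewrite -mulr_sumr ler_wpM2l ?ind_ge0 //.
      rewrite nrm_colE; apply: ler_sum => i _.
      by rewrite -row_mul -row_mul mxE.
    rewrite -(ler_pM2r (mulr_gt0 nv nM)); apply: le_trans h1 _.
    rewrite mulr_sumr mulr_suml; apply: ler_sum => l _; rewrite mulrC -!ExZ.
    apply: (Ex_le p_pos) => u.
    have [la|la] := pselect (lastl l.+1 b u = ord0); last first.
      rewrite (ind0 R la) mul0r.
      by do ![exact: nrm_ge0 | exact: phi_ge0 | exact: ltW | apply: exprn_ge0 | apply: mulr_ge0].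
    rewrite (ind1 R la) mul1r MprodD wshift_pcat lastl_pcat la Mprod_pcat -/M.
    set M1 := Mprod T l.+1 b u.
    have nMM : 0 < nrm (M *m M1).
      have := Mprod_nonzero (l.+1 + N) b (pcat l.+1 u w').
      by rewrite MprodD wshift_pcat lastl_pcat la Mprod_pcat -nrm_gt0.
    have -> : nrm (M *m M1 *m v) = phi (M *m M1) v * (nrm (M *m M1) * nrm v).
      by rewrite /phi divfK // gt_eqF // mulr_gt0.
    have h2 : nrm (M *m M1) <= nrm M * (q%:R * Lam ^+ J).
      apply: le_trans (nrm_mul _ _) _; rewrite ler_wpM2l ?nrm_ge0 //.
      apply: le_trans (Mprod_nrm_le _ _ _) _; rewrite ler_wpM2l //.
      by apply: ler_weXn2l.
    have h3 := ler_wpM2r (ltW nv) h2.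
    have h4 := ler_wpM2l (phi_ge0 (M *m M1) v) h3.
    by apply: le_trans h4 _; rewrite le_eqVlt; apply/orP; left; apply/eqP; ring.
  rewrite -(Ex_cst p_sum N c); apply: le_trans (Ex_le p_pos N pw) _.
  rewrite ExZ Ex_sum // le_eqVlt; apply/orP; left; apply/eqP; congr (_ * _).
  by apply: eq_bigr => l _; rewrite /Y Ex_pcat Ex_exchange.
have h : c <= q%:R * Lam ^+ J * (J%:R * (X + 2 * eps)).
  apply: le_trans main _; apply: ler_wpM2l; first by rewrite mulr_ge0 // exprn_ge0 // ltW.
  apply: (@le_trans _ _ (\sum_(l < J) (X + 2 * eps))); first by apply: ler_sum => l _; exact: YX.
  by rewrite sumr_const card_ord -[leLHS]mulr_natl.
have e : c = 4 * D * eps by rewrite /eps mulrC divfK // gt_eqF // mulr_gt0.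
rewrite ler_pdivrMr; last by apply: mulr_gt0.
by move: h; rewrite e /D; lra.
Qed.

(** Since [phi] is at most 1 and has mean at least c1, it reaches c1 / 2 with probability at least
    c1 / 2. *)
Lemma prob_phi_lt1 : exists (delta q0 : R) N1, [/\ 0 < delta, 0 <= q0, q0 < 1 & forall N b (v : 'cV[R]_q),
  (N1 <= N)%N -> v != 0 -> Prob p N (fun w => phi (Mprod T N b w) v < delta) <= q0].
Proof.
have [c1 c10 [N1 hN1]] := mean_phi.
have h N b (v : 'cV[R]_q) : (N1 <= N)%N -> v != 0 ->
    Prob p N (fun w => phi (Mprod T N b w) v < c1 / 2) <= 1 - c1 / 2.
  move=> NN v0; have := hN1 N b v NN v0.
  have : Ex p N (fun w => phi (Mprod T N b w) v) <= c1 / 2 + 1 - Prob p N (fun w => phi (Mprod T N b w) v < c1 / 2).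
    rewrite -(Ex_cst p_sum N (c1 / 2 + 1)) -ExB; apply: (Ex_le p_pos) => w.
    have [lt|ge] := ltP (phi (Mprod T N b w) v) (c1 / 2).
      by rewrite (ind1 R) //; lra.
    rewrite (ind0 R); last by rewrite /= ltNge ge.
    by have := phi_le1 (Mprod T N b w) v; lra.
  lra.
exists (c1 / 2), (1 - c1 / 2), N1; split => //; first lra; last lra.
have e0 : (delta_mx (Ordinal q_gt0) 0 : 'cV[R]_q) != 0 by rewrite -nrm_gt0 nrm_delta.
by apply: le_trans (h N1 ord0 _ (leqnn _) e0); apply: (Prob_ge0 p_pos p_sum).
Qed.

(* Zero-one mechanism: after n steps the event is essentially decided, while
   from the new starting vector it has conditional probability at most q0. *)
Lemma prob_phi_small (eta : R) : 0 < eta -> exists2 delta : R, 0 < delta & exists N1, forall N b (v : 'cV[R]_q),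
  (N1 <= N)%N -> v != 0 -> Prob p N (fun w => phi (Mprod T N b w) v < delta) <= eta.
Proof.
have [d1 [q0 [N1 [d10 q00 q01 hN1]]]] := prob_phi_lt1.
pose h N d b v := Prob p N (fun w => phi (Mprod T N b w) v < d).
have step (e et : R) : 0 < e -> 0 < et -> exists2 delta : R, 0 < delta & exists N2, forall N b (v : 'cV[R]_q),
    (N2 <= N)%N -> v != 0 -> h N delta b v <= q0 * h N e b v + et.
  move=> e0 et0.
  have e30 : 0 < e / 3 by rewrite divr_gt0.
  have et20 : 0 < et / 2 by rewrite divr_gt0.
  have [n hn] := phi_stable e30 et20.
  pose g : R := (q%:R * (Lam ^+ n) ^+ 2)^-1.
  have g0 : 0 < g by rewrite invr_gt0 mulr_gt0 // !exprn_gt0.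
  (* The first bound leaves room for the stability error. The second uses that the first n factors
     give relative growth at least g, so growth below d1 g at time N forces growth below d1 from the
     new vector. *)
  pose delta := Num.min (e / 3) (d1 * g).
  exists delta; first by rewrite lt_min e30 mulr_gt0.
  exists (n + N1)%N => N b v NN v0.
  (* An intermediate threshold decided by n letters: up to instability, being below delta at time N
     implies G, and G implies being below e at time N. *)
  pose G (w : word) := phi (Mprod T n b w) v < 2 * (e / 3).
  pose S (w : word) := ~ stable_event (e / 3) n N b w.
  have nN : (n <= N)%N by apply: leq_trans NN; exact: leq_addr.
  have Gdep : depends n (ind R G).
    by move=> w w' ww'; rewrite /ind /G (Mprod_depends T b ww').
  have s1 : h N delta b v <= Prob p N (fun w => G w /\ phi (Mprod T N b w) v < delta) + Prob p N S.
    apply: le_trans (ProbU p_pos N _ _); apply: (Prob_le p_pos) => w hw.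
    have [st|nst] := pselect (stable_event (e / 3) n N b w); last by right.
    left; split=> //; rewrite /G; have := st n v; rewrite leqnn nN => /(_ isT v0).
    rewrite ler_norml => /andP[h1 _].
    have : delta <= e / 3 by rewrite ge_min lexx.
    lra.
  have s2 : Prob p N G <= h N e b v + Prob p N S.
    apply: le_trans (ProbU p_pos N _ _); apply: (Prob_le p_pos) => w; rewrite /G => hw.
    have [st|nst] := pselect (stable_event (e / 3) n N b w); last by right.
    left; have := st n v; rewrite leqnn nN => /(_ isT v0).
    rewrite ler_norml => /andP[_ h2]; lra.
  have s3 : Prob p N (fun w => G w /\ phi (Mprod T N b w) v < delta) <= q0 * Prob p N G.
    rewrite /Prob [X in _ <= q0 * X](Ex_depends p_sum nN Gdep) -ExZ.
    rewrite -{1}(subnKC nN) Ex_pcat; apply: (Ex_le p_pos) => u.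
    have [Gu|nGu] := pselect (G u); last first.
      rewrite (ind0 R nGu) mulr0 -[leRHS](Ex_cst p_sum (N - n)); apply: (Ex_le p_pos) => w.
      by rewrite (ind0 R) // /G Mprod_pcat => -[].
    rewrite (ind1 R Gu) mulr1.
    have Mv0 : Mprod T n b u *m v != 0 by exact: (Mprod_neq0 Lam1 hT).
    have NnN : (N1 <= N - n)%N by rewrite leq_subRL // (leq_trans NN).
    apply: le_trans (hN1 (N - n)%N (lastl n b u) _ NnN Mv0).
    apply: (Prob_le p_pos) => w [_].
    rewrite -{1}(subnKC nN) MprodD wshift_pcat lastl_pcat Mprod_pcat => hw.
    have := phi_mul_ge Mv0 _ v0 => /(_ (Mprod T (N - n) (lastl n b u) w)).
    have nz : Mprod T (N - n) (lastl n b u) w *m Mprod T n b u != 0.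
      have := Mprod_nonzero (n + (N - n)) b (pcat n u w).
      by rewrite MprodD wshift_pcat lastl_pcat Mprod_pcat.
    move=> /(_ nz) h1.
    have h2 := phi_Mprod_ge n b u v0.
    have h3 : delta <= d1 * g by rewrite ge_min lexx orbT.
    have h4 := ler_wpM2l (phi_ge0 (Mprod T (N - n) (lastl n b u) w) (Mprod T n b u *m v)) h2.
    rewrite -(ltr_pM2r g0); apply: le_lt_trans h4 _; apply: le_lt_trans h1 _.
    exact: lt_le_trans hw h3.
  have s4 := hn N b; rewrite -/S in s4.
  have := ler_wpM2l q00 s2; have : q0 * Prob p N S <= Prob p N S.
    by rewrite ler_piMl ?(ltW q01) // (Prob_ge0 p_pos p_sum).
  lra.
have iter (j : nat) (et : R) : 0 < et -> exists2 delta : R, 0 < delta & exists N2, forall N b (v : 'cV[R]_q),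
    (N2 <= N)%N -> v != 0 -> h N delta b v <= q0 ^+ j + j%:R * et.
  move=> et0; elim: j => [|j [d d0 [N2 hN2]]].
    exists 1 => //; exists 0%N => N b v _ _; rewrite expr0 mul0r addr0.
    by rewrite -(Ex_cst p_sum N 1); apply: (Ex_le p_pos) => w; exact: ind_le1.
  have [d' d'0 [N3 hN3]] := step d et d0 et0.
  exists d' => //; exists (maxn N2 N3) => N b v; rewrite geq_max => /andP[NN2 NN3] v0.
  apply: le_trans (hN3 N b v NN3 v0) _; have := ler_wpM2l q00 (hN2 N b v NN2 v0).
  have : q0 * (j%:R * et) <= j%:R * et.
    by rewrite ler_piMl ?(ltW q01) // mulr_ge0 // ltW.
  by rewrite exprS -[j.+1%:R]natr1; lra.
move=> eta0; have [j hj] := exprn_small q00 q01 (divr_gt0 eta0 (ltr0n R 2)).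
have j0 : 0 < 2 * j.+1%:R :> R by rewrite mulr_gt0.
have [d d0 [N2 hN2]] := iter j _ (divr_gt0 eta0 j0).
exists d => //; exists N2 => N b v NN v0; apply: le_trans (hN2 N b v NN v0) _.
have : j%:R * (eta / (2 * j.+1%:R)) <= eta / 2.
  rewrite mulrA ler_pdivrMr // mulrC.
  rewrite [leRHS](_ : _ = eta * j.+1%:R); last by field.
  by rewrite ler_wpM2l ?(ltW eta0) // ler_nat.
by move=> h1; apply: le_trans (lerD (hj j (leqnn j)) h1) _; lra.
Qed.

End Gap.

(** * Averaged contraction and its stability *)

Section Openness.
Variables (R : realType) (m : nat) (p : 'I_m.+1 -> R).
Hypotheses (p_pos : forall j, 0 < p j) (p_sum : \sum_j p j = 1).
Variable q : nat.
Local Notation word := (nat -> letter m).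
Local Notation trans := ('I_m.+1 -> 'I_m.+1 -> 'M[R]_q).

Lemma powR_subadditive (x y al : R) : 0 <= x -> 0 <= y -> 0 < al -> al <= 1 ->
  (x + y) `^ al <= x `^ al + y `^ al.
Proof.
move=> x0 y0 al0 al1; set s := x + y.
have [->|sn0] := eqVneq s 0.
  by rewrite powR0 ?gt_eqF // addr_ge0 ?powR_ge0.
have s0 : 0 < s by rewrite lt_neqAle eq_sym sn0 addr_ge0.
have h z : 0 <= z -> z <= s -> z / s * s `^ al <= z `^ al.
  move=> z0 zs; have [->|zn0] := eqVneq z 0; first by rewrite !mul0r powR_ge0.
  have zp : 0 < z by rewrite lt_neqAle eq_sym zn0.
  have -> : z `^ al = (z / s) `^ al * s `^ al.
    by rewrite -powRM ?divr_ge0 ?(ltW s0) // divfK.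
  rewrite ler_wpM2r ?powR_ge0 // ger1_powR // divr_gt0 //=.
  by rewrite ler_pdivrMr // mul1r.
have hx := h x x0 _; have hy := h y y0 _.
have := hx (_ : x <= s); rewrite lerDl => /(_ y0) h1.
have := hy (_ : y <= s); rewrite lerDr => /(_ x0) h2.
have e : s `^ al = x / s * s `^ al + y / s * s `^ al.
  by rewrite -mulrDl -mulrDl divff // mul1r.
by rewrite e lerD.
Qed.

Lemma tame_perturb (Lam : R) (T T' : trans) : 1 <= Lam -> tame Lam T ->
  (forall a b, nrm (T' a b - T a b) <= (2 * Lam)^-1) -> tame (2 * Lam) T'.
Proof.
move=> Lam1 [h1 h2] hd.
have Lam0 : 0 < Lam by apply: lt_le_trans Lam1.
have i1 : (2 * Lam)^-1 <= 1 by rewrite invf_le1 ?mulr_gt0 //; lra.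
split=> [a b|a b v].
  have := nrmD (T' a b - T a b) (T a b); rewrite subrK.
  have := h1 a b; have := hd a b; lra.
have := h2 a b v; have := nrmD ((T a b - T' a b) *m v) (T' a b *m v).
rewrite -mulmxDl subrK => a1 a2.
have a3 : nrm ((T a b - T' a b) *m v) <= (2 * Lam)^-1 * nrm v.
  by apply: le_trans (nrm_mul _ _) _; rewrite ler_wpM2r ?nrm_ge0 // nrm_sub_sym.
have a4 : Lam * ((2 * Lam)^-1 * nrm v) = nrm v / 2 by field; rewrite gt_eqF.
have := ler_wpM2l (ltW Lam0) a1; have := ler_wpM2l (ltW Lam0) a3; rewrite a4; lra.
Qed.

Lemma tame_weaken (Lam Lam' : R) (T : trans) : Lam <= Lam' -> tame Lam T -> tame Lam' T.
Proof.
move=> LL [h1 h2]; split=> [a b|a b v]; first exact: le_trans (h1 a b) LL.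
by apply: le_trans (h2 a b v) _; rewrite ler_wpM2r ?nrm_ge0.
Qed.

Lemma Mprod_lip (L : R) n : 1 <= L -> exists2 C : R, 0 <= C & forall (T T' : trans) d,
  tame L T -> tame L T' -> 0 <= d -> (forall a b, nrm (T' a b - T a b) <= d) ->
  forall b w, nrm (Mprod T' n b w - Mprod T n b w) <= C * d.
Proof.
move=> L1; have L0 : 0 <= L by exact: le_trans L1.
elim: n => [|n [C C0 IH]]; first by exists 0 => // T T' d *; rewrite subrr nrm0 mul0r.
exists (C * L + q%:R * L ^+ n).
  by apply: addr_ge0; apply: mulr_ge0 => //; exact: exprn_ge0.
move=> T T' d hT hT' d0 hd b w /=.
set M := Mprod T n _ _; set M' := Mprod T' n _ _.
have -> : M' *m T' (w 0%N) b - M *m T (w 0%N) b = (M' - M) *m T' (w 0%N) b + M *m (T' (w 0%N) b - T (w 0%N) b).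
  by rewrite mulmxBl mulmxBr addrA subrK.
apply: le_trans (nrmD _ _) _.
have h1 : nrm ((M' - M) *m T' (w 0%N) b) <= C * d * L.
  by apply: le_trans (nrm_mul _ _) _; apply: ler_pM; rewrite ?nrm_ge0 ?IH // hT'.1.
have h2 : nrm (M *m (T' (w 0%N) b - T (w 0%N) b)) <= q%:R * L ^+ n * d.
  apply: le_trans (nrm_mul _ _) _; apply: ler_pM; rewrite ?nrm_ge0 //.
  exact: (Mprod_nrm_le L1 hT).
lra.
Qed.

(** The Lipschitz constant is uniform in the letter, the vector and the word, which makes averaged
    contraction an open condition on T. *)
Lemma expansion_lip (L : R) n : 1 <= L -> exists2 C : R, 0 <= C & forall (T T' : trans) d,
  tame L T -> tame L T' -> 0 <= d -> (forall a b, nrm (T' a b - T a b) <= d) ->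
  forall b (v : 'cV[R]_q) w, v != 0 -> expansion T' n b v w <= expansion T n b v w + C * d.
Proof.
move=> L1; have L0 : 0 <= L by exact: le_trans L1.
have [C C0 hC] := @Mprod_lip L n L1.
pose A := L ^+ n; pose B := q%:R * A.
have A0 : 0 <= A by exact: exprn_ge0.
have B0 : 0 <= B by rewrite mulr_ge0.
pose G := 4 * q%:R ^+ 4 * B * A ^+ 2 + 2 * B ^+ 2 * A ^+ 2 * (2 * A).
have G0 : 0 <= G.
  by do ![done | apply: exprn_ge0 | apply: addr_ge0 | apply: mulr_ge0].
exists (G * C); first exact: mulr_ge0.
move=> T T' d hT hT' d0 hd b v w v0.
have he := hC T T' d hT hT' d0 hd b w.
set M := Mprod T n b w in he *; set M' := Mprod T' n b w in he *.
rewrite /expansion -/M -/M'.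
have nv : 0 < nrm v by rewrite nrm_gt0.
have Mv : 0 < nrm (M *m v) by rewrite nrm_gt0; exact: (Mprod_neq0 L1 hT).
have M'v : 0 < nrm (M' *m v) by rewrite nrm_gt0; exact: (Mprod_neq0 L1 hT').
set X := nrm v / nrm (M *m v); set Y := nrm v / nrm (M' *m v).
have eX : kap M * nrm v ^+ 2 / nrm (M *m v) ^+ 2 = kap M * X ^+ 2.
  by rewrite /X; field; rewrite gt_eqF.
have eY : kap M' * nrm v ^+ 2 / nrm (M' *m v) ^+ 2 = kap M' * Y ^+ 2.
  by rewrite /Y; field; rewrite gt_eqF.
rewrite eX eY.
have X0 : 0 <= X by rewrite divr_ge0 ?nrm_ge0.
have Y0 : 0 <= Y by rewrite divr_ge0 ?nrm_ge0.
have XA : X <= A by rewrite ler_pdivrMr //; exact: (tame_lb L1 hT).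
have YA : Y <= A by rewrite ler_pdivrMr //; exact: (tame_lb L1 hT').
have MB : nrm M <= B by exact: (Mprod_nrm_le L1 hT).
have M'B : nrm M' <= B by exact: (Mprod_nrm_le L1 hT').
set e := nrm (M' - M) in he.
have e0 : 0 <= e by exact: nrm_ge0.
have hk := kap_lip M'B MB; rewrite -/e in hk.
have YX : Y - X <= e * A ^+ 2.
  have -> : Y - X = (nrm (M *m v) - nrm (M' *m v)) / nrm v * (X * Y).
    by rewrite /X /Y; field; rewrite !gt_eqF.
  have h : (nrm (M *m v) - nrm (M' *m v)) / nrm v <= e.
    rewrite ler_pdivrMr //; apply: le_trans (ler_norm _) _; apply: le_trans (nrm_dist _ _) _.
    by rewrite -mulmxBl /e nrm_sub_sym nrm_mul.
  apply: le_trans (ler_wpM2r (mulr_ge0 X0 Y0) h) _.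
  by rewrite ler_wpM2l // expr2 ler_pM.
have k2 : kap M <= 2 * B ^+ 2.
  by apply: le_trans (kap_le _) _; rewrite ler_wpM2l // lerXn2r ?nnegrE ?nrm_ge0.
have t1 : (kap M' - kap M) * Y ^+ 2 <= 4 * q%:R ^+ 4 * B * e * A ^+ 2.
  apply: le_trans (_ : `|kap M' - kap M| * Y ^+ 2 <= _).
    by rewrite ler_wpM2r ?sqr_ge0 // ler_norm.
  by apply: ler_pM; rewrite ?sqr_ge0 // lerXn2r ?nnegrE.
have t2 : kap M * ((Y - X) * (Y + X)) <= 2 * B ^+ 2 * (e * A ^+ 2 * (2 * A)).
  have s0 : 0 <= Y + X by rewrite addr_ge0.
  have s1 : (Y - X) * (Y + X) <= e * A ^+ 2 * (2 * A).
    apply: le_trans (ler_wpM2r s0 YX) _.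
    by rewrite ler_wpM2l ?mulr_ge0 ?sqr_ge0 //; lra.
  apply: le_trans (ler_wpM2l (kap_ge0 _) s1) _.
  by rewrite ler_wpM2r // mulr_ge0 ?mulr_ge0 ?sqr_ge0.
have -> : kap M' * Y ^+ 2 = kap M * X ^+ 2 + ((kap M' - kap M) * Y ^+ 2 + kap M * ((Y - X) * (Y + X))) by ring.
rewrite lerD2l; apply: le_trans (lerD t1 t2) _.
have := ler_wpM2l G0 he; rewrite /G; lra.
Qed.

Variables (Lam : R) (T : trans).
Hypotheses (Lam1 : 1 <= Lam) (hT : tame Lam T) (q_gt0 : (0 < q)%N).
Variable r : R.
Hypotheses (r0 : 0 < r) (r1 : r < 1).
Hypothesis gap : forall eta : R, 0 < eta -> exists n0, forall N b,
  Prob p N (fun w => ~ gap_event T r n0 N b w) <= eta.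
Hypothesis irr : ~ trans_reducible T.

Lemma contraction_open : exists n (al kp delta : R),
  [/\ (0 < n)%N, 0 < al, al <= 1, kp < 1 & 0 < delta /\ delta <= 1] /\
  forall T' : trans, (forall a b, nrm (T' a b - T a b) <= delta) -> admissible p (2 * Lam) n al kp T'.
Proof.
have Lam0 : 0 < Lam by apply: lt_le_trans Lam1.
have Q1 : 1 <= q%:R :> R by rewrite ler1n.
have Q0 : 0 < q%:R :> R by rewrite ltr0n.
(* The bound for the expansion per letter, valid for every word: [kap M] is at most 2 (q Lam^n)^2,
   and the lower bound on M v gives two more powers of Lam^n. *)
pose B : R := 2 * q%:R ^+ 2 * Lam ^+ 4.
have B2 : 2 <= B.
  rewrite /B -mulrA ler_peMr // mulr_ege1 // exprn_ege1 //.
have B0 : 0 < B by lra.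
pose s := Num.sqrt r.
have ss : s ^+ 2 = r by rewrite sqr_sqrtr // ltW.
have s0 : 0 < s by rewrite sqrtr_gt0.
have s1 : s < 1 by rewrite -(@ltr_pXn2r _ 2) ?nnegrE ?(ltW s0) // ss expr1n.
have lnB : 0 < ln B by rewrite ln_gt0 //; lra.
have ln2 : 0 < ln (2 : R) by rewrite ln_gt0 //; lra.
have ln2B : ln 2 <= ln B by rewrite ler_ln ?posrE.
have lns : ln s < 0 by rewrite -ln1 ltr_ln ?posrE.
pose theta := expR (ln 2 * ln s / ln B).
have th0 : 0 < theta by exact: expR_gt0.
have th1 : theta < 1.
  by rewrite expR_lt1 pmulr_llt0 ?invr_gt0 // pmulr_rlt0.
(* Two bad events, each weighted by 2, cost 4 eta = (1 - theta) / 4, and the perturbation eps costs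
   the same; the total is (1 + theta) / 2. *)
pose eta := (1 - theta) / 16.
have eta0 : 0 < eta by rewrite divr_gt0 // subr_gt0.
have [d d0 [N1 hN1]] := prob_phi_small p_pos p_sum Lam1 hT q_gt0 r0 r1 gap irr eta0.
have [n0 hn0] := gap eta0.
have d20 : 0 < d ^+ 2 by rewrite exprn_gt0.
(* Good words have expansion at most r^n / d^2 = s^n (s^n / d^2), so s^n <= d^2 leaves s^n. *)
have [n2 hn2] := exprn_small (ltW s0) s1 d20.
pose n := (maxn 1 (maxn N1 (maxn n0 n2)))%N.
have n_gt0 : (0 < n)%N by rewrite leq_max.
have nN1 : (N1 <= n)%N by rewrite !leq_max leqnn !orbT.
have nn0 : (n0 <= n)%N by rewrite !leq_max leqnn !orbT.
have nn2 : (n2 <= n)%N by rewrite !leq_max leqnn !orbT.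
have n0' : 0 < n%:R :> R by rewrite ltr0n.
have n1' : 1 <= n%:R :> R by rewrite ler1n.
pose al := ln 2 / (n%:R * ln B).
have al0 : 0 < al by rewrite divr_gt0 // mulr_gt0.
have al1 : al <= 1.
  rewrite ler_pdivrMr ?mulr_gt0 // mul1r; apply: le_trans ln2B _.
  by rewrite ler_peMl // ltW.
have Bal : (B ^+ n) `^ al = 2.
  rewrite /powR gt_eqF ?exprn_gt0 // lnXn // -[ln B *+ n]mulr_natl /al divfK; last first.
    by rewrite gt_eqF // mulr_gt0.
  by rewrite lnK // posrE.
have sal : (s ^+ n) `^ al = theta.
  rewrite /powR gt_eqF ?exprn_gt0 // lnXn // -[ln s *+ n]mulr_natl /al /theta; congr expR.
  by field; rewrite !gt_eqF.
pose eps := ((1 - theta) / 4) `^ al^-1.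
have t4 : 0 < (1 - theta) / 4 by rewrite divr_gt0 // subr_gt0.
have eps0 : 0 < eps by exact: powR_gt0.
have epsal : eps `^ al = (1 - theta) / 4.
  by rewrite /eps -powRrM mulVf ?gt_eqF // powRr1 // ltW.
have L21 : 1 <= 2 * Lam by move: Lam1; lra.
have [C C0 hC] := @expansion_lip (2 * Lam) n L21.
pose delta := Num.min (2 * Lam)^-1 (eps / (C + 1)).
have C10 : 0 < C + 1 by rewrite ltr_wpDl.
have delta0 : 0 < delta by rewrite lt_min invr_gt0 mulr_gt0 // divr_gt0.
have deltaL : delta <= (2 * Lam)^-1 by rewrite ge_min lexx.
exists n, al, ((1 + theta) / 2), delta; split.
  split=> //; first lra.
  split=> //; apply: le_trans deltaL _; rewrite invf_le1 ?mulr_gt0 //.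
move=> T' hd.
have hT2 : tame (2 * Lam) T by apply: tame_weaken hT; move: Lam1; lra.
have hT' : tame (2 * Lam) T'.
  by apply: (tame_perturb Lam1 hT) => a b; exact: le_trans (hd a b) deltaL.
split=> // b v v0.
have Cd : C * delta <= eps.
  have : delta <= eps / (C + 1) by rewrite ge_min lexx orbT.
  by rewrite ler_pdivlMr //; have := mulr_ge0 C0 (ltW delta0); lra.
have nv : 0 < nrm v by rewrite nrm_gt0.
pose bad1 w := ~ gap_event T r n0 n b w.
pose bad2 w := phi (Mprod T n b w) v < d.
have pw w : expansion T' n b v w `^ al <= theta + (1 - theta) / 4 + (2 * ind R bad1 w + 2 * ind R bad2 w).
  set M := Mprod T n b w.
  have nM : 0 < nrm M by rewrite nrm_gt0; exact: (Mprod_nonzero Lam1 hT q_gt0).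
  have Mv : 0 < nrm (M *m v) by rewrite nrm_gt0; exact: (Mprod_neq0 Lam1 hT).
  have E0 := expansion_ge0 T n b v w.
  apply: le_trans (_ : (expansion T n b v w + eps) `^ al <= _).
    apply: ge0_ler_powR; rewrite ?nnegrE ?expansion_ge0 ?addr_ge0 ?(ltW eps0) ?(ltW al0) //.
    apply: le_trans (hC T T' delta hT2 hT' (ltW delta0) hd b v w v0) _.
    by rewrite lerD2l.
  apply: le_trans (powR_subadditive E0 (ltW eps0) al0 al1) _; rewrite epsal.
  have big : expansion T n b v w `^ al <= 2.
    rewrite -Bal; apply: ge0_ler_powR; rewrite ?nnegrE ?(ltW al0) ?exprn_ge0 ?(ltW B0) //.
    rewrite /expansion -/M ler_pdivrMr ?exprn_gt0 //.
    have h1 := kap_le M.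
    have h2 : nrm M ^+ 2 <= (q%:R * Lam ^+ n) ^+ 2.
      by rewrite lerXn2r ?nnegrE ?nrm_ge0 ?mulr_ge0 ?exprn_ge0 ?(ltW Lam0) // (Mprod_nrm_le Lam1 hT).
    have h3 : nrm v ^+ 2 <= (Lam ^+ n * nrm (M *m v)) ^+ 2.
      by rewrite lerXn2r ?nnegrE ?mulr_ge0 ?exprn_ge0 ?nrm_ge0 ?(ltW Lam0) // (tame_lb Lam1 hT).
    have h4 : kap M <= 2 * (q%:R * Lam ^+ n) ^+ 2 by lra.
    have h5 := ler_pM (kap_ge0 M) (sqr_ge0 _) h4 h3.
    apply: le_trans h5 _.
    have -> : 2 * (q%:R * Lam ^+ n) ^+ 2 * (Lam ^+ n * nrm (M *m v)) ^+ 2 =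
        (2 * q%:R ^+ 2) * (Lam ^+ 4) ^+ n * nrm (M *m v) ^+ 2.
      by rewrite -exprM mulnC exprM; ring.
    apply: ler_wpM2r; first exact: sqr_ge0.
    rewrite /B [leRHS]exprMn; apply: ler_wpM2r; first by rewrite exprn_ge0 // exprn_ge0 // ltW.
    have Q2 : 1 <= 2 * q%:R ^+ 2 :> R.
      have q2 : 1 <= q%:R ^+ 2 :> R by rewrite exprn_ege1.
      by lra.
    by rewrite -[leLHS]expr1 ler_weXn2l.
  have i1 := @ind_ge0 R m bad1 w; have i2 := @ind_ge0 R m bad2 w.
  have [b1|g1] := pselect (bad1 w); first by rewrite (ind1 R b1); lra.
  have [b2|g2] := pselect (bad2 w); first by rewrite (ind1 R b2); lra.
  have small : expansion T n b v w `^ al <= theta.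
    rewrite -sal; apply: ge0_ler_powR; rewrite ?nnegrE ?(ltW al0) ?exprn_ge0 ?(ltW s0) //.
    have hk : kap M <= r ^+ n * nrm M ^+ 2.
      by move: g1 => /contrapT /(_ n); rewrite nn0 leqnn; apply.
    have hp : d <= phi M v by rewrite leNgt; apply/negP.
    rewrite /expansion -/M ler_pdivrMr ?exprn_gt0 //.
    have h1 : d * (nrm M * nrm v) <= nrm (M *m v) by rewrite -ler_pdivlMr ?mulr_gt0.
    have h2 : (d * (nrm M * nrm v)) ^+ 2 <= nrm (M *m v) ^+ 2.
      by rewrite lerXn2r ?nnegrE ?mulr_ge0 ?nrm_ge0 ?(ltW d0).
    have h3 := ler_wpM2r (sqr_ge0 (nrm v)) hk.
    apply: le_trans h3 _.
    have sn := hn2 n nn2.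
    have sn0 : 0 <= s ^+ n by rewrite exprn_ge0 // ltW.
    apply: le_trans (ler_wpM2l sn0 h2).
    have -> : r ^+ n = s ^+ n * s ^+ n by rewrite -ss -exprM mulnC exprM expr2.
    rewrite [leLHS](_ : _ = s ^+ n * (s ^+ n * (nrm M ^+ 2 * nrm v ^+ 2))); last by ring.
    rewrite [leRHS](_ : _ = s ^+ n * (d ^+ 2 * (nrm M ^+ 2 * nrm v ^+ 2))); last by ring.
    apply: ler_wpM2l => //; apply: ler_wpM2r => //.
    by apply: mulr_ge0; exact: sqr_ge0.
  lra.
apply: le_trans (Ex_le p_pos n pw) _.
rewrite ExD Ex_cst // ExD !ExZ.
have := hn0 n b; have := hN1 n b v nN1 v0; rewrite /Prob -/bad1 -/bad2 /eta; lra.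
Qed.

End Openness.

(** * Cocycles of constant rank *)

Section Factorization.
Variables (R : realType) (m d k : nat).
Local Notation coc := (cocycle R m d).

Lemma unit_near1 n (g : 'M[R]_n) : nrm (1%:M - g) < 1 -> g \in unitmx.
Proof.
move=> h; rewrite -row_free_unit -kermx_eq0; apply/negPn/negP => /rowV0Pn[u /sub_kermxP uk u0].
have e : u = u *m (1%:M - g) by rewrite mulmxBr mulmx1 uk subr0.
have := nrm_mul u (1%:M - g); rewrite -e leNgt => /negP; apply.
by rewrite gtr_pMr // nrm_gt0.
Qed.

Lemma inv_near1 n (g : 'M[R]_n) : nrm (1%:M - g) <= 2^-1 -> nrm (invmx g) <= 2 * n%:R.
Proof.
move=> h; have gu : g \in unitmx by apply: unit_near1; apply: le_lt_trans h _; lra.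
have e : invmx g = 1%:M + (1%:M - g) *m invmx g.
  by rewrite mulmxBl mul1mx mulmxV // addrC subrK.
have h1 : nrm (invmx g) <= n%:R + 2^-1 * nrm (invmx g).
  rewrite {1}e; apply: le_trans (nrmD _ _) _; rewrite nrm1 lerD2l.
  by apply: le_trans (nrm_mul _ _) _; rewrite ler_wpM2r ?nrm_ge0.
lra.
Qed.

Lemma unit_near n (g h : 'M[R]_n) : g \in unitmx -> nrm (invmx g) * nrm (g - h) < 1 -> h \in unitmx.
Proof.
move=> gu hh; have u : invmx g *m h \in unitmx.
  apply: unit_near1; rewrite -(mulVmx gu) -mulmxBr; exact: le_lt_trans (nrm_mul _ _) hh.
by move: u; rewrite unitmx_mul unitmx_inv => /andP[].
Qed.

Lemma inv_lip n (g h : 'M[R]_n) : g \in unitmx -> h \in unitmx ->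
  nrm (invmx g - invmx h) <= nrm (invmx g) * nrm (g - h) * nrm (invmx h).
Proof.
move=> gu hu; have -> : invmx g - invmx h = invmx g *m (h - g) *m invmx h.
  by rewrite mulmxBr mulmxBl (mulVmx gu) -mulmxA (mulmxV hu) mulmx1 mul1mx.
apply: le_trans (nrm_mul _ _) _; rewrite ler_wpM2r ?nrm_ge0 // nrm_sub_sym; exact: nrm_mul.
Qed.

Lemma rank_sandwich (M : 'M[R]_d) : \rank M = k ->
  exists (Y : 'M[R]_(k, d)) (S : 'M[R]_(d, k)), Y *m M *m S = 1%:M.
Proof.
move=> <-; have /row_fullP[Y hY] := col_base_full M.
have /row_freeP[S hS] := row_base_free M.
exists Y, S; have -> : Y *m M *m S = (Y *m col_base M) *m (row_base M *m S).
  by rewrite mulmxA -(mulmxA Y (col_base M)) mulmx_base.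
by rewrite hY hS mulmx1.
Qed.

(** Writing M = C D through R^k, invertibility of Y M S = (Y C)(D S) makes both factors invertible,
    and the formula reduces to cancelling them. *)
Lemma sandwich_factor (M : 'M[R]_d) (Y : 'M[R]_(k, d)) (S : 'M[R]_(d, k)) : \rank M = k ->
  Y *m M *m S \in unitmx -> M = (M *m S *m invmx (Y *m M *m S)) *m (Y *m M).
Proof.
move=> rM; have [C [D CD]] : exists (C : 'M[R]_(d, k)) (D : 'M[R]_(k, d)), C *m D = M.
  by move: rM => <-; exists (col_base M), (row_base M); exact: mulmx_base.
have e : Y *m M *m S = (Y *m C) *m (D *m S) by rewrite -CD !mulmxA.
move=> gu; have := gu; rewrite {1}e unitmx_mul => /andP[u1 u2].
have ei : D *m S *m invmx (Y *m M *m S) *m (Y *m C) = 1%:M.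
  have h : invmx (Y *m M *m S) *m (Y *m C) *m (D *m S) = 1%:M by rewrite -mulmxA -e mulVmx.
  by rewrite -mulmxA; apply: mulmx1C.
by rewrite -{1}CD -[in RHS]CD -[C in LHS]mulmx1 -ei !mulmxA CD -CD !mulmxA.
Qed.

Lemma entry_le_cdist (B B' : coc) a r c : `|B a r c - B' a r c| <= cdist B B'.
Proof.
rewrite -sqrtr_sqr ler_wsqrtr // (bigD1 a) //= (bigD1 r) //= (bigD1 c) //= -!addrA lerDl.
rewrite !addr_ge0 //.
- by apply: sumr_ge0 => j _; exact: sqr_ge0.
- by apply: sumr_ge0 => j _; apply: sumr_ge0 => l _; exact: sqr_ge0.
- by apply: sumr_ge0 => j _; apply: sumr_ge0 => l _; apply: sumr_ge0 => u _; exact: sqr_ge0.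
Qed.

Lemma nrm_le_cdist (B B' : coc) a : nrm (B a - B' a) <= d%:R * d%:R * cdist B B'.
Proof. by apply: nrm_le_card => r c; rewrite !mxE; exact: entry_le_cdist. Qed.

(** The bounded one-sided inverses allow Q and W to be stripped from norms at the price of a
    constant. *)
Definition factored (C : R) (B : coc) (Q : 'I_m.+1 -> 'M[R]_(d, k)) (W : 'I_m.+1 -> 'M[R]_(k, d)) : Prop :=
  [/\ forall a, B a = Q a *m W a, forall a b, W a *m Q b \in unitmx &
   forall a, exists (Q' : 'M[R]_(k, d)) (W' : 'M[R]_(d, k)), [/\ Q' *m Q a = 1%:M, W a *m W' = 1%:M,
     (nrm (Q a) <= C) && (nrm Q' <= C) & (nrm (W a) <= C) && (nrm W' <= C)]].

(* Coordinates on the ranges of the B a: with Y a *m A a *m S a = 1 fixed, the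
   matrix B a *m S a spans the range of B a and Y a inverts it up to the
   invertible factor g. *)
Lemma factor_near (A : coc) : (forall a, \rank (A a) = k) -> (forall a b, \rank (A a *m A b) = k) ->
  exists (delta C CL : R) (Q : coc -> 'I_m.+1 -> 'M[R]_(d, k)) (W : coc -> 'I_m.+1 -> 'M[R]_(k, d)),
  [/\ 0 < delta, 0 <= C, 0 <= CL &
   forall B, (forall a, \rank (B a) = k) -> cdist B A < delta ->
     factored C B (Q B) (W B) /\
     forall B', (forall a, \rank (B' a) = k) -> cdist B' A < delta ->
     forall a b, nrm (W B a *m Q B b - W B' a *m Q B' b) <= CL * cdist B B'].
Proof.
move=> h1 h2.
have [Y hY] := choice (fun a => rank_sandwich (h1 a)).
have [S hS] := choice hY.
have c0 (B B' : coc) : 0 <= cdist B B' by exact: sqrtr_ge0.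
pose D2 : R := d%:R * d%:R.
have D20 : 0 <= D2 by rewrite mulr_ge0.
pose CY := \sum_a nrm (Y a) + 1; pose CS := \sum_a nrm (S a) + 1.
pose CB := \sum_a nrm (A a) + D2.
have sum_ub (F : 'I_m.+1 -> R) a : (forall b, 0 <= F b) -> F a <= \sum_b F b.
  by move=> F0; rewrite (bigD1 a) //= lerDl; apply: sumr_ge0.
have YC a : nrm (Y a) <= CY.
  by apply: le_trans (@sum_ub (fun a => nrm (Y a)) a _) _; rewrite ?lerDl // => b; exact: nrm_ge0.
have SC a : nrm (S a) <= CS.
  by apply: le_trans (@sum_ub (fun a => nrm (S a)) a _) _; rewrite ?lerDl // => b; exact: nrm_ge0.
have CY0 : 0 < CY by rewrite ltr_wpDl // sumr_ge0 // => b _; exact: nrm_ge0.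
have CS0 : 0 < CS by rewrite ltr_wpDl // sumr_ge0 // => b _; exact: nrm_ge0.
have CB0 : 0 <= CB by rewrite addr_ge0 // sumr_ge0 // => b _; exact: nrm_ge0.
pose g (B : coc) a := Y a *m B a *m S a.
pose W (B : coc) a := Y a *m B a.
pose Q (B : coc) a := B a *m S a *m invmx (g B a).
have gA a : g A a = 1%:M by exact: hS.
have glip B B' a : nrm (g B a - g B' a) <= CY * CS * D2 * cdist B B'.
  rewrite /g -mulmxBl -mulmxBr.
  have e1 := le_trans (nrm_mul (Y a) (B a - B' a)) (ler_pM (nrm_ge0 _) (nrm_ge0 _) (YC a) (nrm_le_cdist B B' a)).
  have e2 := le_trans (nrm_mul (Y a *m (B a - B' a)) (S a)) (ler_pM (nrm_ge0 _) (nrm_ge0 _) e1 (SC a)).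
  by apply: le_trans e2 _; rewrite /D2 le_eqVlt; apply/orP; left; apply/eqP; ring.
pose K := CY * CS * D2.
have K0 : 0 <= K by rewrite mulr_ge0 // mulr_ge0 // ltW.
pose G : R := 2 * k%:R.
have G0 : 0 <= G by rewrite mulr_ge0.
pose CQ := CB * CS * G.
have CQ0 : 0 <= CQ by rewrite mulr_ge0 // mulr_ge0 // ltW.
pose CW := CY * CB.
have CW0 : 0 <= CW by rewrite mulr_ge0 // ltW.
pose CLQ := D2 * CS * G + CB * CS * (G * K * G).
have CLQ0 : 0 <= CLQ.
  by do ![done | exact: ltW | apply: addr_ge0 | apply: mulr_ge0].
pose CL := CY * D2 * CQ + CW * CLQ.
have CL0 : 0 <= CL.
  by do ![done | exact: ltW | apply: addr_ge0 | apply: mulr_ge0].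
(* Within d1 each B a stays bounded and g B a stays within 1/2 of the identity. *)
pose d1 := Num.min 1 ((2 * (K + 1))^-1).
have K1 : 0 < 2 * (K + 1) by lra.
have d10 : 0 < d1 by rewrite lt_min ltr01 invr_gt0.
have Bbd B a : cdist B A < d1 -> nrm (B a) <= CB.
  move=> hB; have := nrmD (B a - A a) (A a); rewrite subrK => hh; apply: le_trans hh _.
  rewrite addrC; apply: lerD.
    by apply: (@sum_ub (fun a => nrm (A a)) a) => b; exact: nrm_ge0.
  apply: le_trans (nrm_le_cdist _ _ _) _; rewrite -/D2 ler_piMr // ltW // (lt_le_trans hB) //.
  by rewrite ge_min lexx.
have gnear B a : cdist B A < d1 -> nrm (1%:M - g B a) <= 2^-1.
  move=> hB; rewrite -(gA a) nrm_sub_sym; apply: le_trans (glip _ _ _) _; rewrite -/K.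
  have h : cdist B A <= (2 * (K + 1))^-1 by rewrite (le_trans (ltW hB)) // ge_min lexx orbT.
  have := ler_wpM2l K0 h; have : K * (2 * (K + 1))^-1 <= 2^-1.
    by rewrite ler_pdivrMr //; lra.
  lra.
have gu B a : cdist B A < d1 -> g B a \in unitmx.
  by move=> /(gnear B a) h; apply: unit_near1; apply: le_lt_trans h _; lra.
have ginv B a : cdist B A < d1 -> nrm (invmx (g B a)) <= G.
  by move=> /(gnear B a) h; exact: inv_near1.
have Wbd B a : cdist B A < d1 -> nrm (W B a) <= CW.
  move=> hB; apply: le_trans (nrm_mul _ _) _; apply: ler_pM; rewrite ?nrm_ge0 //; exact: Bbd.
have Qbd B a : cdist B A < d1 -> nrm (Q B a) <= CQ.
  move=> hB; have e1 := le_trans (nrm_mul (B a) (S a)) (ler_pM (nrm_ge0 _) (nrm_ge0 _) (Bbd B a hB) (SC a)).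
  exact: le_trans (nrm_mul _ _) (ler_pM (nrm_ge0 _) (nrm_ge0 _) e1 (ginv B a hB)).
have Qlip B B' a : cdist B A < d1 -> cdist B' A < d1 -> nrm (Q B a - Q B' a) <= CLQ * cdist B B'.
  move=> hB hB'.
  have -> : Q B a - Q B' a = (B a - B' a) *m S a *m invmx (g B a) + B' a *m S a *m (invmx (g B a) - invmx (g B' a)).
    by rewrite /Q mulmxBl mulmxBl mulmxBr addrA subrK.
  apply: le_trans (nrmD _ _) _; rewrite /CLQ mulrDl; apply: lerD.
    have e1 := le_trans (nrm_mul (B a - B' a) (S a)) (ler_pM (nrm_ge0 _) (nrm_ge0 _) (nrm_le_cdist B B' a) (SC a)).
    have e2 := le_trans (nrm_mul _ (invmx (g B a))) (ler_pM (nrm_ge0 _) (nrm_ge0 _) e1 (ginv B a hB)).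
    by apply: le_trans e2 _; rewrite /D2 le_eqVlt; apply/orP; left; apply/eqP; ring.
  have e1 := le_trans (nrm_mul (B' a) (S a)) (ler_pM (nrm_ge0 _) (nrm_ge0 _) (Bbd B' a hB') (SC a)).
  have e2 : nrm (invmx (g B a) - invmx (g B' a)) <= G * (K * cdist B B') * G.
    apply: le_trans (inv_lip (gu B a hB) (gu B' a hB')) _.
    apply: ler_pM; rewrite ?mulr_ge0 ?nrm_ge0 //; last exact: ginv.
    by apply: ler_pM; rewrite ?nrm_ge0 //; exact: ginv.
  have e3 := le_trans (nrm_mul _ _) (ler_pM (nrm_ge0 _) (nrm_ge0 _) e1 e2).
  by apply: le_trans e3 _; rewrite le_eqVlt; apply/orP; left; apply/eqP; ring.
have Wlip B B' a : nrm (W B a - W B' a) <= CY * D2 * cdist B B'.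
  rewrite /W -mulmxBr; apply: le_trans (nrm_mul _ _) _; rewrite -mulrA.
  by apply: ler_pM; rewrite ?nrm_ge0 //; exact: nrm_le_cdist.
have tlip B B' a b : cdist B A < d1 -> cdist B' A < d1 ->
    nrm (W B a *m Q B b - W B' a *m Q B' b) <= CL * cdist B B'.
  move=> hB hB'.
  have -> : W B a *m Q B b - W B' a *m Q B' b = (W B a - W B' a) *m Q B b + W B' a *m (Q B b - Q B' b).
    by rewrite mulmxBl mulmxBr addrA subrK.
  apply: le_trans (nrmD _ _) _; rewrite /CL mulrDl; apply: lerD.
    have e := le_trans (nrm_mul _ _) (ler_pM (nrm_ge0 _) (nrm_ge0 _) (Wlip B B' a) (Qbd B b hB)).
    by apply: le_trans e _; rewrite mulrAC.
  by have e := le_trans (nrm_mul _ _) (ler_pM (nrm_ge0 _) (nrm_ge0 _) (Wbd B' a hB') (Qlip B B' b hB hB')); rewrite -mulrA.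
have cAA : cdist A A = 0.
  rewrite /cdist big1 ?sqrtr0 // => a _; rewrite big1 // => r _; rewrite big1 // => c _.
  by rewrite subrr expr0n.
have fact B a : (forall a, \rank (B a) = k) -> cdist B A < d1 -> B a = Q B a *m W B a.
  by move=> rB hB; exact: sandwich_factor (rB a) (gu B a hB).
(* The product A_a A_b = Q_a (W_a Q_b) W_b has rank k, which forces the k x k factor in the middle
   to be invertible. *)
have tA a b : W A a *m Q A b \in unitmx.
  rewrite -row_full_unit; apply/eqP/anti_leq; rewrite rank_leq_row /=.
  rewrite -[X in (X <= _)%N](h2 a b) (fact A a h1) ?cAA // (fact A b h1) ?cAA //.
  by rewrite mulmxA -(mulmxA (Q A a)) (leq_trans (mxrankM_maxl _ _)) // mxrankM_maxr.
pose CI := \sum_a \sum_b nrm (invmx (W A a *m Q A b)) + 1.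
have CIb a b : nrm (invmx (W A a *m Q A b)) <= CI.
  have s0 a' : 0 <= \sum_b nrm (invmx (W A a' *m Q A b)) by apply: sumr_ge0 => *; exact: nrm_ge0.
  apply: le_trans (_ : \sum_b nrm (invmx (W A a *m Q A b)) <= _).
    by apply: (@sum_ub (fun b => nrm (invmx (W A a *m Q A b)))) => c; exact: nrm_ge0.
  by apply: le_trans (@sum_ub (fun a => \sum_b nrm (invmx (W A a *m Q A b))) a s0) _; rewrite lerDl.
have CI0 : 0 < CI.
  by rewrite ltr_wpDl // sumr_ge0 // => a _; apply: sumr_ge0 => b _; exact: nrm_ge0.
pose d2 := Num.min d1 ((2 * (CI * CL + 1))^-1).
have CC : 0 < 2 * (CI * CL + 1) by rewrite mulr_gt0 // ltr_wpDl // mulr_ge0 // ltW.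
have d2d1 x : x < d2 -> x < d1 by move=> h; apply: lt_le_trans h _; rewrite ge_min lexx.
exists d2, (CQ + CW + CY + CS * G), CL, Q, W; split => //.
- by rewrite lt_min d10 invr_gt0.
- by do ![done | exact: ltW | apply: addr_ge0 | apply: mulr_ge0].
move=> B rB hB2; have hB := d2d1 _ hB2; split; last first.
  by move=> B' rB' hB'2 a b; apply: tlip => //; exact: d2d1.
have SG : 0 <= CS * G by rewrite mulr_ge0 // ltW.
have CY0' := ltW CY0.
split=> [a|a b|a]; first exact: fact.
- apply: (unit_near (tA a b)).
  have e := ler_pM (nrm_ge0 _) (nrm_ge0 _) (CIb a b) (tlip A B a b _ hB).
  apply: le_lt_trans (e _) _; first by rewrite cAA.
  have hs : cdist A B = cdist B A.
    rewrite /cdist; congr Num.sqrt; do 3!(apply: eq_bigr => ? _).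
    by rewrite -sqrrN opprB.
  rewrite hs mulrA.
  have h : cdist B A <= (2 * (CI * CL + 1))^-1.
    by apply: le_trans (ltW hB2) _; rewrite ge_min lexx orbT.
  have CICL : 0 <= CI * CL by rewrite mulr_ge0 // ltW.
  apply: le_lt_trans (ler_wpM2l CICL h) _; rewrite ltr_pdivrMr //; lra.
- have Qu : Y a *m Q B a = 1%:M.
    by rewrite /Q !mulmxA -/(g B a) mulmxV // gu.
  have Wu : W B a *m (S a *m invmx (g B a)) = 1%:M.
    by rewrite /W !mulmxA -/(g B a) mulmxV // gu.
  exists (Y a), (S a *m invmx (g B a)); split => //.
    by apply/andP; split; [have := Qbd B a hB | have := YC a]; lra.
  have e := le_trans (nrm_mul _ _) (ler_pM (nrm_ge0 _) (nrm_ge0 _) (SC a) (ginv B a hB)).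
  by apply/andP; split; [have := Wbd B a hB | move: e]; lra.
Qed.

Lemma iterB_factored (B : coc) (Q : 'I_m.+1 -> 'M[R]_(d, k)) (W : 'I_m.+1 -> 'M[R]_(k, d)) : (forall a, B a = Q a *m W a) -> forall n w,
  iterB B n.+1 w = Q (lastl n (w 0%N) (wshift 1 w)) *m
     Mprod (fun a b => W a *m Q b) n (w 0%N) (wshift 1 w) *m W (w 0%N).
Proof.
move=> hB; elim=> [|n IH] w; first by rewrite /= !mulmx1 hB.
rewrite [LHS]/= -/(iterB B n.+1 w) IH hB MprodSr.
rewrite (_ : lastl n.+1 (w 0%N) (wshift 1 w) = w n.+1) // (_ : wshift 1 w n = w n.+1) //.
by rewrite !mulmxA.
Qed.

Lemma compound_Mprod i (t : 'I_m.+1 -> 'I_m.+1 -> 'M[R]_k) n b w :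
  compound i (Mprod t n b w) = Mprod (fun a b => compound i (t a b)) n b w.
Proof. by elim: n b w => [|n IH] b w /=; rewrite ?compound1 // compound_mul IH. Qed.

Lemma compound_unit i (M : 'M[R]_k) : M \in unitmx -> compound i M \in unitmx.
Proof.
move=> Mu; have h : compound i M *m compound i (invmx M) = 1%:M.
  by rewrite -compound_mul mulmxV // compound1.
by have [] := mulmx1_unit h.
Qed.

(** The compound of Q_a is injective and has the range of the compound of A_a, so it carries an
    invariant family of proper subspaces for T to one for the exterior cocycle. *)
Lemma irreducible_transfer (A : coc) (C : R) (Q : 'I_m.+1 -> 'M[R]_(d, k)) (W : 'I_m.+1 -> 'M[R]_(k, d)) i : factored C A Q W ->
  irreducible_cocycle (ext_cocycle i A) ->
  ~ trans_reducible (fun a b => compound i (W a *m Q b)).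
Proof.
move=> [fA tu inv] irr [V [V0 [Vr Vi]]]; apply: irr.
have [Q' hQ'] := choice (fun a => inv a).
have [W' hW'] := choice hQ'.
pose CQ a := compound i (Q a); pose CW a := compound i (W a).
have QQ a : compound i (Q' a) *m CQ a = 1%:M.
  by have [h _ _ _] := hW' a; rewrite -compound_mul h compound1.
have WW a : CW a *m compound i (W' a) = 1%:M.
  by have [_ h _ _] := hW' a; rewrite -compound_mul h compound1.
have DE a : (ext_cocycle i A a)^T = (CW a)^T *m (CQ a)^T.
  by rewrite /ext_cocycle -compound_extpow fA compound_mul trmx_mul.
have QT a : (CQ a)^T *m (compound i (Q' a))^T = 1%:M by rewrite -trmx_mul QQ trmx1.
have WT a : (compound i (W' a))^T *m (CW a)^T = 1%:M by rewrite -trmx_mul WW trmx1.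
have VQrk a : \rank (V a *m (CQ a)^T) = \rank (V a).
  by rewrite mxrankMfree //; apply/row_freeP; exists (compound i (Q' a))^T.
(* The row space must be given by a square matrix; [<<_>>] provides one. *)
exists (fun a => <<V a *m (CQ a)^T>>%MS); split; last split.
- by move=> a; rewrite -mxrank_eq0 genmxE VQrk mxrank_eq0.
- move=> a; rewrite /ltmx genmxE; apply/andP; split.
    have -> : V a *m (CQ a)^T = V a *m (compound i (W' a))^T *m (ext_cocycle i A a)^T.
      by rewrite DE !mulmxA -(mulmxA (V a)) WT mulmx1.
    exact: submxMl.
  apply/negP => h; have := leq_trans (mxrankS h) _; rewrite genmxE VQrk => /(_ _ (leqnn _)).
  rewrite leqNgt (leq_trans (Vr a)) //.
  have -> : (ext_cocycle i A a)^T = (CW a)^T *m (CQ a)^T by exact: DE.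
  rewrite mxrankMfree; last by apply/row_freeP; exists (compound i (Q' a))^T.
  have /eqP -> // : row_full (CW a)^T by apply/row_fullP; exists (compound i (W' a))^T.
- move=> a b.
  have e : V b *m (CQ b)^T *m (ext_cocycle i A a)^T = V b *m (compound i (W a *m Q b))^T *m (CQ a)^T.
    by rewrite DE compound_mul -/(CW a) -/(CQ b) trmx_mul !mulmxA.
  have /andP[le1 le2] := Vi a b.
  apply/andP; split.
    rewrite genmxE (submx_trans (submxMr _ (_ : (_ <= V b *m (CQ b)^T)%MS))) ?genmxE //.
    by rewrite e submxMr.
  rewrite genmxE (submx_trans (submxMr _ le2)) // -e submxMr // genmxE //.
Qed.

Lemma unit_tame n (T : 'I_m.+1 -> 'I_m.+1 -> 'M[R]_n) : (forall a b, T a b \in unitmx) ->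
  exists Lam : R, [/\ 1 <= Lam, tame Lam T & forall a b, nrm (invmx (T a b)) <= Lam].
Proof.
move=> Tu.
pose L := 1 + \sum_a \sum_b (nrm (T a b) + nrm (invmx (T a b))).
have f0 a b : 0 <= nrm (T a b) + nrm (invmx (T a b)) by rewrite addr_ge0 ?nrm_ge0.
have hL a b : nrm (T a b) + nrm (invmx (T a b)) <= L.
  rewrite /L (bigD1 a) //= (bigD1 b) //=.
  have s1 : 0 <= \sum_(c | c != b) (nrm (T a c) + nrm (invmx (T a c))) by apply: sumr_ge0.
  have s2 : 0 <= \sum_(c | c != a) \sum_e (nrm (T c e) + nrm (invmx (T c e))).
    by apply: sumr_ge0 => c _; apply: sumr_ge0.
  lra.
have iL a b : nrm (invmx (T a b)) <= L.
  by apply: le_trans (hL a b); rewrite lerDr nrm_ge0.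
exists L; split => //.
  by rewrite lerDl; apply: sumr_ge0 => a _; apply: sumr_ge0.
split=> [a b|a b v]; first by apply: le_trans (hL a b); rewrite lerDl nrm_ge0.
apply: le_trans (nrm_inv_lb v (mulVmx (Tu a b))) _.
by rewrite ler_wpM2r ?nrm_ge0.
Qed.

End Factorization.

(** * Linear growth rates *)

Definition has_rate (R : realType) (f : nat -> R) (l : R) : Prop :=
  forall e, 0 < e -> exists N, forall n, (N <= n)%N -> `|f n - n%:R * l| <= n%:R * e.

Section Rates.
Variable R : realType.

Lemma ln_dist_le (x y C : R) : 0 < x -> 0 < y -> x <= C * y -> y <= C * x -> `|ln x - ln y| <= ln C.
Proof.
move=> x0 y0 h1 h2; have C0 : 0 < C by rewrite -(pmulr_lgt0 _ y0) (lt_le_trans x0).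
have e1 : ln x <= ln C + ln y by rewrite -lnM ?posrE // ler_ln ?posrE // mulr_gt0.
have e2 : ln y <= ln C + ln x by rewrite -lnM ?posrE // ler_ln ?posrE // mulr_gt0.
rewrite ler_norml; lra.
Qed.

Lemma has_rate_unique (f : nat -> R) l l' : has_rate f l -> has_rate f l' -> l = l'.
Proof.
move=> h h'; apply/eqP; rewrite -subr_eq0 -normr_le0; apply/ler_addgt0Pl => e e0; rewrite addr0.
have e2 : 0 < e / 4 by rewrite divr_gt0.
have [N hN] := h _ e2; have [N' hN'] := h' _ e2.
pose n := (N + N').+1.
have h1 : `|f n - n%:R * l| <= n%:R * (e / 4) by apply: hN; rewrite /n -addnS leq_addr.
have h2 : `|f n - n%:R * l'| <= n%:R * (e / 4) by apply: hN'; rewrite /n -addSn leq_addl.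
have n0 : (0 : R) < n%:R by rewrite ltr0n.
rewrite -(ler_pM2l n0) -[X in X * `|_|]ger0_norm ?ltW // -normrM mulrBr.
have := ler_normB (f n - n%:R * l') (f n - n%:R * l).
rewrite (_ : f n - n%:R * l' - (f n - n%:R * l) = n%:R * l - n%:R * l'); last by ring.
have h3 : 0 < n%:R * e by rewrite mulr_gt0.
by move: h1 h2; lra.
Qed.

Lemma has_rate_sub (f g : nat -> R) l l' : has_rate f l -> has_rate g l' -> has_rate (fun n => f n - g n) (l - l').
Proof.
move=> h h' e e0; have e2 : 0 < e / 2 by rewrite divr_gt0.
have [N hN] := h _ e2; have [N' hN'] := h' _ e2.
exists (maxn N N') => n; rewrite geq_max => /andP[/hN h1 /hN' h2].
by move: h1 h2; rewrite !ler_norml !mulrBr => /andP[? ?] /andP[? ?]; lra.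
Qed.

Lemma logE_cvg (X f : nat -> R) (l K : R) : (forall n, 0 < X n.+1) ->
  (forall n, `|ln (X n.+1) - f n| <= K) -> has_rate f l ->
  (fun n => (n%:R^-1)%:E * logE (X n))%E @ \oo --> l%:E.
Proof.
move=> X0 hX hf.
have K0 : 0 <= K by apply: le_trans (hX 0%N).
have h : (fun n => n%:R^-1 * ln (X n)) @ \oo --> l.
  apply/cvgrPdist_le => e e0.
  have e2 : 0 < e / 2 by rewrite divr_gt0.
  have [N hN] := hf _ e2.
  have [M hM] := archi_above ((K + `|l|) / (e / 2)).
  exists (maxn N M).+1 => // -[//|n] /=; rewrite ltnS geq_max => /andP[Nn Mn].
  have n0 : (0 : R) < n.+1%:R by rewrite ltr0n.
  rewrite -(ler_pM2l n0) -[X in X * `|_|]ger0_norm ?ltW // -normrM mulrBr mulrA divff ?gt_eqF // mul1r.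
  have h1 := hN n Nn; have h2 := hX n.
  have h3 : K + `|l| <= n%:R * (e / 2).
    by rewrite -ler_pdivrMr // (le_trans (ltW hM)) // ler_nat.
  rewrite -[n.+1%:R]natr1.
  have h4 := ler_norm l; have h5 := ler_norm (- l); rewrite normrN in h5.
  move: h1 h2 h3; rewrite ltr_norml !ler_norml => /andP[? ?] /andP[? ?] h3; lra.
have XE n : ((n.+1%:R^-1)%:E * logE (X n.+1))%E = (n.+1%:R^-1 * ln (X n.+1))%:E.
  by rewrite /logE leNgt X0 /= EFinM.
apply: cvg_EFin; first by exists 1%N => // -[//|n] _ /=; rewrite XE.
apply: cvg_trans h; apply: near_eq_cvg; exists 1%N => // -[//|n] _ /=.
by rewrite XE.
Qed.

End Rates.

(** * Growth rates and Lyapunov exponents *)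

Section AlmostSure.
Variables (R : realType) (m : nat) (p : 'I_m.+1 -> R).
Hypotheses (p_pos : forall j, 0 < p j) (p_sum : \sum_j p j = 1).
Variables (P : probability (Xspace m) R) (P_bern : is_bernoulli p P).
Local Notation word := (nat -> letter m).

Lemma ae_exists (A : set (Xspace m)) : {ae P, forall om, A om} -> exists om, A om.
Proof.
move=> [N [mN PN hN]]; apply: contrapT => h.
have NT : N = setT.
  by apply/seteqP; split => // om _; apply: hN => hA; apply: h; exists om.
by move: PN; rewrite NT probability_setT => /eqP; rewrite onee_eq0.
Qed.

(** Egorov's argument: the events that G fails at some time after n decrease to a null set.
    Truncating at N makes the event depend on finitely many letters without changing the bound. *)
Lemma ae_uniform (G : nat -> set (Xspace m)) eta : (forall n, depends n.+1 (G n : word -> Prop)) -> 0 < eta ->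
  {ae P, forall om, exists N, forall n, (N <= n)%N -> G n om} ->
  exists n0, forall N, Prob p N.+1 (fun w => ~ forall n, (n0 <= n <= N)%N -> G n w) <= eta.
Proof.
move=> dG eta0 hG.
pose F n : set (Xspace m) := \bigcup_(k in [set k | (n <= k)%N]) ~` G k.
have mG n : measurable (G n) by exact: (word_event P_bern (@dG n)).1.
have mF n : measurable (F n) by apply: bigcup_measurable => // k _; exact: measurableC.
have cv : P (F n) @[n --> \oo] --> P (\bigcap_n F n).
  apply: nonincreasing_cvg_mu => //.
  - by rewrite -ge0_fin_numE // P_fin.
  - by apply: bigcap_measurable.
  - by move=> a b ab; apply/subsetPset => om [k /= bk Gk]; exists k => //=; exact: leq_trans bk.
have P0 : P (\bigcap_n F n) = 0%E.
  have [N [mN PN hN]] := hG.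
  apply/eqP; rewrite eq_le measure_ge0 andbT -PN; apply: le_measure; rewrite ?inE //.
    exact: bigcap_measurable.
  move=> om h; apply: hN => -[n hn]; have [k nk Gk] := h n I; exact: Gk (hn k nk).
rewrite P0 in cv; have /fine_cvgP[_ /cvgrPdist_le /(_ _ eta0)] := cv.
move=> [n0 _ /(_ n0 (leqnn _))]; rewrite /= sub0r normrN => h.
exists n0 => N.
pose E : set (Xspace m) := fun w => ~ forall n, (n0 <= n <= N)%N -> G n w.
have dE : depends N.+1 (E : word -> Prop).
  move=> w w' ww'.
  have e n : (n <= N)%N -> G n w = G n w'.
    by move=> nN; apply: dG => t tn; apply: ww'; exact: leq_trans tn _.
  rewrite /E; apply: congr1; apply: propext; split=> hh n hn; have /andP[_ nN] := hn.
    by rewrite -e //; exact: hh.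
  by rewrite e //; exact: hh.
have [mE PE] := word_event P_bern dE.
have PF := P_fin P (mF n0).
apply: le_trans (le_trans (ler_norm _) h).
rewrite -lee_fin fineK // -PE; apply: le_measure; rewrite ?inE //.
move=> w hw; apply: contrapT => hF; apply: hw => n /andP[n0n _].
by apply: contrapT => hn; apply: hF; exists n.
Qed.

Lemma Prob_first N (A : word -> Prop) b : p b * Prob p N (fun w => A (scons b w)) <= Prob p N.+1 A.
Proof.
rewrite /Prob /= (bigD1 b) //= lerDl; apply: sumr_ge0 => a _; apply: mulr_ge0; first exact: ltW.
exact: Prob_ge0.
Qed.

(** [lyap] is a choice among almost sure limits; two such limits are compared at a sequence where
    both hold. *)
Lemma lyap_eq N (B : cocycle R m N) j (l : \bar R) :
  {ae P, forall om : Xspace m,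
     (fun n : nat => ((n%:R)^-1)%:E * logE (singval j (iterB B n om)))%E @ \oo --> l} ->
  lyap P B j = l.
Proof.
move=> h; rewrite /lyap; case: xgetP => [y _ hy|h0]; last by case: (h0 l).
have [om [h1 h2]] := ae_exists (ae_and hy h).
exact: (cvg_unique (@ereal_hausdorff R) h1 h2).
Qed.

Section FurstenbergKesten.
Variables (q : nat) (T : 'I_m.+1 -> 'I_m.+1 -> 'M[R]_q).
Hypotheses (q_gt0 : (0 < q)%N) (Tu : forall a b, T a b \in unitmx).

Definition growth n (w : word) : R := ln (nrm (Mprod T n (w 0%N) (wshift 1 w))).

Lemma growth_depends n : depends n.+1 (growth n).
Proof.
move=> w w' ww'; rewrite /growth ww' //; congr (ln (nrm _)).
by apply: Mprod_depends => t tn; rewrite /wshift; exact: ww'.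
Qed.

Lemma Mprod_nrm_gt0 n b w : 0 < nrm (Mprod T n b w).
Proof.
have [Lam [Lam1 hT _]] := unit_tame Tu.
by rewrite nrm_gt0; exact: (Mprod_nonzero Lam1 hT).
Qed.

(** Invertibility enters twice: it bounds the log norm below linearly, and it makes the removal of
    the first factor a bounded change, which is the shift condition of [kingman]. *)
Lemma furstenberg_kesten : exists l : R, {ae P, forall om : Xspace m, has_rate (fun n => growth n om) l}.
Proof.
have [Lam [Lam1 hT hTi]] := unit_tame Tu.
have L0 : 0 < Lam by lra.
have lnL : 0 <= ln Lam by exact: ln_ge0.
have q1 : 1 <= q%:R :> R by rewrite ler1n.
have lnq : 0 <= ln (q%:R : R) by exact: ln_ge0.
apply: (kingman p_pos p_sum P_bern (K := ln Lam + ln q%:R)).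
- exact: growth_depends.
- move=> n w; rewrite /growth; move: (wshift 1 w) (w 0%N) => u b.
  have g0 := Mprod_nrm_gt0 n b u.
  have Ln : 0 < Lam ^+ n by exact: exprn_gt0.
  have h1 : ln (nrm (Mprod T n b u)) <= ln q%:R + ln Lam *+ n.
    rewrite -lnXn // -lnM ?posrE //; last lra.
    rewrite ler_ln ?posrE // ?mulr_gt0 //; last lra.
    exact: (Mprod_nrm_le Lam1 hT).
  have h2 : 0 <= ln Lam *+ n + ln (nrm (Mprod T n b u)).
    rewrite -lnXn // -lnM ?posrE //; apply: ln_ge0.
    pose v : 'cV[R]_q := const_mx 1.
    have v0 : v != 0.
      apply/eqP => /matrixP /(_ (Ordinal q_gt0) 0); rewrite !mxE => /eqP; by rewrite oner_eq0.
    rewrite -nrm_gt0 in v0; rewrite -(ler_pM2r v0) mul1r -mulrA.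
    apply: le_trans (tame_lb Lam1 hT n b u v) _; rewrite ler_pM2l //; exact: nrm_mul.
  have h3 : 0 <= n%:R * ln (q%:R : R) by rewrite mulr_ge0.
  by rewrite -[n.+1%:R]natr1 ler_norml; move: h1 h2 h3; rewrite -[ln Lam *+ n]mulr_natl; nra.
- move=> n k w; rewrite /growth MprodD -lnM ?posrE ?Mprod_nrm_gt0 // ler_ln ?posrE ?mulr_gt0 ?Mprod_nrm_gt0 //.
    rewrite mulrC; apply: le_trans (nrm_mul _ _) _.
    rewrite (_ : lastl n (w 0%N) (wshift 1 w) = w n); last exact: (lastlS _ (w 0%N)).
    rewrite (_ : wshift n w 0%N = w n); last by rewrite /wshift addn0.
    by rewrite !wshiftD addnC.
  by rewrite -MprodD Mprod_nrm_gt0.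
- move=> n w; rewrite /growth /= -/(Mprod T n).
  set M := Mprod T n _ _; set t := T _ _.
  have M0 : 0 < nrm M by exact: Mprod_nrm_gt0.
  have Mt0 : 0 < nrm (M *m t) by have := Mprod_nrm_gt0 n.+1 (w 0%N) (wshift 1 w).
  apply: le_trans (_ : ln Lam <= _); last lra.
  apply: ln_dist_le => //; rewrite mulrC.
    by apply: le_trans (nrm_mul _ _) _; rewrite ler_wpM2l ?nrm_ge0 //; exact: hT.1.
  rewrite -[leLHS](_ : nrm (M *m t *m invmx t) = _); last by rewrite -mulmxA mulmxV ?mulmx1 ?Tu.
  by apply: le_trans (nrm_mul _ _) _; rewrite ler_wpM2l ?nrm_ge0 //; exact: hTi.
Qed.

End FurstenbergKesten.

End AlmostSure.

(** * Singular values and norms of compounds *)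

Section SingularValueGrowth.
Variable R : realType.

Lemma unit_nrm_gt0 n (M : 'M[R]_n) : (0 < n)%N -> M \in unitmx -> 0 < nrm M.
Proof.
move=> n0 Mu; rewrite nrm_gt0; apply/eqP => M0.
have := nrm1 R n; rewrite -(mulmxV Mu) M0 mul0mx nrm0 => /eqP.
by rewrite eq_sym pnatr_eq0 -leqn0 leqNgt n0.
Qed.

Lemma card_isub_gt0 k i : (i <= k)%N -> (0 < #|{: isub k i}|)%N.
Proof. by move=> ik; apply/card_gt0P; exists (first_isub ik). Qed.

Lemma compound_nrm_gt0 k i (M : 'M[R]_k) : (i <= k)%N -> M \in unitmx -> 0 < nrm (compound i M).
Proof. by move=> ik Mu; apply: unit_nrm_gt0; [exact: card_isub_gt0 | exact: compound_unit]. Qed.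

(** Multiplied by X and Y, a pivot decomposition of M becomes one of X M Y. So the singular value is
    comparable with [delta j], the quotient of the products of the first j.+1 and the first j
    entries. *)
Lemma singval_compound (C : R) d k j : (k <= d)%N -> (j < k)%N ->
  exists K : R, forall (X : 'M[R]_(d, k)) (X' : 'M[R]_(k, d)) (Y : 'M[R]_(k, d)) (Y' : 'M[R]_(d, k)) (M : 'M[R]_k),
    X' *m X = 1%:M -> Y *m Y' = 1%:M -> (nrm X <= C) && (nrm X' <= C) -> (nrm Y <= C) && (nrm Y' <= C) ->
    M \in unitmx ->
    0 < singval j.+1 (X *m M *m Y) /\
    `|ln (singval j.+1 (X *m M *m Y)) - (ln (nrm (compound j.+1 M)) - ln (nrm (compound j M)))| <= K.
Proof.
move=> kd jk; have [Cp Cp1 pd] := pivot_dec R k.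
have [C1 C10 hb1] := bounded_dec_compound Cp k k j.
have [C2 C20 hb2] := bounded_dec_compound Cp k k j.+1.
pose D := Cp * (`|C| + 1).
have D0 : 0 < D by rewrite mulr_gt0 ?ltr_wpDl //; lra.
pose E := D * D * d%:R.
have d0 : (0 : R) < d%:R by rewrite ltr0n (leq_trans _ kd) // (leq_ltn_trans _ jk).
have E0 : 0 < E by exact: mulr_gt0 (mulr_gt0 D0 D0) d0.
exists (ln E + ln C1 + ln C2) => X X' Y Y' M hX hY /andP[X1 X2] /andP[Y1 Y2] Mu.
have [delta sd bd] := pd M.
have [delta0 _ _] := sd.
have bdX : bounded_dec D k (X *m M *m Y) delta.
  have [Z [Z' [V [V' [eM hZ hV /andP[Z1 Z2] /andP[V1 V2]]]]]] := bd.
  have bnd n1 n2 n3 (G : 'M[R]_(n1, n2)) (H : 'M[R]_(n2, n3)) : nrm G <= Cp -> nrm H <= C -> nrm (G *m H) <= D.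
    move=> hG hH; apply: le_trans (nrm_mul _ _) (ler_pM (nrm_ge0 _) (nrm_ge0 _) hG _).
    by have := ler_norm C; lra.
  have bnd' n1 n2 n3 (G : 'M[R]_(n1, n2)) (H : 'M[R]_(n2, n3)) : nrm G <= C -> nrm H <= Cp -> nrm (G *m H) <= D.
    move=> hG hH; rewrite /D mulrC; apply: le_trans (nrm_mul _ _) (ler_pM (nrm_ge0 _) (nrm_ge0 _) _ hH).
    by have := ler_norm C; lra.
  exists (X *m Z), (Z' *m X'), (V *m Y), (Y' *m V'); split.
  - by rewrite {1}eM !mulmxA.
  - by rewrite mulmxA -(mulmxA Z') hX mulmx1.
  - by rewrite mulmxA -(mulmxA V) hY mulmx1.
  - by rewrite bnd' // bnd.
  - by rewrite bnd // bnd'.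
have [hb1a hb1b] := hb1 M delta sd bd (ltnW jk).
have [hb2a hb2b] := hb2 M delta sd bd jk.
have c1 := compound_nrm_gt0 (ltnW jk) Mu.
have c2 := compound_nrm_gt0 jk Mu.
move: hb1a hb1b hb2a hb2b; rewrite big_ord_recr /=.
have : 0 <= \prod_(l < j) delta l by apply: prodr_ge0.
move: (\prod_(l < j) delta l) => q q0 hb1a hb1b hb2a hb2b.
have qp : 0 < q by have := lt_le_trans c1 hb1a; rewrite pmulr_rgt0.
have dp : 0 < delta j by have := lt_le_trans c2 hb2a; rewrite pmulr_rgt0 // pmulr_rgt0.
have s1 := singval_le j sd bdX; have s2 := singval_ge sd bdX D0 kd jk.
rewrite -/E in s1 s2.
have sp : 0 < singval j.+1 (X *m M *m Y) by have := lt_le_trans dp s2; rewrite pmulr_rgt0.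
split=> //.
have e1 := ln_dist_le sp dp s1 s2.
have e2 := ln_dist_le c1 qp hb1a hb1b.
have qd : 0 < q * delta j by rewrite mulr_gt0.
have e3 := ln_dist_le c2 qd hb2a hb2b.
by move: e1 e2 e3; rewrite lnM ?posrE // !ler_norml => /andP[? ?] /andP[? ?] /andP[? ?]; apply/andP; split; lra.
Qed.

Lemma singval1_nrm n : (0 < n)%N -> exists2 E : R, 0 < E & forall M : 'M[R]_n,
  singval 1 M <= E * nrm M /\ nrm M <= E * singval 1 M.
Proof.
move=> n0; have [C C1 pd] := pivot_dec R n.
have C0 : 0 < C by lra.
have N0 : (0 : R) < n%:R by rewrite ltr0n.
pose E := (C * C * n%:R) * (C * C * n%:R).
have E0 : 0 < E by rewrite /E !mulr_gt0.
exists E => // M; have [delta sd bd] := pd M; have [delta0 dmon _] := sd.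
have s1 := singval_le 0 sd bd; have s2 := singval_ge sd bd C0 (leqnn _) n0.
have [X [X' [Y [Y' [eM hX hY /andP[X1 X2] /andP[Y1 Y2]]]]]] := bd.
have [b1 b2] := nrm_conj_bounds (ndiag n delta) hX hY X1 X2 Y1 Y2; rewrite -eM in b1 b2.
have dd : nrm (ndiag n delta) <= n%:R * delta 0%N.
  rewrite /nrm (eq_bigr (fun l : 'I_n => delta l)); last first.
    move=> l _; rewrite (bigD1 l) //= big1 => [|l' nl]; first by rewrite !mxE eqxx mulr1n addr0 ger0_norm.
    by rewrite !mxE eq_sym (negbTE nl) mulr0n normr0.
  rewrite -[X in X%:R * _]card_ord -sum1_card natr_sum mulr_suml; apply: ler_sum => l _.
  by rewrite mul1r; exact: dmon.
have dn : delta 0%N <= nrm (ndiag n delta).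
  have := entry_le_nrm (ndiag n delta) (Ordinal n0) (Ordinal n0).
  by rewrite !mxE eqxx mulr1n ger0_norm.
have CC : 0 <= C * C by rewrite mulr_ge0 // ltW.
have n1 : (1 : R) <= n%:R by rewrite ler1n.
have CCn : 0 <= C * C * n%:R by rewrite mulr_ge0 // ltW.
have e (x : R) : E * x = C * C * n%:R * (C * C * n%:R * x) by rewrite /E -mulrA.
rewrite !e; split.
  apply: le_trans s1 _; apply: ler_wpM2l => //.
  apply: le_trans dn (le_trans b2 _); rewrite ler_wpM2r ?nrm_ge0 //.
  by rewrite ler_peMr.
by apply: le_trans b1 _; apply: le_trans (ler_wpM2l CC dd) _; rewrite (mulrA (C * C)); exact: ler_wpM2l.
Qed.

(** The bound for [kap] is regrouped by moving [delta i.+1] from the short product to the long one: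
    the result is the product of the first i entries times that of the first i.+2. *)
Lemma kap_compound_le k i : (i.+1 < k)%N -> exists2 C : R, 0 < C & forall M : 'M[R]_k,
  kap (compound i.+1 M) <= C * (nrm (compound i M) * nrm (compound i.+2 M)).
Proof.
move=> ik; have [Cp Cp1 pd] := pivot_dec R k.
have [C1 C10 hb1] := bounded_dec_compound Cp k k i.
have [C2 C20 hb2] := bounded_dec_compound Cp k k i.+2.
have [C3 C30 hb3] := bounded_dec_kap Cp k i.
exists (C3 * (C1 * C2)) => [|M]; first by rewrite !mulr_gt0.
have [delta sd bd] := pd M; have [delta0 _ _] := sd.
have i1 := ltnW ik; have i2 := ltnW i1.
have [_ h1] := hb1 M delta sd bd i2; have [_ h2] := hb2 M delta sd bd ik.
apply: le_trans (hb3 M delta sd bd i1) _; rewrite -mulrA; apply: ler_wpM2l; first exact: ltW.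
have e : \prod_(j < i.+2) delta j = (\prod_(j < i.+1) delta j) * delta i.+1 by rewrite big_ord_recr.
rewrite mulrCA -e mulrACA.
by apply: ler_pM => //; apply: prodr_ge0.
Qed.

Lemma rate_gap (f0 f1 f2 : nat -> R) l0 l1 l2 C :
  has_rate f0 l0 -> has_rate f1 l1 -> has_rate f2 l2 -> l2 - l1 < l1 - l0 -> 0 < C ->
  exists N, forall n, (N <= n)%N ->
    C * (expR (f0 n) * expR (f2 n)) <= expR (- ((2 * l1 - l0 - l2) / 2)) ^+ n * expR (f1 n) ^+ 2.
Proof.
move=> h0 h1 h2 hl C0; set g := 2 * l1 - l0 - l2; have g0 : 0 < g by rewrite /g; lra.
(* The four errors of size n g / 16 and ln C, at most n g / 4, use up half of the decay n g. *)
have e0 : 0 < g / 16 by rewrite divr_gt0.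
have [N0 H0] := h0 _ e0; have [N1 H1] := h1 _ e0; have [N2 H2] := h2 _ e0.
have [N3 H3] := archi_above (ln C / (g / 4)).
exists (N0 + N1 + N2 + N3)%N => n hn.
have {}H0 := H0 n (leq_trans (leq_trans (leq_addr _ _) (leq_trans (leq_addr _ _) (leq_addr _ _))) hn).
have {}H1 := H1 n (leq_trans (leq_trans (leq_addl _ _) (leq_trans (leq_addr _ _) (leq_addr _ _))) hn).
have {}H2 := H2 n (leq_trans (leq_trans (leq_addl _ _) (leq_addr _ _)) hn).
have {}H3 : ln C <= n%:R * (g / 4).
  by rewrite -ler_pdivrMr ?divr_gt0 // (le_trans (ltW H3)) // ler_nat (leq_trans _ hn) // leq_addl.
rewrite -[C]lnK ?posrE // -!expRD -!expRM_natl -expRD ler_expR.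
move: H0 H1 H2 H3; rewrite !ler_norml => /andP[_ a0] /andP[a1 _] /andP[_ a2] a3.
have a4 : n%:R * g = n%:R * l1 * 2 - n%:R * l0 - n%:R * l2 by rewrite /g; ring.
rewrite mulrN mulrA; lra.
Qed.

End SingularValueGrowth.

(** * Exponents of a factored cocycle *)

Section ConstantRank.
Variables (R : realType) (m : nat) (p : 'I_m.+1 -> R).
Hypotheses (p_pos : forall j, 0 < p j) (p_sum : \sum_j p j = 1).
Variables (P : probability (Xspace m) R) (P_bern : is_bernoulli p P).
Local Notation word := (nat -> letter m).
Variables (d k : nat) (C : R).

Definition transfer (Q : 'I_m.+1 -> 'M[R]_(d, k)) (W : 'I_m.+1 -> 'M[R]_(k, d)) i a b :=
  compound i (W a *m Q b).

Lemma Mprod_unit q (T : 'I_m.+1 -> 'I_m.+1 -> 'M[R]_q) : (forall a b, T a b \in unitmx) ->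
  forall n b w, Mprod T n b w \in unitmx.
Proof. by move=> Tu; elim=> [|n IH] b w /=; rewrite ?unitmx1 // unitmx_mul IH Tu. Qed.

Lemma iterB_ext (B : cocycle R m d) i n w : iterB (ext_cocycle i B) n w = extpow i (iterB B n w).
Proof.
rewrite -compound_extpow; elim: n => [|n IH] /=; first by rewrite compound1.
by rewrite IH compound_mul.
Qed.

Lemma transfer_unit (B : cocycle R m d) Q W i a b : factored C B Q W -> transfer Q W i a b \in unitmx.
Proof. by move=> [_ tu _]; exact: compound_unit. Qed.

Lemma ext_growth i : (i <= k)%N -> exists K : R, forall (B : cocycle R m d) Q W, factored C B Q W ->
  forall n w, 0 < nrm (extpow i (iterB B n.+1 w)) /\
    `|ln (nrm (extpow i (iterB B n.+1 w))) - growth (transfer Q W i) n w| <= K.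
Proof.
move=> ik.
have [C1 C10 hC1] := @compound_bound R i d k C.
have [C2 C20 hC2] := @compound_bound R i k d C.
pose D := C1 + C2.
exists (ln (D * D)) => B Q W hB n w.
have [fB tu inv] := hB.
have [Q' [W1' [hQ _ /andP[Q1 Q2] _]]] := inv (lastl n (w 0%N) (wshift 1 w)).
have [Q1' [W' [_ hW _ /andP[W1 W2]]]] := inv (w 0%N).
rewrite (iterB_factored fB) -compound_extpow !compound_mul compound_Mprod.
have h x : x <= C1 \/ x <= C2 -> x <= D by rewrite /D => -[]; lra.
have := @nrm_conj_bounds R D _ _ (compound i (Q (lastl n (w 0%N) (wshift 1 w)))) (compound i Q')
  (compound i (W (w 0%N))) (compound i W') (Mprod (transfer Q W i) n (w 0%N) (wshift 1 w)).
rewrite -!compound_mul hQ hW !compound1 => /(_ erefl erefl) [].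
- by apply: h; left; exact: hC1.
- by apply: h; right; exact: hC2.
- by apply: h; right; exact: hC2.
- by apply: h; left; exact: hC1.
move=> b1 b2.
have g0 : 0 < nrm (Mprod (transfer Q W i) n (w 0%N) (wshift 1 w)).
  apply: Mprod_nrm_gt0; first exact: card_isub_gt0.
  by move=> a b; exact: transfer_unit hB.
have D0 : 0 <= D * D by rewrite mulr_ge0 // addr_ge0.
have e0 : 0 < nrm (compound i (Q (lastl n (w 0%N) (wshift 1 w))) *m
    Mprod (transfer Q W i) n (w 0%N) (wshift 1 w) *m compound i (W (w 0%N))).
  rewrite lt_neqAle nrm_ge0 andbT eq_sym; apply/eqP => e.
  by move: b2; rewrite e mulr0 leNgt g0.
by split=> //; exact: ln_dist_le.
Qed.

Section Factored.
Variables (B : cocycle R m d) (Q : 'I_m.+1 -> 'M[R]_(d, k)) (W : 'I_m.+1 -> 'M[R]_(k, d)).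
Hypotheses (hkd : (k <= d)%N) (hB : factored C B Q W).

Definition growth_rate i (l : R) : Prop :=
  {ae P, forall om : Xspace m, has_rate (fun n => growth (transfer Q W i) n om) l}.

Lemma ex_growth_rate i : (i <= k)%N -> exists l, growth_rate i l.
Proof.
move=> ik; apply: (furstenberg_kesten p_pos p_sum P_bern (card_isub_gt0 ik)).
by move=> a b; exact: transfer_unit hB.
Qed.

Lemma growth_rate0 l : growth_rate 0 l -> l = 0.
Proof.
move=> /ae_exists[om h]; apply: (has_rate_unique h) => e e0; exists 0%N => n _.
rewrite mulr0 subr0 /growth /transfer -compound_Mprod.
have -> : compound 0 (Mprod (fun a b => W a *m Q b) n (om 0%N) (wshift 1 om)) = 1%:M.
  rewrite -(compound1 _ 0 k); apply/matrixP => r c; rewrite !mxE /cminor.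
  by rewrite !det_mx00.
rewrite nrm1 (_ : #|_| = 1%N) ?ln1 ?normr0 ?mulr_ge0 // ?ltW //.
rewrite card_sig -[RHS](cards1 (@finset.set0 'I_k)); apply: eq_card => S.
by rewrite !inE cards_eq0.
Qed.

Lemma lyap_factored (l l' : R) j : (j < k)%N -> growth_rate j l -> growth_rate j.+1 l' ->
  lyap P B j.+1 = (l' - l)%:E.
Proof.
move=> jk h h'; apply: lyap_eq; have [K hK] := singval_compound C hkd jk.
apply: ae_mono (ae_and h h') => om [r r'].
have [fB tu inv] := hB.
have key n : 0 < singval j.+1 (iterB B n.+1 om) /\ `|ln (singval j.+1 (iterB B n.+1 om)) -
    (growth (transfer Q W j.+1) n om - growth (transfer Q W j) n om)| <= K.
  rewrite (iterB_factored fB) /growth /transfer -!compound_Mprod.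
  have [Q' [W1' [hQ _ Q1 _]]] := inv (lastl n (om 0%N) (wshift 1 om)).
  have [Q1' [W' [_ hW _ W1]]] := inv (om 0%N).
  by apply: hK hQ hW Q1 W1 _; exact: Mprod_unit.
apply: (logE_cvg (fun n => (key n).1) (fun n => (key n).2)).
exact: has_rate_sub.
Qed.

Lemma lyap_ext i (l : R) : (i <= k)%N -> growth_rate i l -> lyap P (ext_cocycle i B) 1 = l%:E.
Proof.
move=> ik h; apply: lyap_eq; have [K hK] := ext_growth ik.
have [E E0 hE] := singval1_nrm R (card_isub_gt0 (leq_trans ik hkd)).
apply: ae_mono h => om r.
have key n : 0 < singval 1 (iterB (ext_cocycle i B) n.+1 om) /\
    `|ln (singval 1 (iterB (ext_cocycle i B) n.+1 om)) - growth (transfer Q W i) n om| <= ln E + K.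
  rewrite iterB_ext; have [g0 gK] := hK B Q W hB n om.
  have [e1 e2] := hE (extpow i (iterB B n.+1 om)).
  have s0 : 0 < singval 1 (extpow i (iterB B n.+1 om)).
    by have := lt_le_trans g0 e2; rewrite pmulr_rgt0.
  split=> //; have := ln_dist_le s0 g0 e1 e2; move: gK.
  by rewrite !ler_norml => /andP[? ?] /andP[? ?]; apply/andP; split; lra.
exact: (logE_cvg (fun n => (key n).1) (fun n => (key n).2) r).
Qed.

Lemma lyap_sum i (l : R) : (i <= k)%N -> growth_rate i l ->
  (\sum_(1 <= j < i.+1) lyap P B j)%E = l%:E.
Proof.
elim: i l => [|i IH] l ik hl; first by rewrite big_geq // (growth_rate0 hl).
have [l' hl'] := ex_growth_rate (ltnW ik).
rewrite big_nat_recr //= (IH l' (ltnW ik) hl') (lyap_factored ik hl' hl) -EFinD.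
by congr EFin; ring.
Qed.

Lemma gap_of_lyap i : (0 < i)%N -> (i <= k)%N -> (lyap P B i.+1 < lyap P B i)%E ->
  exists r : R, [/\ 0 < r, r < 1 & forall eta, 0 < eta -> exists n0, forall N b,
    Prob p N (fun w => ~ gap_event (transfer Q W i) r n0 N b w) <= eta].
Proof.
case: i => // i _ ik hl.
have [r [r0 r1 hr]] : exists r : R, [/\ 0 < r, r < 1 & {ae P, forall om : Xspace m, exists N, forall n, (N <= n)%N ->
    kap (Mprod (transfer Q W i.+1) n (om 0%N) (wshift 1 om)) <=
    r ^+ n * nrm (Mprod (transfer Q W i.+1) n (om 0%N) (wshift 1 om)) ^+ 2}].
  (* For i.+1 = k the compound is a scalar and its [kap] is 0, so any r in (0, 1) serves. *)
  have [ik'|ik'] := ltnP i.+1 k; last first.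
    have ei : i.+1 = k by apply/anti_leq; rewrite ik.
    exists 2^-1; split; [by rewrite invr_gt0 | by rewrite invf_lt1 // ltr1n |].
    apply: (@ae_mono _ _ _ setT); last by apply: aeW.
    move=> om _; exists 0%N => n _; rewrite /transfer -compound_Mprod.
    rewrite (_ : kap _ = 0); first by rewrite mulr_ge0 ?exprn_ge0 ?nrm_ge0 // invr_ge0.
    by move: (Mprod _ _ _ _); rewrite ei => M; exact: kap_compound_full.
  have [l0 h0] := ex_growth_rate (ltnW ik).
  have [l1 h1] := ex_growth_rate ik.
  have [l2 h2] := ex_growth_rate ik'.
  move: hl; rewrite (lyap_factored ik h0 h1) (lyap_factored ik' h1 h2) lte_fin => hl.
  have [C0 C00 hC0] := kap_compound_le R ik'.
  exists (expR (- ((2 * l1 - l0 - l2) / 2))); split; first exact: expR_gt0.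
    by rewrite expR_lt1; lra.
  apply: ae_mono (ae_and h0 (ae_and h1 h2)) => om [r0 [r1 r2]].
  have [N hN] := rate_gap r0 r1 r2 hl C00.
  exists N => n Nn; have := hN n Nn; rewrite /growth !lnK ?posrE.
  - rewrite /transfer -!compound_Mprod; exact: le_trans (hC0 _).
  - apply: Mprod_nrm_gt0 => [|a b]; last exact: transfer_unit hB.
    by apply: card_isub_gt0; rewrite ?ik ?ik' ?(ltnW ik).
  - apply: Mprod_nrm_gt0 => [|a b]; last exact: transfer_unit hB.
    by apply: card_isub_gt0; rewrite ?ik ?ik' ?(ltnW ik).
  - apply: Mprod_nrm_gt0 => [|a b]; last exact: transfer_unit hB.
    by apply: card_isub_gt0; rewrite ?ik ?ik' ?(ltnW ik).
(* The almost sure gap averages over the initial letter; conditioning on one letter b costs 1 / p b,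
   hence the target c0 * eta. *)
exists r; split=> // eta eta0; have [c0 c00 hc0] := fin_lower_bound p_pos.
pose G n : set (Xspace m) := fun w => kap (Mprod (transfer Q W i.+1) n (w 0%N) (wshift 1 w)) <=
    r ^+ n * nrm (Mprod (transfer Q W i.+1) n (w 0%N) (wshift 1 w)) ^+ 2.
have dG n : depends n.+1 (G n : word -> Prop).
  move=> w w' ww'; rewrite /G ww' // (@Mprod_depends _ _ _ _ _ _ (wshift 1 w) (wshift 1 w')) //.
  by move=> t tn; rewrite /wshift; exact: ww'.
have [n0 hn0] := ae_uniform P_bern dG (mulr_gt0 c00 eta0) hr.
exists n0 => N b; rewrite -(ler_pM2l c00); apply: le_trans (hn0 N).
apply: (@le_trans _ _ (p b * Prob p N (fun w => ~ gap_event (transfer Q W i.+1) r n0 N b w))).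
  by rewrite ler_wpM2r ?hc0 //; exact: Prob_ge0.
exact: (Prob_first p_pos p_sum N (fun w => ~ forall n, (n0 <= n <= N)%N -> G n w) b).
Qed.

End Factored.
End ConstantRank.

(** * The theorem *)

Section LargeDeviationsToRates.
Variables (R : realType) (m : nat) (p : 'I_m.+1 -> R).
Hypotheses (p_pos : forall j, 0 < p j) (p_sum : \sum_j p j = 1).
Variables (P : probability (Xspace m) R) (P_bern : is_bernoulli p P).
Local Notation word := (nat -> letter m).

Lemma Prob_average n (A : word -> Prop) x : (forall b, Prob p n (fun w => A (scons b w)) <= x) ->
  Prob p n.+1 A <= x.
Proof.
move=> h; rewrite /Prob /= -[leRHS]mul1r -p_sum mulr_suml; apply: ler_sum => b _.
by apply: ler_wpM2l; [exact: ltW | exact: h].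
Qed.

Lemma iterB_depends N (B : cocycle R m N) n : depends n (iterB B n).
Proof.
elim: n => [//|n IH] w w' ww' /=; rewrite (IH w w') ?ww' // => t tn.
by apply: ww'; exact: ltnW.
Qed.

Variables (q : nat) (T : 'I_m.+1 -> 'I_m.+1 -> 'M[R]_q) (K c L : R) (D : R).
Hypotheses (c0 : 0 < c)
  (ldt : forall n b y, 0 <= y -> y <= 1 ->
    Prob p n (fun w => K + n%:R * y <= `|ln (nrm (Mprod T n b w)) - n%:R * L|) <= D * expR (- (n%:R * c * y ^+ 2))).

Lemma growth_ldt n y : 0 <= y -> y <= 1 ->
  Prob p n.+1 (fun w => K + n%:R * y <= `|growth T n w - n%:R * L|) <= D * expR (- (n%:R * c * y ^+ 2)).
Proof. by move=> y0 y1; apply: Prob_average => b; exact: ldt. Qed.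

(** The deviation probabilities are summable, so by Borel-Cantelli growth is eventually near n L on
    almost every word, where it must match the almost sure limit. *)
Lemma ldt_rate l : {ae P, forall om : Xspace m, has_rate (fun n => growth T n om) l} -> l = L.
Proof.
move=> hl; apply/eqP; rewrite -subr_eq0 -normr_le0; apply/ler_addgt0Pl => e e0; rewrite addr0.
pose y := Num.min 1 (e / 4).
have y0 : 0 < y by rewrite lt_min ltr01 divr_gt0.
have y1 : y <= 1 by rewrite ge_min lexx.
have ye : y <= e / 4 by rewrite ge_min lexx orbT.
pose A n : set (Xspace m) := fun w => K + n%:R * y <= `|growth T n w - n%:R * L|.
have dA n : depends n.+1 (A n : word -> Prop).
  by move=> w w' ww'; rewrite /A (growth_depends T ww').
have hA : {ae P, forall om : Xspace m, exists N, forall n, (N <= n)%N -> ~ A n om}.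
  apply: (@ae_eventually_not _ _ P A D (expR (- (c * y ^+ 2)))); first exact: expR_ge0.
  - by rewrite expR_lt1 oppr_lt0 mulr_gt0 // exprn_gt0.
  - by move=> n; exact: (word_event P_bern (@dA n)).1.
  - move=> n; rewrite (word_event P_bern (@dA n)).2 lee_fin -expRM_natl mulrN mulrA.
    exact: growth_ldt (ltW y0) y1.
have [om [h1 [N hN]]] := ae_exists (ae_and hl hA).
have [N' hN'] := h1 y y0.
have [M hM] := archi_above (K / y).
pose n := (N + N' + M).+1.
have n1 : `|growth T n om - n%:R * l| <= n%:R * y.
  by apply: hN'; apply: leqW; exact: leq_trans (leq_addl N N') (leq_addr M _).
have n2 : `|growth T n om - n%:R * L| < K + n%:R * y.
  rewrite ltNge; apply/negP; apply: hN; apply: leqW; rewrite -addnA; exact: leq_addr.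
have n3 : K <= n%:R * y.
  rewrite -ler_pdivrMr // (le_trans (ltW hM)) // ler_nat.
  by apply: leqW; exact: leq_addl.
have n0 : (0 : R) < n%:R by rewrite ltr0n.
rewrite -(ler_pM2l n0) -[X in X * `|_|]ger0_norm ?ltW // -normrM mulrBr.
have := ler_normB (growth T n om - n%:R * L) (growth T n om - n%:R * l).
rewrite (_ : growth T n om - n%:R * L - (growth T n om - n%:R * l) = n%:R * l - n%:R * L); last by ring.
have n4 : n%:R * y <= n%:R * (e / 4) by rewrite ler_wpM2l // ltW.
have n5 : 0 < n%:R * e by rewrite mulr_gt0.
by move: n1 n2 n3 n4 n5; lra.
Qed.

(** Outer factors and the passage from n transitions to n.+1 letters cost a constant K5. For n eps
    large it is absorbed by using eps / 2, hence the rate c / 4. *)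
Lemma uniform_ldt K4 (X : nat -> word -> R) n eps : 0 <= K -> 0 <= K4 -> 0 <= D ->
  (forall n, depends n (X n)) ->
  (forall n w, 0 < X n.+1 w /\ `|ln (X n.+1 w) - growth T n w| <= K4) ->
  (0 < n)%N -> 0 < eps -> eps < 1 ->
  (P [set om : Xspace m | (`| ((n%:R)^-1)%:E * logE (X n om) - L%:E | > eps%:E)%E] <=
    ((D + 1) * expR ((2 * (K + K4 + `|L|) + 1) * (c / 4)) * expR (- (n%:R * (c / 4) * eps ^+ 2)))%:E)%E.
Proof.
move=> K0 K40 D0 dX hX; case: n => // n _ e0 e1.
pose E : set (Xspace m) := [set om : Xspace m | (`| ((n.+1%:R)^-1)%:E * logE (X n.+1 om) - L%:E | > eps%:E)%E].
have dE : depends n.+1 (E : word -> Prop) by move=> w w' ww'; rewrite /E /= (dX n.+1 w w').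
rewrite (word_event P_bern dE).2 lee_fin.
set K5 := K + K4 + `|L|.
have K50 : 0 <= K5 by rewrite !addr_ge0.
have n0 : (0 : R) < n.+1%:R by rewrite ltr0n.
have c4 : 0 < c / 4 by rewrite divr_gt0.
have ee : eps ^+ 2 <= 1 by rewrite expr_le1 // ltW.
have nee : 0 <= n%:R * eps by rewrite mulr_ge0 // ltW.
rewrite -mulrA -expRD.
(* For n eps < 2 K5 the claimed bound is at least 1, because the exponential prefactor compensates
   the decay. *)
have [hn|hn] := leP K5 (n%:R * (eps / 2)); last first.
  apply: le_trans (Prob_le1 p_pos p_sum _ _) _.
  apply: (@le_trans _ _ (1 * 1)); first by rewrite mulr1.
  apply: ler_pM => //; first by rewrite lerDr.
  rewrite -[leLHS]expR0 ler_expR -[n.+1%:R]natr1.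
  have h : (n%:R + 1) * eps ^+ 2 <= 2 * K5 + 1.
    have : n%:R * eps ^+ 2 <= n%:R * eps by rewrite expr2 mulrA ler_piMr // ltW.
    by move: hn ee; lra.
  have := ler_wpM2r (ltW c4) h; lra.
have sub w : E w -> K + n%:R * (eps / 2) <= `|growth T n w - n%:R * L|.
  have [X0 XK] := hX n w.
  rewrite /E /= /logE leNgt X0 /= lte_fin => h.
  have {}h : n.+1%:R * eps < `|ln (X n.+1 w) - n.+1%:R * L|.
    have -> : ln (X n.+1 w) - n.+1%:R * L = n.+1%:R * (n.+1%:R^-1 * ln (X n.+1 w) - L).
      by rewrite mulrBr mulVKf // gt_eqF.
    by rewrite normrM ger0_norm ?ltW // ltr_pM2l.
  move: h; rewrite -[n.+1%:R]natr1 => h.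
  have t1 := ler_normD (ln (X n.+1 w) - growth T n w) (growth T n w - n%:R * L - L).
  have t2 := ler_normB (growth T n w - n%:R * L) L.
  have t3 : ln (X n.+1 w) - growth T n w + (growth T n w - n%:R * L - L) = ln (X n.+1 w) - (n%:R + 1) * L.
    by ring.
  rewrite t3 in t1.
  by move: t1 t2 h XK hn; rewrite /K5; lra.
apply: le_trans (Prob_le p_pos n.+1 sub) _.
have y0 : 0 <= eps / 2 by rewrite divr_ge0 // ltW.
have y1 : eps / 2 <= 1 by lra.
apply: le_trans (growth_ldt n y0 y1) _.
apply: ler_pM; rewrite ?expR_ge0 ?lerDl //.
rewrite ler_expR -[n.+1%:R]natr1.
have t3 : (c / 4) * eps ^+ 2 <= c / 4 by rewrite ler_piMr // ltW.
have t4 : 0 <= 2 * K5 * (c / 4) by rewrite !mulr_ge0 // ltW.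
rewrite (_ : n%:R * c * (eps / 2) ^+ 2 = n%:R * ((c / 4) * eps ^+ 2)); last by field.
by move: t3 t4; rewrite -/K5; lra.
Qed.

End LargeDeviationsToRates.

Lemma rate_bound (R : realType) m (p : 'I_m.+1 -> R) (p_pos : forall j, 0 < p j) (p_sum : \sum_j p j = 1)
  q (T : 'I_m.+1 -> 'I_m.+1 -> 'M[R]_q) Lam K L : (0 < q)%N -> 1 <= Lam -> tame Lam T ->
  (forall n b (v : 'cV[R]_q), v != 0 -> `|log_growth p T n b v - n%:R * L| <= K) -> `|L| <= ln Lam + K.
Proof.
move=> q0 Lam1 hT hL.
pose v : 'cV[R]_q := delta_mx (Ordinal q0) 0.
have v0 : v != 0 by rewrite -nrm_gt0 nrm_delta.
have h1 := hL 1%N ord0 v v0.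
have h2 : `|log_growth p T 1 ord0 v| <= 1%:R * ln Lam.
  by apply: (Ex_norm_le p_pos p_sum) => w; exact: (ln_Mprod_le Lam1 hT).
have := ler_normB (log_growth p T 1 ord0 v) (log_growth p T 1 ord0 v - 1%:R * L).
rewrite opprB addrCA subrr addr0 !mul1r; rewrite !mul1r in h1 h2; lra.
Qed.

Theorem theorem2p5 (R : realType) (m d : nat)
  (p : 'I_m.+1 -> R) (p_pos : forall j, 0 < p j) (p_sum : \sum_j p j = 1)
  (P : probability (Xspace m) R) (P_bern : is_bernoulli p P)
  (A : cocycle R m d) (i k : nat)
  (hi : (1 <= i)%N) (hik : (i <= k)%N) (hkd : (k <= d)%N)
  (h1 : forall a, \rank (A a) = k)
  (h2 : forall a b, \rank (A a *m A b) = k)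
  (h3 : (lyap P A i.+1 < lyap P A i)%E)
  (h4 : irreducible_cocycle (ext_cocycle i A)) :
  (* (a) uniform large deviations estimate on a neighborhood of A in C_k(d) *)
  (exists delta eps0 C c : R,
     [/\ 0 < delta, 0 < eps0, 0 < c &
     forall B : cocycle R m d,
       (forall a, \rank (B a) = k) -> cdist B A < delta ->
       forall (n : nat) (eps : R), (0 < n)%N -> 0 < eps -> eps < eps0 ->
         (P [set om : Xspace m |
               (`| ((n%:R)^-1)%:E * logE (opnorm (extpow i (iterB B n om)))
                   - lyap P (ext_cocycle i B) 1 | > eps%:E)%E]
          <= (C * expR (- (n%:R * c * eps ^+ 2)))%:E)%E]) /\
  (* (b) B |-> L_1(B) + ... + L_i(B) is Hoelder continuous near A in C_k(d) *)
  (exists delta C alpha : R,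
     [/\ 0 < delta, 0 < alpha, alpha <= 1 &
     forall B B' : cocycle R m d,
       (forall a, \rank (B a) = k) -> (forall a, \rank (B' a) = k) ->
       cdist B A < delta -> cdist B' A < delta ->
       (`| (\sum_(1 <= j < i.+1) lyap P B j) - (\sum_(1 <= j < i.+1) lyap P B' j) |
          <= (C * (cdist B B') `^ alpha)%:E)%E]).
Proof.
have [d1 [C [CL [Q [W [d10 C0 CL0 hF]]]]]] := factor_near h1 h2.
have cAA : cdist A A = 0.
  rewrite /cdist big1 ?sqrtr0 // => a _; rewrite big1 // => r _; rewrite big1 // => s _.
  by rewrite subrr expr0n.
have cd0 B B' : 0 <= cdist B B' :> R by exact: sqrtr_ge0.
have [fA _] : factored C A (Q A) (W A) /\ True by split => //; have [] := hF A h1; rewrite ?cAA.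
set q := #|{: isub k i}|.
have q0 : (0 < q)%N by exact: card_isub_gt0.
pose T B := transfer (Q B) (W B) i.
have [r [r0 r1 gap]] := gap_of_lyap p_pos p_sum P_bern hkd fA hi hik h3.
have TuA a b : T A a b \in unitmx by exact: transfer_unit fA.
have [Lam [Lam1 tA _]] := unit_tame TuA.
have Lam2 : 1 <= 2 * Lam by lra.
have [n0 [al [kp [d2 [[n00 al0 al1 kp1 [d20 d21]] adm]]]]] :=
  contraction_open p_pos p_sum Lam1 tA q0 r0 r1 gap (irreducible_transfer fA h4).
have [C3 C30 hC3] := compound_lip i k k (C * C).
pose D := C3 * CL + 1.
have D1 : 1 <= D by rewrite lerDr mulr_ge0.
have D0 : 0 < D by exact: lt_le_trans ltr01 D1.
have Tlip B B' : (forall a, \rank (B a) = k) -> (forall a, \rank (B' a) = k) ->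
    cdist B A < d1 -> cdist B' A < d1 -> forall a b, nrm (T B a b - T B' a b) <= D * cdist B B'.
  move=> rB rB' hB hB' a b.
  have tb B0 : factored C B0 (Q B0) (W B0) -> nrm (W B0 a *m Q B0 b) <= C * C.
    move=> [_ _ inv]; have [? [? [_ _ _ /andP[w1 _]]]] := inv a.
    have [? [? [_ _ /andP[q1 _] _]]] := inv b.
    exact: le_trans (nrm_mul _ _) (ler_pM (nrm_ge0 _) (nrm_ge0 _) w1 q1).
  have [fB hBB] := hF B rB hB; have [fB' _] := hF B' rB' hB'.
  apply: le_trans (hC3 _ _ (tb B fB) (tb B' fB')) _.
  apply: le_trans (ler_wpM2l C30 (hBB B' rB' hB' a b)) _.
  by rewrite mulrA ler_wpM2r // lerDl.
(* Within d3 the factorization is valid and the transition matrices move by at most d2, the radius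
   of [contraction_open]. *)
pose d3 := Num.min d1 (d2 / D).
have d30 : 0 < d3 by rewrite lt_min d10 divr_gt0.
have d31 x : x < d3 -> x < d1 by move=> h; apply: lt_le_trans h _; rewrite ge_min lexx.
have Tadm B : (forall a, \rank (B a) = k) -> cdist B A < d3 -> admissible p (2 * Lam) n0 al kp (T B).
  move=> rB hB; apply: adm => a b; apply: le_trans (Tlip B A rB h1 (d31 _ hB) _ a b) _; first by rewrite cAA.
  rewrite mulrC -ler_pdivlMr // (le_trans (ltW hB)) // ge_min lexx orbT //.
have [K K0 hK] := lyapunov_rate p_pos p_sum q Lam2 n00 al0 al1 kp1.
have [c c0 hc] := large_deviations p_pos p_sum q Lam2 n00 al0 al1 kp1.
have [Ch Ch0 hh] := rate_holder p_pos p_sum q Lam2 n00 al0 al1 kp1.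
have q1 : 1 <= q%:R :> R by rewrite ler1n.
have lnq : 0 <= ln (q%:R : R) by exact: ln_ge0.
have lnLam : 0 <= ln (2 * Lam) by exact: ln_ge0.
pose K' := K + ln q%:R.
have K'0 : 0 <= K' by rewrite addr_ge0.
have rate B : (forall a, \rank (B a) = k) -> cdist B A < d3 -> exists L : R,
    [/\ growth_rate P (Q B) (W B) i L,
      forall n b (v : 'cV[R]_q), v != 0 -> `|log_growth p (T B) n b v - n%:R * L| <= K &
      `|L| <= ln (2 * Lam) + K].
  move=> rB hB; have aB := Tadm B rB hB; have [L hL] := hK _ aB.
  have [fB _] := hF B rB (d31 _ hB).
  have [l hl] := ex_growth_rate p_pos p_sum P_bern fB hik.
  exists L; split=> //; last exact: (rate_bound p_pos p_sum q0 Lam2 aB.1 hL).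
  have <- // : l = L.
  by apply: (ldt_rate p_pos p_sum P_bern c0 _ hl) => n b y y0 y1; exact: hc aB K L hL q0 n b y y0 y1.
split; last first.
  exists d3, (D `^ al * (Ch + 2 * (ln (2 * Lam) + K))), al; split => // B B' rB rB' hB hB'.
  have [L [hl hL Lb]] := rate B rB hB; have [L' [hl' hL' Lb']] := rate B' rB' hB'.
  have [fB _] := hF B rB (d31 _ hB); have [fB' _] := hF B' rB' (d31 _ hB').
  have C2 : 0 <= Ch + 2 * (ln (2 * Lam) + K) by rewrite addr_ge0 // mulr_ge0 // addr_ge0.
  rewrite [X in (_ - X)%E](lyap_sum p_pos p_sum P_bern hkd fB' hik hl').
  (* [rate_holder] takes a positive delta; distance 0 means B = B'. *)
  have [e|e] := eqVneq (cdist B B') 0.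
    have eB : B = B'.
      apply/funext => a; apply/matrixP => s t; apply/eqP; rewrite -subr_eq0 -normr_le0 -e.
      exact: entry_le_cdist.
    rewrite eB [X in (X - _)%E](lyap_sum p_pos p_sum P_bern hkd fB' hik hl') -EFinB subrr abse_EFin normr0 lee_fin.
    by rewrite !mulr_ge0 // powR_ge0.
  rewrite [X in (X - _)%E](lyap_sum p_pos p_sum P_bern hkd fB hik hl) -EFinB abse_EFin lee_fin mulrAC -powRM //; last exact: ltW.
  set delta := D * cdist B B'; have delta0 : 0 < delta by rewrite mulr_gt0 // lt_neqAle eq_sym e cd0.
  (* For delta > 1 the uniform bound on |L| suffices, as delta to the power alpha is at least 1. *)
  have [dle|dgt] := leP delta 1.
    apply: le_trans (hh _ _ K L L' delta (Tadm B rB hB) (Tadm B' rB' hB') q0 delta0 dle _ hL hL') _.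
      by move=> a b; exact: Tlip (d31 _ hB) (d31 _ hB') a b.
    by rewrite mulrC ler_wpM2l ?powR_ge0 // lerDl mulr_ge0 // addr_ge0.
  apply: le_trans (ler_normB _ _) _; apply: (@le_trans _ _ (1 * (Ch + 2 * (ln (2 * Lam) + K)))).
    move: Lb Lb' Ch0; clear; lra.
  by rewrite ler_wpM2r // -[leLHS](powRr0 delta) ler_powR // ltW.
have [Kx hKx] := ext_growth m d C hik.
pose N : R := #|{: isub d i}|%:R.
have N1 : 1 <= N by rewrite ler1n; exact: card_isub_gt0 (leq_trans hik hkd).
have N0 : 0 < N by exact: lt_le_trans ltr01 N1.
pose K4 := ln (N * N) + Kx.
(* The uniform bound ln (2 Lam) + K stands in for |L|, so the constant does not depend on B. *)
pose E := (q%:R * 2 + 1) * expR ((2 * (K' + `|K4| + (ln (2 * Lam) + K)) + 1) * (c / 4)).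
exists d3, 1, E, (c / 4); split => //; first by rewrite divr_gt0.
move=> B rB hB n eps n_gt0 e0 e1.
have [L [hl hL Lb]] := rate B rB hB.
have [fB _] := hF B rB (d31 _ hB).
rewrite (lyap_ext hkd fB hik hl).
pose X n w : R := opnorm (extpow i (iterB B n w)).
have Xdep n' : depends n' (X n') by move=> w w' ww'; rewrite /X (iterB_depends B ww').
have Xg n' w : 0 < X n'.+1 w /\ `|ln (X n'.+1 w) - growth (T B) n' w| <= `|K4|.
  have [g0 g1] := hKx B _ _ fB n' w.
  have [nb1 nb2] := opnorm_bounds (extpow i (iterB B n'.+1 w)).
  have X0 : 0 < X n'.+1 w by have := lt_le_trans g0 nb2; rewrite pmulr_rgt0 ?mulr_gt0.
  split=> //; apply: le_trans (ler_norm _).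
  have nb3 : X n'.+1 w <= N * N * nrm (extpow i (iterB B n'.+1 w)).
    apply: le_trans nb1 _; rewrite mulrC -mulrA.
    by apply: ler_wpM2l; [exact: ltW | rewrite ler_peMl ?nrm_ge0].
  move: g1 (ln_dist_le X0 g0 nb3 nb2); rewrite /K4 /T; clear; rewrite !ler_norml => /andP[? ?] /andP[? ?].
  by apply/andP; split; lra.
have q20 : (0 : R) <= q%:R * 2 by rewrite mulr_ge0.
apply: le_trans (uniform_ldt p_pos p_sum P_bern c0 _ K'0 (normr_ge0 K4) q20 Xdep Xg n_gt0 e0 e1) _.
  by move=> n' b y y0 y1; exact: hc (Tadm B rB hB) K L hL q0 n' b y y0 y1.
rewrite lee_fin ler_wpM2r ?expR_ge0 // /E ler_wpM2l ?addr_ge0 // ler_expR; apply: ler_wpM2r.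
  by rewrite divr_ge0 // ltW.
by rewrite lerD2r ler_pM2l // lerD2l.
Qed.
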